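(* Let $\lambda=(\lambda_1>\lambda_2>\dots>\lambda_r>0)$ be a strict partition of length $r$. Under the identification $p_n\mapsto p_n(x)=x_1^n+x_2^n+\cdots$ $(n\ge 1)$, the $K$-theoretic $Q$-function $GQ_\lambda(x)$ satisfies $$GQ_\lambda(x)=\begin{cases}\langle 0|e^{\mathcal H^{(\beta)}}\phi^{(\beta)}_{\lambda_1}e^{\Theta}\phi^{(\beta)}_{\lambda_2}e^{\Theta}\cdots\phi^{(\beta)}_{\lambda_r}e^{\Theta}|0\rangle, & \text{if } r \text{ is even},\\[2pt] \langle 0|e^{\mathcal H^{(\beta)}}\phi^{(\beta)}_{\lambda_1}e^{\Theta}\phi^{(\beta)}_{\lambda_2}e^{\Theta}\cdots\phi^{(\beta)}_{\lambda_r}e^{\Theta}\phi^{(\beta)}_{0}e^{\Theta}|0\rangle, & \text{if } r \text{ is odd}.\end{cases}$$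
   Context: **Fermions.** $k=\mathbb Q(\beta)$ with $\beta$ an indeterminate; $[A,B]=AB-BA$, $[A,B]_+=AB+BA$. $\mathcal A$ is the unital associative $k$-algebra generated by $\phi_n$ ($n\in\mathbb Z$) with relations $[\phi_m,\phi_n]_+=2(-1)^m\delta_{m+n,0}$. $\mathcal F$ is the left $\mathcal A$-module generated by a vector $|0\rangle$ with $\phi_{-n}|0\rangle=0$ for $n>0$; it has $k$-basis $\phi_{n_1}\cdots\phi_{n_r}|0\rangle$ ($r\ge0$, $n_1>\dots>n_r\ge0$). $\mathcal E$ is the right $\mathcal A$-module generated by $\langle 0|$ with $\langle 0|\phi_n=0$ for $n>0$; it has $k$-basis $\langle0|\phi_{m_1}\cdots\phi_{m_r}$ ($r\ge0$, $0\ge m_1>\dots>m_r$). There is a bilinear pairing $\mathcal E\otimes_k\mathcal F\to k$, $\langle w|\otimes|v\rangle\mapsto\langle w|v\rangle$, determined by $\langle0|0\rangle=1$, $(\langle w|X)|v\rangle=\langle w|(X|v\rangle)$ for $X\in\mathcal A$, and $\langle0|\phi_0|0\rangle=0$. For odd $m\in\mathbb Z$, $b_m=\frac14\sum_{i\in\mathbb Z}(-1)^i\phi_{-i-m}\phi_i$ (acting on $\mathcal E$ and $\mathcal F$). **Deformed operators.** $\phi^{(\beta)}_n$ ($n\in\mathbb Z$) is defined by $\sum_{n\ge0}\phi^{(\beta)}_nz^n=\sum_{n\ge0}\phi_n(z+\frac\beta2)^n$ and $\sum_{n>0}\phi^{(\beta)}_{-n}z^{-n}=\sum_{n>0}\phi_{-n}\left(\frac{z^{-1}}{1+\frac\beta2z^{-1}}\right)^n$.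 These may be infinite sums but act on $\mathcal E$ from the right (on each vector only finitely many terms are nonzero). For $m\ge 1$, $b^{(\beta)}_m$ is obtained from the polynomial $\frac{(X-\frac\beta2)^m-(-X-\frac\beta2)^m}{2}$ by replacing $X^l\mapsto b_l$ (only odd $l$ occur). Put $\mathcal H^{(\beta)}=2\sum_{n\ge1}\frac{p_n}{n}b^{(\beta)}_n$ with commuting indeterminates $p_1,p_2,\dots$; $e^{\mathcal H^{(\beta)}}$ maps $\mathcal E$ to $\mathcal E[[p]]=\mathcal E[[p_1,p_2,\dots]]$. Put $\Theta=2\left(\frac\beta2b_{-1}+\frac{\beta^3}{2^3}\frac{b_{-3}}3+\frac{\beta^5}{2^5}\frac{b_{-5}}5+\cdots\right)$; $\Theta$ and $e^\Theta$ act on $\mathcal E$ from the right. An expression $\langle0|O_1O_2\cdots O_l|0\rangle$ means: apply $O_1$, then $O_2$, $\dots$, then $O_l$ to $\langle0|$ from the right, and pair the result (coefficientwise in the $p_i$) with $|0\rangle$. **$K$-theoretic $Q$-functions.** Let $x\oplus y=x+y+\beta xy$, $x\ominus y=\frac{x-y}{1+\beta y}$, $\overline x=0\ominus x=\frac{-x}{1+\beta x}$, $[[x]]^a=(2+\beta x)x^a$ for $a\ge1$, $[[x]]^0=1$. For $n\ge r$, $$GQ_\lambda(x_1,\dots,x_n)=\frac1{(n-r)!}\sum_{w\in S_n}w\left[[[x_1]]^{\lambda_1}\cdots[[x_r]]^{\lambda_r}\prod_{i=1}^r\prod_{j=i+1}^n\frac{x_i\oplus x_j}{x_i\ominus x_j}\right],$$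 and $GQ_\lambda(x)=GQ_\lambda(x_1,x_2,\dots)$ is the limit $n\to\infty$. The paper takes as its starting point the following known (Hudson–Ikeda–Matsumura–Naruse) description of $GQ_\lambda(x)$. One-row functions $GQ_n(x)$, $n\in\mathbb Z$, are given by $\sum_{n\in\mathbb Z}GQ_n(x)z^n=\frac1{1+\beta z^{-1}}\prod_{i\ge1}\frac{1+(z+\beta)x_i}{1+(z+\beta)\overline{x_i}}$ with $(1+\beta z^{-1})^{-1}=1-\beta z^{-1}+\beta^2z^{-2}-\cdots$. Let $r'$ be the smallest even integer $\ge r$. Then $GQ_\lambda(x)=\mathrm{Pf}(\tau_{i,j})_{1\le i<j\le r'}$ with $\tau_{i,j}=\sum_{p\ge0,\,p+q\ge0}f^{i,j}_{p,q}GQ_{\lambda_i+p}(x)GQ_{\lambda_j+q}(x)$ if $j\ne r+1$ and $\tau_{i,r+1}=\sum_{p\ge0}f^{i,r+1}_pGQ_{\lambda_i+p}(x)$, where $\frac{1}{(1+\beta t_i)^{r'-i}(1+\beta t_j)^{r'-j}}\frac{t_j-t_i}{t_i+t_j+\beta t_it_j}=\sum_{p\ge0,\,p+q\ge0}f^{i,j}_{p,q}t_i^pt_j^q$ (expanded for $|t_{r'}|>\dots>|t_1|$) and $\frac1{(1+\beta t_i)^{r'-i-1}}=\sum_{p\ge0}f^{i,r+1}_pt_i^p$. Here $\mathrm{Pf}(a_{i,j})_{1\le i<j\le 2s}=\sum_\sigma\mathrm{sgn}(\sigma)a_{\sigma(1),\sigma(2)}\cdots a_{\sigma(2s-1),\sigma(2s)}$,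 summed over $\sigma\in S_{2s}$ with $\sigma(1)<\sigma(3)<\dots<\sigma(2s-1)$ and $\sigma(2i-1)<\sigma(2i)$ for all $i$. *)

(* Defs.v *)
From HB Require Import structures.
From mathcomp Require Import all_boot all_order all_algebra perm.
From mathcomp Require Import fraction finmap.
From mathcomp Require Import boolp classical_sets fsbigop.
From mathcomp.multinomials Require Import monalg.
From mathcomp.multinomials Require Import mpoly.

Set Implicit Arguments.
Unset Strict Implicit.
Unset Printing Implicit Defensive.

Import Order.TTheory GRing.Theory Num.Theory.

Local Open Scope classical_set_scope.
Local Open Scope ring_scope.

Notation Qbeta := {fraction {poly rat}}.

Definition beta : Qbeta := tofrac 'X.

(* Sums [\sum_(i \in A) F i] are the finitely supported sums of fsbigop: every
   such sum below has finitely many nonzero terms on the vectors it is used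
   for. *)

Definition clifford_rel (B : algType Qbeta) (psi : int -> B) : Prop :=
  forall m n : int,
    psi m * psi n + psi n * psi m = (2 * (-1) ^ m * (m + n == 0)%:R)%:A.

(* [A] is the algebra presented by the generators [phi n] and the relations
   [clifford_rel], in the form of its universal property. *)
Record is_fermion_algebra (A : algType Qbeta) (phi : int -> A) : Prop := {
  fermion_rel : clifford_rel phi;
  fermion_lift : forall (B : algType Qbeta) (psi : int -> B),
    clifford_rel psi ->
    exists f : {lrmorphism A -> B}, forall n, f (phi n) = psi n;
  fermion_gen : forall (B : algType Qbeta) (f g : {lrmorphism A -> B}),
    (forall n, f (phi n) = g (phi n)) -> f =1 g
}.

(* [M] is the left [R]-module generated by [v] subject to the relations
   [s *: v = 0] for [s] in [S]. *)
Record is_cyclic_module (R : nzRingType) (S : set R) (M : lmodType R) (v : M) :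
    Prop := {
  cyclic_gen : forall u : M, exists X : R, u = X *: v;
  cyclic_rel : forall s, S s -> s *: v = 0;
  cyclic_lift : forall (M' : lmodType R) (v' : M'),
    (forall s, S s -> s *: v' = 0) ->
    exists f : {linear M -> M'}, f v = v'
}.

Definition is_fock (A : algType Qbeta) (phi : int -> A)
    (F : lmodType A) (vac : F) : Prop :=
  is_cyclic_module [set X : A | exists2 n : int, 0 < n & X = phi (- n)] vac.

(* Right [A]-modules are left modules over the converse ring [A^c]. *)
Definition is_dual_fock (A : algType Qbeta) (phi : int -> A)
    (E : lmodType A^c) (covac : E) : Prop :=
  is_cyclic_module [set X : A^c | exists2 n : int, 0 < n & X = phi n] covac.

Section RightAction.
Context {A : algType Qbeta} {E : lmodType A^c}.

Definition actr (w : E) (X : A) : E := (X : A^c) *: w.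

Definition rscale (c : Qbeta) (w : E) : E := actr w c%:A.

End RightAction.

Record is_vacuum_pairing (A : algType Qbeta) (phi : int -> A)
    (F : lmodType A) (vac : F) (E : lmodType A^c) (covac : E)
    (pairing : E -> F -> Qbeta) : Prop := {
  pairing_linl : forall c w w' v,
    pairing (rscale c w + w') v = c * pairing w v + pairing w' v;
  pairing_linr : forall c w v v',
    pairing w (c%:A *: v + v') = c * pairing w v + pairing w v';
  pairing_balanced : forall w X v, pairing (actr w X) v = pairing w (X *: v);
  pairing_vac : pairing covac vac = 1;
  pairing_phi0 : pairing covac (phi 0 *: vac) = 0
}.

(* Formal power series in countably many commuting indeterminates: a series is
   its family of coefficients.  The generator [i : nat] of the monomials stands
   for p_(i+1), resp. x_(i+1). *)
Definition mseries (V : Type) := {cmonom nat} -> V.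

Section Operators.
Context (A : algType Qbeta) (phi : int -> A) (E : lmodType A^c).
Implicit Types (w : E) (v : mseries E).

Definition bop (m : int) w : E :=
  rscale 4^-1 (\sum_(i \in [set: int])
    actr w (((-1) ^ i : Qbeta) *: (phi (- i - m) * phi i))).

(* phi^(beta)_n for n >= 0: the coefficient of z^n in
   \sum_(m >= 0) phi_m (z + beta/2)^m. *)
Definition phib (n : nat) w : E :=
  \sum_(m \in [set: nat])
    actr w ((('X + (beta / 2)%:P) ^+ m : {poly Qbeta})`_n *: phi m%:Z).

Definition bpoly (m : nat) : {poly Qbeta} :=
  2^-1 *: (('X - (beta / 2)%:P) ^+ m - (- 'X - (beta / 2)%:P) ^+ m).

Definition bbop (m : nat) w : E :=
  \sum_(l < size (bpoly m)) rscale (bpoly m)`_l (bop l%:Z w).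

Definition Theta w : E :=
  rscale 2 (\sum_(j \in [set: nat])
    rscale ((beta / 2) ^+ j.*2.+1 / j.*2.+1%:R) (bop (- j.*2.+1%:Z) w)).

Definition expTheta w : E :=
  \sum_(N \in [set: nat]) rscale N`!%:R^-1 (iter N Theta w).

(* The summand (i, nu) is the contribution of p_(i+1) times the monomial nu. *)
Definition Ham v : mseries E := fun mu =>
  rscale 2 (\sum_(q \in [set q : nat * {cmonom nat} |
                          mmul (ucm q.1) q.2 = mu])
    rscale q.1.+1%:R^-1 (bbop q.1.+1 (v q.2))).

Definition expHam v : mseries E := fun mu =>
  \sum_(N \in [set: nat]) rscale N`!%:R^-1 (iter N Ham v mu).

Definition const_mseries w : mseries E := fun mu => if mu == mone then w else 0.

Definition phib_expTheta v (n : nat) : mseries E :=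
  fun mu => expTheta (phib n (v mu)).

(* <0| e^H phi^(beta)_(s_1) e^Theta ... phi^(beta)_(s_l) e^Theta |0> *)
Definition vev (F : lmodType A) (vac : F) (covac : E)
    (pairing : E -> F -> Qbeta) (s : seq nat) : mseries Qbeta := fun mu =>
  pairing (foldl phib_expTheta (expHam (const_mseries covac)) s mu) vac.

End Operators.

Section PowerSums.

Definition mseries_one : mseries Qbeta := fun mu => (mu == mone)%:R.

Definition mseries_mul (f g : mseries Qbeta) : mseries Qbeta := fun mu =>
  \sum_(q \in [set q : {cmonom nat} * {cmonom nat} | mmul q.1 q.2 = mu])
    f q.1 * g q.2.

(* p_n(x) = x_1^n + x_2^n + ... *)
Definition powersum (n : nat) : mseries Qbeta := fun mu =>
  `[< exists i : nat, mu = expcmn (ucm i) n >]%:R.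

Definition powersum_monom (kappa : {cmonom nat}) : mseries Qbeta :=
  \big[mseries_mul/mseries_one]_(i <- finsupp kappa)
    iter (kappa i) (mseries_mul (powersum i.+1)) mseries_one.

(* The image of a series in p_1, p_2, ... under p_n |-> p_n(x). *)
Definition subst_powersums (f : mseries Qbeta) : mseries Qbeta := fun mu =>
  \sum_(kappa \in [set: {cmonom nat}]) f kappa * powersum_monom kappa mu.

End PowerSums.

Section GQ.
Context (L : fieldType) (b : L).

Definition oplus (x y : L) : L := x + y + b * x * y.
Definition ominus (x y : L) : L := (x - y) / (1 + b * y).
Definition dbracket (x : L) (a : nat) : L :=
  if a == 0%N then 1 else (2 + b * x) * x ^+ a.

Definition GQ_at (lambda : seq nat) (n : nat) (x : 'I_n -> L) : L :=
  ((n - size lambda)`!)%:R^-1 *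
  \sum_(w : 'S_n)
     ((\prod_(i < n | (i < size lambda)%N) dbracket (x (w i)) (nth 0%N lambda i))
      * \prod_(i < n | (i < size lambda)%N) \prod_(j < n | (i < j)%N)
          (oplus (x (w i)) (x (w j)) / ominus (x (w i)) (x (w j)))).

End GQ.

(* GQ_lambda(x_1, ..., x_n) as a rational function of x_1, ..., x_n. *)
Definition GQ_frac (lambda : seq nat) (n : nat) :
    {fraction mpoly n Qbeta} :=
  GQ_at (tofrac beta%:MP_[n]) lambda (fun i : 'I_n => tofrac 'X_i).

(* The part of a monomial of x_1, x_2, ... that involves x_1, ..., x_n. *)
Definition trunc_monom (n : nat) (mu : {cmonom nat}) : multinom n :=
  [multinom mu (i : nat) | i < n].

(* [G] is GQ_lambda(x) = lim_n GQ_lambda(x_1, ..., x_n), the coefficientwise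
   limit: for n large, the rational function GQ_lambda(x_1, ..., x_n) is a
   polynomial [P] and its coefficient at [mu] is that of [G].  (The monomial
   [mu] only involves x_1, ..., x_n for n large, so truncating it is harmless.) *)
Definition is_GQ (lambda : seq nat) (G : mseries Qbeta) : Prop :=
  forall mu : {cmonom nat}, exists N : nat, forall n : nat, (N <= n)%N ->
    exists2 P : mpoly n Qbeta,
      tofrac P = GQ_frac lambda n & P@_(trunc_monom n mu) = G mu.

Definition strict_partition (lambda : seq nat) : bool :=
  sorted gtn lambda && all (fun a => (0 < a)%N) lambda.

(* Main.v *)
(* Write y = x / (1 + beta x / 2) and q(y) = exp (2 \sum_(l odd) y^l b_l / l).
   At p_n = x_1^n + ... + x_k^n the vector <0| e^(H^(beta)) becomes
   <0| q(y_1) ... q(y_k).  A vector v annihilated by all phi_n with n > 0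
   satisfies v phi_(-n) = (-1)^n v phi_0 q_n, and commuting phi past the q(y_j)
   yields, for m > 0,

     v q(y_1) ... q(y_k) phi_m
       = \sum_i 2 y_i^m \prod_(j != i) (y_i + y_j) / (y_i - y_j)
           v phi_0 \prod_(j != i) q(y_j),

   where v phi_0 is again annihilated by the phi_n.  The deformation turns
   2 y_i^m into (2 + beta x_i) x_i^m, and commuting e^Theta past the q(y_j)
   contributes the factors 1 + beta x_j, so that the product becomes the one of
   the (x_i (+) x_j) / (x_i (-) x_j).  This recursion is the expansion of the
   symmetrized sum defining GQ_lambda(x_1, ..., x_k) according to the value
   w(1) of the permutation w.  When r is odd, the last factor
   phi^(beta)_0 e^Theta contributes 1, by a partial fraction identity.

   The variables are x_i = xi_i t with distinct scalars xi_i, and all expressions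
   are formal power series in t. *)

Require Import Defs.
From HB Require Import structures.
From mathcomp Require Import all_boot all_order all_algebra.
From mathcomp Require Import fingroup perm fraction finmap.
From mathcomp Require Import boolp classical_sets functions cardinality fsbigop.
From mathcomp.multinomials Require Import monalg.
From mathcomp.multinomials Require Import mpoly.
From mathcomp Require Import zify ring.

Set Implicit Arguments.
Unset Strict Implicit.
Unset Printing Implicit Defensive.

Import Order.TTheory GRing.Theory Num.Theory.

Local Open Scope ring_scope.

(** The vector [covac] times a product of the q(y_j) does not lie in [E]: it has infinitely many
    modes, with coefficients in a larger ring. So no module is completed or extended. Instead q(y)
    acts by precomposition on linear maps from [E] to [fps L], and as y is divisible by t, only
    finitely many modes count modulo t^N.

    The variable t also records weight: the coefficient of t^d in a pairing is the part of weight d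
    in the p_n. At the end [L] is the fraction field of polynomials in n variables and the xi_i are
    these variables. Setting t = 1 is then legitimate, because (y_i + y_j) / (y_i - y_j) is a
    polynomial in t, hence so is the whole recursion.

    The q_n and the coefficients of e^H are handled through the recursions given by their Euler
    derivatives, and compared by uniqueness of solutions.

    Passing phi_m across several q(y_j) should produce the poles of a product of fractions. The
    relation is used with denominators cleared, which shows only that the defect D_m of the claimed
    formula satisfies D_(m+1) = y_i D_m for every i; two distinct y_i force it to vanish. *)

Lemma fsum_seq (I : choiceType) (V : nmodType) (r : seq I) (F : I -> V) :
  uniq r -> (forall i, i \notin r -> F i = 0) ->
  \sum_(i \in [set: I]) F i = \sum_(i <- r) F i.
Proof.
move=> ur Fr; rewrite (@bigfs _ _ _ _ r xpredT) //; last by move=> i _; exact: Fr.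
by apply: eq_fsbigl; apply/seteqP; split.
Qed.

Lemma fsum_nat (V : nmodType) (M : nat) (F : nat -> V) :
  (forall i, (M <= i)%N -> F i = 0) ->
  \sum_(i \in [set: nat]) F i = \sum_(i < M) F i.
Proof.
move=> FM; rewrite (@fsum_seq _ _ (iota 0 M)) ?iota_uniq //; last first.
  by move=> i; rewrite mem_iota /= add0n -leqNgt; exact: FM.
by rewrite -(subn0 M) -/(index_iota 0 M) big_mkord subn0.
Qed.

(** * Finitely supported sums indexed by the integers *)

Section IntSums.
Variable V : zmodType.
Implicit Types F G : int -> V.

Definition int_range (M : nat) : seq int := [seq k%:Z - M%:Z | k <- iota 0 M.*2.+1].

Lemma int_range_uniq M : uniq (int_range M).
Proof. by rewrite map_inj_uniq ?iota_uniq // => i j /addIr [->]. Qed.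

Lemma mem_int_range M (i : int) : (i \in int_range M) = (`|i| <= M)%N.
Proof.
apply/mapP/idP => [[k + ->]|iM]; first by rewrite mem_iota; lia.
by exists (absz (i + M%:Z)); [rewrite mem_iota; lia | lia].
Qed.

Definition finsup F := exists M : nat, forall i : int, (M < `|i|)%N -> F i = 0.

Definition zsum F := \sum_(i \in [set: int]) F i.

Lemma zsumE F M : (forall i : int, (M < `|i|)%N -> F i = 0) ->
  zsum F = \sum_(i <- int_range M) F i.
Proof.
move=> FM; apply: fsum_seq => [|i]; first exact: int_range_uniq.
by rewrite mem_int_range -ltnNge; exact: FM.
Qed.

Lemma zsum_shift F (m : int) : zsum (fun i => F (i + m)) = zsum F.
Proof.
rewrite /zsum [RHS](reindex_fsbig (fun i : int => i + m) [set: int]%classic) //.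
by rewrite setTT_bijective; exists (fun i => i - m) => i; rewrite ?addrK ?subrK.
Qed.

Lemma finsupD F G : finsup F -> finsup G -> finsup (fun i => F i + G i).
Proof.
move=> [M FM] [N GN]; exists (maxn M N) => i.
by rewrite gtn_max => /andP[/FM-> /GN->]; rewrite addr0.
Qed.

Lemma zsumD F G : finsup F -> finsup G ->
  zsum (fun i => F i + G i) = zsum F + zsum G.
Proof.
move=> [M FM] [N GN]; rewrite !(@zsumE _ (maxn M N)) ?big_split // => i;
  by rewrite gtn_max => /andP[? ?]; rewrite ?FM ?GN ?addr0.
Qed.

Lemma zsum1 F (j : int) : (forall i, i != j -> F i = 0) -> zsum F = F j.
Proof.
move=> Fj; rewrite /zsum (@fsum_seq _ _ [:: j]) ?big_seq1 // => i.
by rewrite inE; exact: Fj.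
Qed.

Lemma eq_zsum F G : F =1 G -> zsum F = zsum G.
Proof. by move=> /funext ->. Qed.

End IntSums.

Lemma zsum_morph (V W : zmodType) (f : V -> W) (F : int -> V) :
  f 0 = 0 -> {morph f : x y / x + y} -> finsup F ->
  f (zsum F) = zsum (fun i => f (F i)).
Proof.
move=> f0 fD [M FM]; rewrite !(@zsumE _ _ M) //; last by move=> i /FM ->.
exact: big_morph.
Qed.

Lemma Qbeta_natr_neq0 n : n.+1%:R != 0 :> Qbeta.
Proof.
rewrite -(rmorph_nat (@tofrac {poly rat})) tofrac_eq0 -polyC_natr polyC_eq0.
by rewrite pnatr_eq0.
Qed.

(** * The right action on [E] and operators linear over the base field *)

Section RightModule.
Context (A : algType Qbeta) (E : lmodType A^c).
Implicit Types (w : E) (X Y : A) (c : Qbeta).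

Lemma actr0l X : actr (0 : E) X = 0. Proof. exact: scaler0. Qed.
Lemma actr0r w : actr w 0 = 0. Proof. exact: scale0r. Qed.
Lemma actr1 w : actr w 1 = w. Proof. exact: scale1r. Qed.
Lemma actrDl X : {morph (fun w => actr w X) : w w' / w + w'}.
Proof. by move=> w w'; exact: scalerDr. Qed.
Lemma actrDr w : {morph (actr w) : X Y / X + Y}.
Proof. by move=> X Y; exact: scalerDl. Qed.
Lemma actrNl w X : actr (- w) X = - actr w X. Proof. exact: scalerN. Qed.
Lemma actrNr w X : actr w (- X) = - actr w X. Proof. exact: scaleNr. Qed.
Lemma actrM w X Y : actr w (X * Y) = actr (actr w X) Y.
Proof. by rewrite /actr scalerA. Qed.
Lemma actrZ w c X : actr w (c *: X) = rscale c (actr w X).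
Proof. by rewrite /rscale -actrM mulr_algr. Qed.
Lemma rscale_actr w c X : actr (rscale c w) X = rscale c (actr w X).
Proof. by rewrite /rscale -!actrM mulr_algl mulr_algr. Qed.

Lemma rscaleDr c : {morph (@rscale A E c) : w w' / w + w'}.
Proof. exact: actrDl. Qed.
Lemma rscaler0 c : rscale c (0 : E) = 0. Proof. exact: actr0l. Qed.
Lemma rscale0r w : rscale 0 w = 0. Proof. by rewrite /rscale scale0r actr0r. Qed.
Lemma rscale1 w : rscale 1 w = w. Proof. by rewrite /rscale scale1r actr1. Qed.
Lemma rscaleDl w : {morph (fun c => rscale c w) : c d / c + d}.
Proof. by move=> c d; rewrite /rscale scalerDl actrDr. Qed.
Lemma rscaleA c d w : rscale c (rscale d w) = rscale (c * d) w.
Proof. by rewrite /rscale -actrM mulr_algr scalerA. Qed.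
Lemma rscaleNl c w : rscale (- c) w = - rscale c w.
Proof. by rewrite /rscale scaleNr actrNr. Qed.
Lemma rscaleNr c w : rscale c (- w) = - rscale c w.
Proof. exact: actrNl. Qed.
Lemma rscaleBr c w w' : rscale c (w - w') = rscale c w - rscale c w'.
Proof. by rewrite rscaleDr rscaleNr. Qed.
Lemma rscaleBl c d w : rscale (c - d) w = rscale c w - rscale d w.
Proof. by rewrite rscaleDl rscaleNl. Qed.
Lemma rscale_nat n w : rscale n%:R w = w *+ n.
Proof. by elim: n => [|n IH]; rewrite ?rscale0r // mulrS rscaleDl rscale1 IH -mulrS. Qed.
Lemma rscale_sum c I (r : seq I) P (G : I -> E) :
  rscale c (\sum_(i <- r | P i) G i) = \sum_(i <- r | P i) rscale c (G i).
Proof. exact: (big_morph _ (rscaleDr c) (rscaler0 c)). Qed.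
Lemma rscale_suml w I (r : seq I) P (G : I -> Qbeta) :
  rscale (\sum_(i <- r | P i) G i) w = \sum_(i <- r | P i) rscale (G i) w.
Proof. exact: (big_morph _ (rscaleDl w) (rscale0r w)). Qed.
Lemma actr_suml X I (r : seq I) P (G : I -> E) :
  actr (\sum_(i <- r | P i) G i) X = \sum_(i <- r | P i) actr (G i) X.
Proof. exact: (big_morph _ (actrDl X) (actr0l X)). Qed.
Lemma rscale_inj c w w' : c != 0 -> rscale c w = rscale c w' -> w = w'.
Proof.
by move=> c0 /(congr1 (rscale c^-1)); rewrite !rscaleA mulVf // !rscale1.
Qed.

End RightModule.

(** The operators on [E] are linear over [Qbeta] but not over [A^c], the ring of scalars of [E];
    hence a predicate of its own. *)
Record klin (A : algType Qbeta) (E : lmodType A^c) (f : E -> E) : Prop := Klin {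
  klinD : {morph f : w w' / w + w'};
  klinZ : forall c w, f (rscale c w) = rscale c (f w) }.

Section Klin.
Context (A : algType Qbeta) (E : lmodType A^c).
Implicit Types (f g : E -> E).

Lemma klin0 f : klin f -> f 0 = 0.
Proof. by move=> [_ fZ]; have := fZ 0 0; rewrite !rscale0r. Qed.
Lemma klinN f w : klin f -> f (- w) = - f w.
Proof. by move=> [_ fZ]; have := fZ (-1) w; rewrite !rscaleNl !rscale1. Qed.
Lemma klin_sum f I (r : seq I) P (G : I -> E) : klin f ->
  f (\sum_(i <- r | P i) G i) = \sum_(i <- r | P i) f (G i).
Proof. by move=> lf; apply: (big_morph f (klinD lf) (klin0 lf)). Qed.

Lemma klin_id : klin (@id E). Proof. by []. Qed.
Lemma klin_comp f g : klin f -> klin g -> klin (f \o g).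
Proof.
move=> [fD fZ] [gD gZ].
by split=> [w w'|c w] /=; rewrite ?gD ?fD // gZ fZ.
Qed.
Lemma klin_actr X : klin (fun w : E => actr w X).
Proof. by split=> [|c w]; [exact: actrDl|exact: rscale_actr]. Qed.
Lemma klin_rscale c f : klin f -> klin (fun w => rscale c (f w)).
Proof.
move=> [fD fZ]; split=> [w w'|d w]; first by rewrite fD rscaleDr.
by rewrite fZ !rscaleA mulrC.
Qed.
Lemma klin_iter f n : klin f -> klin (iter n f).
Proof. by move=> lf; elim: n => [|n IH]; [exact: klin_id|exact: klin_comp]. Qed.

Lemma klin_fsum (f : nat -> E -> E) : (forall i, klin (f i)) ->
  (forall w, exists M : nat, forall i, (M <= i)%N -> f i w = 0) ->
  klin (fun w => \sum_(i \in [set: nat]) f i w).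
Proof.
move=> lf ff.
have fE w M : (forall i, (M <= i)%N -> f i w = 0) ->
  \sum_(i \in [set: nat]) f i w = \sum_(i < M) f i w by exact: fsum_nat.
split=> [w w'|c w].
  have [M fM] := ff w; have [N fN] := ff w'.
  rewrite !(fE _ (maxn M N)) => [||i|i]; rewrite ?geq_max.
  - by rewrite -big_split; apply: eq_bigr => i _; exact: klinD.
  - by move=> i; rewrite geq_max => /andP[_]; exact: fN.
  - by move=> /andP[/fM].
  by move=> /andP[/fM + /fN]; rewrite klinD // => -> ->; rewrite addr0.
have [M fM] := ff w.
rewrite !(fE _ M) // => [|i iM]; last by rewrite klinZ // fM // rscaler0.
by rewrite rscale_sum; apply: eq_bigr => i _; exact: klinZ.
Qed.

End Klin.

(** * Fermions and Heisenberg modes *)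

Section FermionInduction.
Context (A : algType Qbeta) (phi : int -> A) (P : A -> Prop).
Hypotheses (P1 : P 1) (PD : forall X Y, P X -> P Y -> P (X + Y)).
Hypotheses (PZ : forall c X, P X -> P (c *: X)).
Hypotheses (PM : forall X Y, P X -> P Y -> P (X * Y)) (Pphi : forall n, P (phi n)).

Let S : {pred A} := [pred X | `[< P X >]].

Fact fermion_sub_closed : subalg_closed S.
Proof.
split=> [|c X Y|X Y]; rewrite ?inE // => PX PY; last exact: PM.
by apply: PD => //; exact: PZ.
Qed.

HB.instance Definition _ := GRing.isSubalgClosed.Build _ _ S fermion_sub_closed.

Record fermion_sub := FermionSub { fermion_val : A; _ : fermion_val \in S }.

HB.instance Definition _ := [isSub for fermion_val].
HB.instance Definition _ := [Choice of fermion_sub by <:].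
HB.instance Definition _ := [SubChoice_isSubAlgebra of fermion_sub by <:].

Fact fermion_val_linear : linear fermion_val. Proof. by []. Qed.
Fact fermion_val_monoid_morphism : monoid_morphism fermion_val. Proof. by []. Qed.

HB.instance Definition _ :=
  GRing.isLinear.Build Qbeta fermion_sub A *:%R fermion_val fermion_val_linear.
HB.instance Definition _ :=
  GRing.isMonoidMorphism.Build fermion_sub A fermion_val fermion_val_monoid_morphism.

(** The elements satisfying [P] form a subalgebra containing the generators. The universal property
    maps [A] into it, and the composite with the inclusion fixes the generators, so it is the
    identity. *)
Lemma fermion_ind : is_fermion_algebra phi -> forall X, P X.
Proof.
move=> [rel lift gen] X.
have Sphi n : phi n \in S by apply/asboolP.
have [|f fE] := lift fermion_sub (fun n => FermionSub (Sphi n)).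
  by move=> m n; apply: val_inj; rewrite /= rel.
pose g : {lrmorphism A -> A} := fermion_val \o f.
have gE : g =1 idfun by apply: gen => n; rewrite /= fE.
by rewrite -[X]gE; apply/asboolP; exact: (valP (f X)).
Qed.

End FermionInduction.

Lemma signzD (i j : int) : (-1) ^ (i + j) = (-1) ^ i * (-1) ^ j :> Qbeta.
Proof. by rewrite expfzDr // oppr_eq0 oner_eq0. Qed.

Lemma signzN (i : int) : (-1) ^ (- i) = (-1) ^ i :> Qbeta.
Proof. by rewrite -exprz_inv invrN1. Qed.

Lemma signz_sq (i : int) : (-1) ^ i * (-1) ^ i = 1 :> Qbeta.
Proof. by rewrite -expfzMl mulrNN mulr1 exp1rz. Qed.

Lemma signz_odd (i : int) : odd `|i|%N -> (-1) ^ i = -1 :> Qbeta.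
Proof.
case: i => n /=; first by rewrite -[LHS]signr_odd => ->.
by move=> io; rewrite NegzE signzN -[(-1) ^ _]signr_odd /= io.
Qed.

Section Fermions.
Context (A : algType Qbeta) (phi : int -> A) (E : lmodType A^c).
Hypothesis phi_rel : clifford_rel phi.
Implicit Types (w v : E) (m n : int).

Local Notation "w |> n" := (actr w (phi n)) (at level 28, left associativity).

Lemma actr_anticomm w m n :
  w |> m |> n = rscale (2 * (-1) ^ m * (m + n == 0)%:R) w - w |> n |> m.
Proof.
by rewrite -!actrM; apply/eqP; rewrite eq_sym subr_eq -actrDr phi_rel /rscale.
Qed.

Lemma actr_anticomm0 w m n : m + n != 0 -> w |> m |> n = - w |> n |> m.
Proof. by move=> /negPf mn; rewrite actr_anticomm mn mulr0 rscale0r sub0r. Qed.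

Definition actw w (s : seq int) : E := foldl (fun u n => u |> n) w s.

Lemma actw_klin s : klin (actw^~ s).
Proof.
elim: s => [|n s IH]; first exact: klin_id.
exact: (klin_comp IH (klin_actr E (phi n))).
Qed.

(* In terms of the grading by energy, where [phi n] lowers the degree by [n],
   [w] has components of degree at most [d] only. *)
Definition bdeg (d : int) w :=
  forall s, d < \sum_(i <- s) i -> actw w s = 0.

Lemma bdeg_le d d' w : d <= d' -> bdeg d w -> bdeg d' w.
Proof. by move=> dd' dw s sd; apply: dw; apply: le_lt_trans sd. Qed.

Lemma bdeg_actw d w s : bdeg d w -> bdeg (d - \sum_(i <- s) i) (actw w s).
Proof.
move=> dw s' ds'; rewrite /actw -foldl_cat; apply: dw.
by rewrite big_cat /= addrC -ltrBlDr.
Qed.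

Lemma bdeg_phi d w n : bdeg d w -> bdeg (d - n) (w |> n).
Proof. by move=> /(@bdeg_actw _ _ [:: n]); rewrite big_seq1. Qed.

Lemma bdegD d w w' : bdeg d w -> bdeg d w' -> bdeg d (w + w').
Proof.
by move=> dw dw' s ds; rewrite (klinD (actw_klin s)) dw // dw' // addr0.
Qed.

Lemma bdegZ d c w : bdeg d w -> bdeg d (rscale c w).
Proof. by move=> dw s ds; rewrite (klinZ (actw_klin s)) dw // rscaler0. Qed.

Lemma bdeg_kill d w n : bdeg d w -> d < n -> w |> n = 0.
Proof. by move=> /(_ [:: n]); rewrite big_seq1; exact. Qed.

(** The recursion replaces v by v phi_0 at each row, so [covac] and its image under phi_0 must be
    treated alike; this is the property that they share. *)
Definition vaclike v := forall n, 0 < n -> v |> n = 0.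

(** A word of positive total index contains a positive letter. Moving it to the front annihilates v;
    each exchange on the way adds at most a contraction, which leaves a shorter word of the same
    total. *)
Lemma vaclike_bdeg v : vaclike v -> bdeg 0 v.
Proof.
move=> vac s; have [k] := ubnP (size s); elim: k s => // k IH s.
rewrite ltnS => sk s_gt0.
have /hasP[n ns n_gt0] : has (> 0) s.
  apply: contraLR s_gt0; rewrite -all_predC -leNgt => /allP s_le0.
  by rewrite big_seq; apply: sumr_le0 => i /s_le0 /=; rewrite -leNgt.
case/splitPr: ns sk s_gt0 => s1 s2.
elim/last_ind: s1 s2 => [|s1 a IH1] s2 sk s_gt0.
  by rewrite /= vac // (klin0 (actw_klin s2)).
rewrite cat_rcons /actw foldl_cat /= actr_anticomm.
rewrite -[foldl _ _ s2]/(actw _ s2) (klinD (actw_klin s2)) (klinN _ (actw_klin s2)).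
rewrite (klinZ (actw_klin s2)) -[actw (_ |> n |> a) s2]/(actw _ (n :: a :: s2)).
rewrite -[actw _ s2]foldl_cat -[actw _ (n :: _)]foldl_cat.
rewrite -/(actw v (s1 ++ s2)) -/(actw v (s1 ++ n :: a :: s2)) IH1; first last.
- by move: s_gt0; rewrite -cats1 -catA !big_cat !big_cons /= big_nil; lia.
- by move: sk; rewrite size_cat size_rcons /= size_cat /=; lia.
case: eqP => [an|_]; last by rewrite mulr0 rscale0r subr0.
rewrite IH ?rscaler0 ?subr0 //.
  by move: sk; rewrite size_cat size_rcons /= size_cat /=; lia.
by move: s_gt0; rewrite -cats1 -catA !big_cat !big_cons /= big_nil; lia.
Qed.

Lemma vaclike_phi0 v : vaclike v -> vaclike (v |> 0).
Proof.
move=> vac n n_gt0; rewrite actr_anticomm0 ?vac ?actr0l ?oppr0 //.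
by rewrite add0r gt_eqF.
Qed.

Lemma phi00 w : w |> 0 |> 0 = w.
Proof.
apply: (@rscale_inj _ _ 2); first exact: (Qbeta_natr_neq0 1).
have := actr_anticomm w 0 0; rewrite addr0 eqxx !mulr1 => /eqP.
by rewrite eq_sym subr_eq -mulr2n -rscale_nat => /eqP.
Qed.

End Fermions.

Section Bosons.
Context (A : algType Qbeta) (phi : int -> A) (E : lmodType A^c).
Hypothesis phi_rel : clifford_rel phi.
Hypothesis ex_bdeg : forall w : E, exists d, bdeg phi d w.
Implicit Types (w v : E) (m n : int).

Local Notation "w |> n" := (actr w (phi n)) (at level 28, left associativity).
Local Notation bop := (@bop A phi E).

Definition bterm m w (i : int) : E := rscale ((-1) ^ i) (w |> (- i - m) |> i).

Lemma bopE m w : bop m w = rscale 4^-1 (zsum (bterm m w)).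
Proof.
by congr rscale; apply: eq_zsum => i; rewrite /bterm actrZ actrM.
Qed.

(** Far out, one of the two indices is large and positive, so its fermion annihilates [w]. For m
    nonzero the two fermions anticommute, and that one may act first. *)
Lemma bterm_finsup m w : m != 0 -> finsup (bterm m w).
Proof.
move=> m0; have [d dw] := ex_bdeg w; exists (absz d + absz m)%N => i i_gt.
rewrite /bterm; have [i0|i0] := leP 0 i.
  rewrite actr_anticomm0 //; last by apply: contra m0; lia.
  by rewrite (bdeg_kill dw) ?actr0l ?oppr0 ?rscaler0 //; lia.
by rewrite (bdeg_kill dw (n := - i - m)) ?actr0l ?rscaler0 //; lia.
Qed.

Lemma bop_klin m : m != 0 -> klin (bop m).
Proof.
move=> m0; split=> [w w'|c w]; rewrite !bopE.
  rewrite -rscaleDr -zsumD; try exact: bterm_finsup.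
  by congr rscale; apply: eq_zsum => i; rewrite /bterm !actrDl rscaleDr.
rewrite rscaleA mulrC -rscaleA; congr rscale.
rewrite (zsum_morph (f := rscale c)); last exact: bterm_finsup.
- by apply: eq_zsum => i; rewrite /bterm !rscale_actr !rscaleA mulrC.
- exact: rscaler0.
- exact: rscaleDr.
Qed.

Lemma bdeg_bop m d w : m != 0 -> bdeg phi d w -> bdeg phi (d + m) (bop m w).
Proof.
move=> m0 dw s ds; rewrite bopE (klinZ (actw_klin phi E s)).
rewrite (zsum_morph (f := fun u : E => actw phi u s)); last exact: bterm_finsup.
- rewrite (eq_zsum (G := fun=> 0)) => [|i]; first by rewrite (zsum1 (j := 0)) ?rscaler0.
  rewrite /bterm (klinZ (actw_klin phi E s)).
  rewrite -[actw _ _ _]/(actw phi w [:: - i - m, i & s]) dw ?rscaler0 //.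
  rewrite !big_cons addrA (_ : - i - m + i = - m); last by ring.
  by rewrite addrC ltrBrDr.
- exact: klin0 (actw_klin phi E s).
- exact: klinD (actw_klin phi E s).
Qed.

Lemma finsup_shift (V : zmodType) (F : int -> V) (m : int) :
  finsup F -> finsup (fun i => F (i + m)).
Proof. by move=> [M FM]; exists (M + absz m)%N => i im; apply: FM; lia. Qed.

Lemma finsupN (V : zmodType) (F : int -> V) : finsup F -> finsup (fun i => - F i).
Proof. by move=> [M FM]; exists M => i /FM ->; rewrite oppr0. Qed.

Lemma finsup1 (V : zmodType) (F : int -> V) (j : int) :
  (forall i, i != j -> F i = 0) -> finsup F.
Proof. by move=> Fj; exists (absz j) => i ij; apply: Fj; lia. Qed.

Lemma zsumB (V : zmodType) (F G : int -> V) : finsup F -> finsup G ->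
  zsum (fun i => F i - G i) = zsum F - zsum G.
Proof.
move=> Ff Gf; rewrite zsumD //; last exact: finsupN.
by rewrite -(zsum_morph (f := -%R)) ?oppr0 //; exact: opprD.
Qed.

(** The relation [b_m, phi_n] = phi_(n-m): phi_n is moved across both factors of each quadratic
    term, and only the contractions remain. *)
Lemma bop_phi m n w : odd `|m|%N ->
  bop m w |> n = bop m (w |> n) + w |> (n - m).
Proof.
move=> mo; have m0 : m != 0 by lia.
(* [P] and [Q] are the contractions of phi_n with the two factors. Each is nonzero for one value of
   i, and [P - Q] sums to 4 phi_(n-m), which explains the 1/4 in b_m. *)
pose P i := rscale (2 * (i + n == 0)%:R) (w |> (- i - m)).
pose Q i := rscale (- 2 * (- i - m + n == 0)%:R) (w |> i).
have P0 i : i != - n -> P i = 0.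
  by rewrite /P addr_eq0 => /negPf ->; rewrite mulr0 rscale0r.
have Q0 i : i != n - m -> Q i = 0.
  move=> im; rewrite /Q (_ : _ == 0 = false) ?mulr0 ?rscale0r //.
  by apply: contra_neqF im; lia.
have termE i : bterm m w i |> n = bterm m (w |> n) i + (P i - Q i).
  rewrite /bterm rscale_actr (actr_anticomm phi_rel _ i n).
  rewrite (actr_anticomm phi_rel w (- i - m) n) actrDl actrNl rscale_actr.
  rewrite opprB addrCA rscaleDr; congr (_ + _).
  rewrite rscaleDr rscaleNr !rscaleA /P /Q.
  rewrite signzD !signzN (signz_odd mo).
  have := signz_sq i; set e := (-1) ^ i => ee; congr (rscale _ _ - rscale _ _).
    by rewrite [2 * e]mulrC !mulrA ee mul1r.
  by rewrite mulrN1 [2 * _]mulrC !mulrA mulrN ee mulN1r.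
rewrite !bopE rscale_actr (zsum_morph (f := fun u : E => u |> n)).
- rewrite (eq_zsum termE) zsumD; last 2 first.
  + exact: bterm_finsup.
  + by apply: finsupD; [|apply: finsupN]; [exact: finsup1 P0|exact: finsup1 Q0].
  rewrite zsumB; [|exact: finsup1 P0|exact: finsup1 Q0].
  rewrite (zsum1 P0) (zsum1 Q0) rscaleDr; congr (_ + _).
  rewrite /P /Q addNr opprK eqxx (_ : - (n - m) - m + n = 0) ?eqxx ?mulr1; last by ring.
  rewrite -rscaleBl rscaleA opprK -natrD mulVf ?rscale1 //.
  exact: (Qbeta_natr_neq0 3).
- exact: actr0l.
- exact: actrDl.
- exact: bterm_finsup.
Qed.

End Bosons.

Section Generation.
Context (A : algType Qbeta) (phi : int -> A) (phiP : is_fermion_algebra phi).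
Context (E : lmodType A^c) (covac : E) (covacP : is_dual_fock phi covac).

Lemma covac_vaclike : vaclike phi covac.
Proof. by move=> n n_gt0; apply: (cyclic_rel covacP); exists n. Qed.

Lemma dual_fock_ind (P : E -> Prop) : P covac ->
  (forall w w', P w -> P w' -> P (w + w')) ->
  (forall c w, P w -> P (rscale c w)) ->
  (forall w n, P w -> P (actr w (phi n))) -> forall w, P w.
Proof.
move=> P0 PD PZ Pphi w; have [X wE] := cyclic_gen covacP w; have {wE} -> : w = actr covac X := wE.
pose Q (Y : A) := forall u, P u -> P (actr u Y).
suff QX : Q X by apply: QX.
apply: (fermion_ind (P := Q) _ _ _ _ _ phiP) => [u|Y Z|c Y|Y Z|n].
- by rewrite actr1.
- by move=> QY QZ u Pu; rewrite actrDr; apply: PD; [exact: QY|exact: QZ].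
- by move=> QY u Pu; rewrite actrZ; apply: PZ; exact: QY.
- by move=> QY QZ u Pu; rewrite actrM; apply: QZ; exact: QY.
- by move=> u; exact: Pphi.
Qed.

(** This bound is what makes every infinite sum of operators finite on each vector. *)
Lemma ex_bdeg (w : E) : exists d, bdeg phi d w.
Proof.
move: w; apply: dual_fock_ind => [|w w' [d dw] [d' dw']|c w [d dw]|w n [d dw]].
- exists 0; apply: vaclike_bdeg covac_vaclike; exact: fermion_rel phiP.
- exists (Num.max d d'); apply: bdegD; [apply: bdeg_le dw|apply: bdeg_le dw'].
    by rewrite le_max lexx.
  by rewrite le_max lexx orbT.
- by exists d; exact: bdegZ.
- by exists (d - n); exact: bdeg_phi.
Qed.

End Generation.

(** * Commutation relations of the b_m *)

Lemma natr_double_div4 (K : fieldType) (n2 : 2%:R != 0 :> K) (l : nat) :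
  (2 * l)%:R / (2 * 2)%:R = l%:R / 2 :> K.
Proof. by rewrite !natrM invfM mulrACA divff // mul1r. Qed.

Section Heisenberg.
Context (A : algType Qbeta) (phi : int -> A) (phiP : is_fermion_algebra phi).
Context (E : lmodType A^c) (covac : E) (covacP : is_dual_fock phi covac).
Implicit Types (w v : E) (m n : int).

Local Notation "w |> n" := (actr w (phi n)) (at level 28, left associativity).
Local Notation bop := (@bop A phi E).
Let phi_rel : clifford_rel phi := fermion_rel phiP.
Let bdegE := ex_bdeg phiP covacP.

Lemma bop_phiE m n w : odd `|m|%N ->
  bop m w |> n = bop m (w |> n) + w |> (n - m).
Proof. exact: bop_phi. Qed.

(** The commutator of b_m with the i-th summand of b_n is the i-th summand of b_(m+n) minus a shift
    of it by m. These summands have finite support when m + n is nonzero, so the two sums cancel. *)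
Lemma bopC m n w : odd `|m|%N -> odd `|n|%N -> m + n != 0 ->
  bop n (bop m w) = bop m (bop n w).
Proof.
move=> mo no mn0; have m0 : m != 0 by lia. have n0 : n != 0 by lia.
have termE i : bterm phi n (bop m w) i = bop m (bterm phi n w i) +
    (bterm phi (m + n) w i - bterm phi (m + n) w (i - m)).
  rewrite /bterm (klinZ (bop_klin phi_rel bdegE m0)) bop_phiE // actrDl bop_phiE //.
  rewrite -addrA !rscaleDr; congr (_ + _); rewrite addrC.
  rewrite (_ : - (i - m) - (m + n) = - i - n); last by ring.
  rewrite (_ : - i - (m + n) = - i - n - m); last by ring.
  by rewrite signzD signzN (signz_odd mo) mulrN1 rscaleNl opprK.
have fin : finsup (bterm phi (m + n) w) := bterm_finsup phi_rel bdegE w mn0.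
rewrite !(bopE _ n) (klinZ (bop_klin phi_rel bdegE m0)); congr rscale.
rewrite (eq_zsum termE) zsumD; last 2 first.
- case: (bterm_finsup phi_rel bdegE w n0) => M FM; exists M => i /FM ->.
  by rewrite klin0 //; exact: bop_klin.
- by apply: finsupD => //; apply/finsupN/(finsup_shift (- m)).
rewrite zsumB //; last exact/(finsup_shift (- m)).
rewrite (zsum_shift (bterm phi (m + n) w) (- m)) subrr addr0.
rewrite -(zsum_morph (f := bop m)) //; last exact: bterm_finsup.
- by rewrite klin0 //; exact: bop_klin.
- exact: klinD (bop_klin phi_rel bdegE m0).
Qed.

Lemma vaclike_bopN m v : vaclike phi v -> m < 0 -> bop m v = 0.
Proof.
move=> vac m_lt0; rewrite bopE (eq_zsum (G := fun=> 0)) => [|i].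
  by rewrite (zsum1 (j := 0)) ?rscaler0.
rewrite /bterm -[_ |> i]/(actw phi v [:: - i - m; i]).
rewrite (vaclike_bdeg phi_rel vac) ?rscaler0 //.
by rewrite !big_cons big_nil; lia.
Qed.

Lemma vaclike_pair v (i : int) : vaclike phi v ->
  v |> (- i) |> i = rscale ((-1) ^ i * ((i == 0)%:R + 2 * (0 < i)%R%:R)) v.
Proof.
move=> vac; have [i0|i0|->] := ltrgtP i 0.
- by rewrite vac ?actr0l ?oppr_gt0 // mulr0 addr0 mulr0 rscale0r.
- rewrite (actr_anticomm phi_rel) addNr eqxx mulr1 signzN vac // actr0l subr0.
  by rewrite add0r mulr1 mulrC.
- by rewrite oppr0 (phi00 phi_rel) mulr0 addr0 mulr1 rscale1.
Qed.

Lemma bopNl_vac l v : odd l -> vaclike phi v ->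
  bop (- l%:Z) (bop l v) = rscale (l%:R / 2) v.
Proof.
move=> lo vac; set m := l%:Z; have mo : odd `|m|%N by [].
have m0 : m != 0 by rewrite /m; case: (l) lo.
have Nm0 : - m != 0 by rewrite oppr_eq0.
have mNo : odd `|- m|%N by rewrite abszN.
have vN : bop (- m) v = 0 by apply: vaclike_bopN => //; lia.
(* On v the product phi_(-i) phi_i acts as (-1)^i [h i]. The step function [h] rises from 0 through
   1 to 2; it is not summable, but its shift by l minus itself is, with total 2 l, and 1/4 of this
   is l / 2. *)
pose h (i : int) : Qbeta := (i == 0)%:R + 2 * (0 < i)%R%:R.
have termE i : bop (- m) (bterm phi m v i) = rscale (h (i + m) - h i) v.
  have NE k u : bop (- m) (u |> k) = bop (- m) u |> k - u |> (k + m).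
    by rewrite bop_phiE // opprK addrK.
  rewrite /bterm (klinZ (bop_klin phi_rel bdegE Nm0)) !NE vN actr0l sub0r actrNl.
  rewrite (_ : - i - m + m = - i); last by ring.
  rewrite (_ : - i - m = - (i + m)); last by ring.
  rewrite !vaclike_pair // -/(h i) -/(h (i + m)) -rscaleNl -rscaleBl rscaleA.
  rewrite signzD (signz_odd mo) mulrN1 mulNr opprK mulrDr mulrN !mulrA.
  by rewrite signz_sq !mul1r addrC.
have fin : finsup (bterm phi m v) := bterm_finsup phi_rel bdegE v m0.
rewrite (bopE _ m v) (klinZ (bop_klin phi_rel bdegE Nm0)).
rewrite (zsum_morph (f := bop (- m))) //; last exact: klinD (bop_klin phi_rel bdegE Nm0).
  rewrite (eq_zsum termE) (@zsumE _ _ l) => [|i il]; last first.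
    by rewrite (_ : h _ - h _ = 0) ?rscale0r // /h /m; case: (ltrgtP i 0) => i0;
       case: (ltrgtP (i + l%:Z) 0) => im; try lia; rewrite subrr.
  rewrite -rscale_suml rscaleA; congr rscale.
  have hS N : \sum_(k < N.+1) h k%:Z = 1 + 2 * N%:R.
    elim: N => [|N IH]; first by rewrite big_ord1 /h eqxx ltxx /= !mulr0.
    rewrite big_ord_recr IH /= (_ : h N.+1%:Z = 2); last by rewrite /h /= add0r mulr1.
    by rewrite [N.+1%:R]mulrSr mulrDr mulr1 [RHS]addrA.
  rewrite big_map -[iota 0 _]/(index_iota 0 l.*2.+1) sumrB.
  rewrite [X in _ * (X - _)](eq_bigr (fun k : nat => h k%:Z)) => [|k _]; last by rewrite subrK.
  rewrite [X in _ * (X - _)]big_mkord hS (big_cat_nat (n := l)) //=; last first.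
    by rewrite -addnn -addnS leq_addr.
  rewrite big1_seq ?add0r => [|k]; last first.
    rewrite mem_index_iota /= => kl; rewrite /h (_ : (_ == 0) = false); last by apply/eqP; lia.
    by rewrite (_ : (0 < _)%R = false) ?mulr0 ?addr0 //; apply/negP; lia.
  have -> : \sum_(l <= k < l.*2.+1) h (k%:Z - l%:Z) = \sum_(k < l.+1) h k%:Z.
    rewrite -{1}[l]add0n big_addn -addnn -addSn addnK big_mkord.
    by apply: eq_bigr => k _; rewrite PoszD addrK.
  rewrite hS opprD addrACA subrr add0r -mulrBr -natrB ?leq_addr -?addnn ?addnK //.
  have n4 : 2 * 2 != 0 :> Qbeta by rewrite -natrM; exact: (Qbeta_natr_neq0 3).
  rewrite (_ : 4 = 2 * 2 :> Qbeta) -?natrM // mulrC.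
    exact: natr_double_div4 (Qbeta_natr_neq0 1) l.
  exact: leq_addr.
by rewrite klin0 //; exact: bop_klin.
Qed.

End Heisenberg.

(** * An Euler recursion for the vectors v phi_(-n) *)

Lemma sum_odd_ord n : (\sum_(c < n.+1 | odd (n - c)) 1 = uphalf n)%N.
Proof.
rewrite (reindex_inj rev_ord_inj) /=.
rewrite (eq_bigl (fun c : 'I_n.+1 => odd c)) => [|c]; last first.
  by rewrite subSS subKn // -ltnS.
elim: n => [|n IH]; first by rewrite big_mkcond big_ord1.
rewrite big_mkcond big_ord_recr /= -big_mkcond IH /= uphalf_half.
by case: (odd n); rewrite ?addn0 ?add0n ?addn1.
Qed.

Lemma vac_euler_coef (K : fieldType) (n2 : 2%:R != 0 :> K) n :
  - 2 * (4^-1 * (2^-1 * ((2 - (-1) ^+ n) - (-1) ^+ n)) - (uphalf n)%:R)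
    = n%:R :> K.
Proof.
have n4 : 4%:R != 0 :> K by rewrite (natrM _ 2 2) mulf_neq0.
rewrite -signr_odd -[in RHS](odd_double_half n) uphalf_half !natrD -muln2 natrM.
by case: (odd n) => /=; field; rewrite n2 n4.
Qed.

Section VacuumEuler.
Context (A : algType Qbeta) (phi : int -> A) (phiP : is_fermion_algebra phi).
Context (E : lmodType A^c) (covac : E) (covacP : is_dual_fock phi covac).
Implicit Types (w v : E) (m n : int).

Local Notation "w |> n" := (actr w (phi n)) (at level 28, left associativity).
Local Notation bop := (@bop A phi E).
Let phi_rel : clifford_rel phi := fermion_rel phiP.
Let bdegE := ex_bdeg phiP covacP.

Lemma bop_klinE m : m != 0 -> klin (bop m).
Proof. exact: bop_klin. Qed.

(** The commutator of b_l and b_(-l) commutes with every phi_n, since the two index shifts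
    compensate each other. It is therefore the scalar found on [covac]. *)
Lemma bopNl l w : odd l ->
  bop (- l%:Z) (bop l w) = bop l (bop (- l%:Z) w) + rscale (l%:R / 2) w.
Proof.
move=> lo; have mo : odd `|l%:Z|%N by [].
have m0 : l%:Z != 0 by case: (l) lo.
have Nm0 : - l%:Z != 0 by rewrite oppr_eq0.
have mNo : odd `|- l%:Z|%N by rewrite abszN.
have lm := bop_klinE m0; have lNm := bop_klinE Nm0.
move: w; apply: (dual_fock_ind phiP covacP).
- have vac := covac_vaclike covacP; rewrite (bopNl_vac phiP covacP) //.
  rewrite (vaclike_bopN phiP vac) ?oppr_lt0 ?ltz_nat ?odd_gt0 //.
  by rewrite (klin0 lm) add0r.
- move=> w w' IH IH'.
  by rewrite (klinD lm) !(klinD lNm) (klinD lm) IH IH' rscaleDr addrACA.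
- move=> c w IH.
  rewrite (klinZ lm c w) (klinZ lNm c w) (klinZ lNm c (bop l w)).
  rewrite (klinZ lm c (bop (- l%:Z) w)) IH rscaleDr; congr (_ + _).
  by rewrite !rscaleA mulrC.
- move=> w n IH.
  have bE m k u : odd `|m|%N -> bop m (u |> k) = bop m u |> k - u |> (k - m).
    by move=> mo'; rewrite (bop_phiE phiP covacP) // addrK.
  rewrite (bE l%:Z) // (bE (- l%:Z)) // (klinD lm) (klinN _ lm) (klinD lNm) (klinN _ lNm).
  rewrite !bE // IH actrDl rscale_actr.
  rewrite (_ : n - - l%:Z - l%:Z = n - l%:Z - - l%:Z); last by ring.
  by rewrite !opprB !addrA [RHS](ACl (1*5*4*3*2)%AC).
Qed.

Lemma vaclike_bop v (m N : nat) : vaclike phi v -> odd m -> (m < N)%N ->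
  bop m v = rscale 4^-1 (\sum_(a < N) \sum_(b < N)
    rscale ((-1) ^+ b * (a + b == m)%N%:R) (v |> (- a%:Z) |> (- b%:Z))).
Proof.
move=> vac mo mN; rewrite bopE; congr rscale.
have m0 : m%:Z != 0 by case: (m) mo.
rewrite /zsum (@fsum_seq _ _ [seq - k%:Z | k <- iota 0 N]); last 2 first.
- by rewrite map_inj_uniq ?iota_uniq // => i j /oppr_inj [].
- move=> i /mapP iN; rewrite /bterm; have [i0|i0] := ltrP 0 i.
    rewrite (actr_anticomm0 phi_rel); last by apply: contra m0; lia.
    by rewrite vac // actr0l oppr0 rscaler0.
  have [iN'|iN'] := leqP N `|i|%N; first by rewrite vac ?actr0l ?rscaler0 //; lia.
  by case: iN; exists `|i|%N; [rewrite mem_iota | lia].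
rewrite big_map -[iota 0 N](_ : index_iota 0 N = _); last by rewrite /index_iota subn0.
rewrite big_mkord exchange_big; apply: eq_bigr => b _.
rewrite /bterm signzN opprK.
have [bm|bm] := leqP b m; last first.
  rewrite vac ?subr_gt0 // actr0l rscaler0 big1 // => a _.
  by rewrite (_ : _ == _ = false) ?mulr0 ?rscale0r //; apply/eqP; lia.
have aN : (m - b < N)%N by lia.
rewrite (bigD1 (Ordinal aN)) //= subnK // eqxx mulr1 big1 ?addr0 => [|a].
  by congr (rscale _ (_ |> _ |> _)); lia.
rewrite -val_eqE /= => am; rewrite (_ : _ == _ = false) ?mulr0 ?rscale0r //.
by apply: contra_neqF am; lia.
Qed.

Section Triple.
Variables (v : E) (vac : vaclike phi v) (n : nat).

Let t a b c := v |> (- a%:Z) |> (- b%:Z) |> (- c%:Z).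
Let S3 (f : nat -> nat -> nat -> Qbeta) :=
  \sum_(a < n.+1) \sum_(b < n.+1) \sum_(c < n.+1)
    rscale (f a b c * (a + b + c == n)%N%:R) (t a b c).

Let swap12 a b c : t a b c + t b a c =
  rscale (2 * (a == 0)%N%:R * (b == 0)%N%:R) (v |> (- c%:Z)).
Proof.
rewrite /t [v |> _ |> - b%:Z](actr_anticomm phi_rel) actrDl actrNl subrK.
rewrite rscale_actr; case: a b => [|a] [|b]; rewrite ?mulr1 ?mulr0 //=.
Qed.

Let swap23 a b c : t a b c + t a c b =
  rscale (2 * (b == 0)%N%:R * (c == 0)%N%:R) (v |> (- a%:Z)).
Proof.
rewrite /t (actr_anticomm phi_rel (v |> - a%:Z)) subrK.
by case: b c => [|b] [|c]; rewrite ?mulr1 ?mulr0 //=.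
Qed.

Let e := v |> (- n%:Z).
Let sgn_a := fun a b c : nat => (-1) ^+ a : Qbeta.
Let sgn_b := fun a b c : nat => (-1) ^+ b : Qbeta.
Let sgn_c := fun a b c : nat => (-1) ^+ c : Qbeta.

Let S3_swap12 f : S3 f = \sum_(a < n.+1) \sum_(b < n.+1) \sum_(c < n.+1)
  rscale (f b a c * (a + b + c == n)%N%:R) (t b a c).
Proof.
rewrite /S3 exchange_big; apply: eq_bigr => x _; apply: eq_bigr => y _.
by apply: eq_bigr => z _; rewrite /= (addnC y x).
Qed.

Let S3_swap23 f : S3 f = \sum_(a < n.+1) \sum_(b < n.+1) \sum_(c < n.+1)
  rscale (f a c b * (a + b + c == n)%N%:R) (t a c b).
Proof.
rewrite /S3; apply: eq_bigr => a _; rewrite exchange_big.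
apply: eq_bigr => x _; apply: eq_bigr => y _.
by rewrite /= (addnAC a y x).
Qed.

Let sum_pt (i j k : 'I_n.+1) (g : nat -> nat -> nat -> E) :
  (forall a b c : nat, [|| a != i, b != j | c != k]%N ->
     (a + b + c = n)%N -> g a b c = 0) ->
  \sum_(a < n.+1) \sum_(b < n.+1) \sum_(c < n.+1)
    rscale (a + b + c == n)%N%:R (g a b c) = rscale (i + j + k == n)%N%:R (g i j k).
Proof.
move=> g0.
have g0' a b c : [|| a != i :> nat, b != j :> nat | c != k :> nat]%N ->
  rscale (a + b + c == n)%N%:R (g a b c) = 0.
  move=> abc; case: eqP => [E1|_]; last by rewrite rscale0r.
  by rewrite g0 // rscaler0.
rewrite (bigD1 i) //= [X in _ + X]big1 ?addr0 => [|a ai]; last first.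
  by do 2!rewrite big1 // => ? _; rewrite g0' // ai.
rewrite (bigD1 j) //= [X in _ + X]big1 ?addr0 => [|b bj]; last first.
  by rewrite big1 // => ? _; rewrite g0' // bj orbT.
rewrite (bigD1 k) //= [X in _ + X]big1 ?addr0 // => c ck.
by rewrite g0' // ck !orbT.
Qed.

Let pair_sum (s : nat -> nat -> nat -> Qbeta) (u u' g : nat -> nat -> nat -> E) :
  (forall a b c, u a b c + u' a b c = g a b c) ->
  \sum_(a < n.+1) \sum_(b < n.+1) \sum_(c < n.+1)
    rscale (s a b c * (a + b + c == n)%N%:R) (u a b c) +
  \sum_(a < n.+1) \sum_(b < n.+1) \sum_(c < n.+1)
    rscale (s a b c * (a + b + c == n)%N%:R) (u' a b c) =
  \sum_(a < n.+1) \sum_(b < n.+1) \sum_(c < n.+1)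
    rscale (a + b + c == n)%N%:R (rscale (s a b c) (g a b c)).
Proof.
move=> ug; rewrite -big_split; apply: eq_bigr => a _.
rewrite -big_split; apply: eq_bigr => b _; rewrite -big_split.
by apply: eq_bigr => c _; rewrite /= -rscaleDr ug rscaleA mulrC.
Qed.

(** Exchanging two neighbours in [t] changes its sign unless both indices are 0. Adding a sum to its
    exchanged form thus leaves one multiple of [e]. The relations obtained in this way determine all
    three sums: (-1)^n e for [sgn_a] and [sgn_c], and (2 - (-1)^n) e for [sgn_b]. *)
Let Sab : S3 sgn_a + S3 sgn_b = rscale 2 e.
Proof.
rewrite S3_swap12 /S3 (pair_sum sgn_b (u := fun a b c => t b a c) (u' := t)
  (fun a b c => etrans (addrC _ _) (swap12 a b c))).
rewrite (@sum_pt ord0 ord0 ord_max (fun a b c => rscale (sgn_b a b c)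
  (rscale (2 * (a == 0)%N%:R * (b == 0)%N%:R) (v |> (- c%:Z))))) /=.
  by rewrite eqxx rscale1 /sgn_b expr0 rscale1 !mulr1.
move=> [|a] [|b] c; rewrite ?(mulr0, mul0r, rscale0r, rscaler0) //=.
by rewrite !add0n => /eqP.
Qed.

Let Sbc : S3 sgn_b + S3 sgn_c = rscale 2 e.
Proof.
rewrite (S3_swap23 sgn_b) /S3 (pair_sum sgn_c (u := fun a b c => t a c b) (u' := t)
  (fun a b c => etrans (addrC _ _) (swap23 a b c))).
rewrite (@sum_pt ord_max ord0 ord0 (fun a b c => rscale (sgn_c a b c)
  (rscale (2 * (b == 0)%N%:R * (c == 0)%N%:R) (v |> (- a%:Z))))) /=.
  by rewrite !addn0 eqxx rscale1 /sgn_c expr0 rscale1 !mulr1.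
move=> a [|b] [|c]; rewrite ?(mulr0, mul0r, rscale0r, rscaler0) //=.
by rewrite !addn0 orbF => /eqP.
Qed.

Let Scc : S3 sgn_c = rscale ((-1) ^+ n) e.
Proof.
apply: (@rscale_inj _ _ 2); first exact: (Qbeta_natr_neq0 1).
rewrite rscale_nat mulr2n {1}S3_swap12 /S3.
rewrite (pair_sum sgn_c (u := fun a b c => t b a c) (u' := t)
  (fun a b c => etrans (addrC _ _) (swap12 a b c))).
rewrite (@sum_pt ord0 ord0 ord_max (fun a b c => rscale (sgn_c a b c)
  (rscale (2 * (a == 0)%N%:R * (b == 0)%N%:R) (v |> (- c%:Z))))) /=.
  by rewrite eqxx rscale1 /sgn_c !mulr1 !rscaleA mulrC.
move=> [|a] [|b] c; rewrite ?(mulr0, mul0r, rscale0r, rscaler0) //=.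
by rewrite !add0n => /eqP.
Qed.

(** As [b_(n-c), phi_(-c)] = phi_(-n), the sum is that of the v b_(n-c) phi_(-c), minus [uphalf n]
    copies of [e]. For a + b odd, (-1)^b is half of (-1)^b - (-1)^a, a difference that vanishes for
    a + b even. The parity condition on n - c can therefore be dropped, and [S3 sgn_b - S3 sgn_a]
    appears. *)
Lemma vac_euler : rscale n%:R e =
  rscale (- 2) (\sum_(c < n.+1 | odd (n - c)) bop (n - c)%N (v |> (- c%:Z))).
Proof.
have Sb : S3 sgn_b = rscale (2 - (-1) ^+ n) e.
  by rewrite rscaleBl -Scc -Sbc addrK.
have Sa : S3 sgn_a = rscale ((-1) ^+ n) e.
  by apply: (addIr (S3 sgn_b)); rewrite Sab Sb -rscaleDl addrC subrK.
have termE (c : 'I_n.+1) : odd (n - c) -> bop (n - c)%N (v |> (- c%:Z)) =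
    rscale 4^-1 (rscale 2^-1 (\sum_(a < n.+1) \sum_(b < n.+1)
      (rscale (sgn_b a b c * (a + b + c == n)%N%:R) (t a b c) -
       rscale (sgn_a a b c * (a + b + c == n)%N%:R) (t a b c)))) - e.
  move=> nc; apply/eqP; rewrite eq_sym subr_eq eq_sym; apply/eqP.
  have -> : e = v |> (- c%:Z - (n - c)%N%:Z) by congr (_ |> _); have := ltn_ord c; lia.
  rewrite -(bop_phiE phiP covacP) //.
  rewrite (vaclike_bop vac nc (leq_ltn_trans (leq_subr c n) (ltnSn n))).
  rewrite rscale_actr; congr rscale; rewrite actr_suml rscale_sum.
  apply: eq_bigr => a _; rewrite actr_suml rscale_sum; apply: eq_bigr => b _.
  rewrite rscale_actr -/(t a b c) -rscaleBl rscaleA; congr rscale.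
  rewrite -mulrBl mulrA (_ : (a + b + c == n)%N = (a + b == n - c)%N); last first.
    by apply/eqP/eqP; have := ltn_ord c; lia.
  case: eqP => [E1|_]; last by rewrite !mulr0.
  congr (_ * _); move: nc; rewrite -E1 oddD /sgn_a /sgn_b.
  rewrite -[(-1) ^+ a]signr_odd -[(-1) ^+ b]signr_odd.
  have n2 := Qbeta_natr_neq0 1.
  case: (odd a) (odd b) => [] [] //= _; rewrite ?expr1 ?expr0 ?opprK.
    by rewrite -mulr2n mulVf.
  by rewrite -opprD mulrN -mulr2n mulVf.
rewrite (eq_bigr _ termE) sumrB -!rscale_sum.
rewrite [X in _ - X](_ : _ = rscale (uphalf n)%:R e); last first.
  by rewrite rscale_nat -sum_odd_ord -sumrMnr; apply: eq_bigr.
rewrite [X in rscale 2^-1 X](_ : _ = S3 sgn_b - S3 sgn_a); last first.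
  rewrite /S3 -sumrB exchange_big; apply: eq_bigr => a _.
  rewrite -sumrB exchange_big; apply: eq_bigr => b _; rewrite -sumrB big_mkcond.
  apply: eq_bigr => c _; case: ifPn => // nc; rewrite -rscaleBl -mulrBl.
  case: eqP => [E1|_]; last by rewrite mulr0 rscale0r.
  have : ~~ odd (a + b) by rewrite (_ : (a + b)%N = (n - c)%N) //; lia.
  rewrite oddD /sgn_a /sgn_b -[(-1) ^+ a]signr_odd -[(-1) ^+ b]signr_odd.
  by case: (odd a) (odd b) => [] [] // _; rewrite subrr mul0r rscale0r.
rewrite Sa Sb -rscaleBl !rscaleA -rscaleBl rscaleA; congr rscale.
by rewrite -[LHS](vac_euler_coef (Qbeta_natr_neq0 1)) [4^-1 * (_ * _)]mulrA.
Qed.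

End Triple.

End VacuumEuler.

Lemma zmod_cancel (V : zmodType) (x y z s a b : V) :
  x + y + z + (s + (a + b)) - (x + s + a) - y - (z + b) = 0.
Proof.
apply/eqP; rewrite !subr_eq add0r !addrA [X in X == _](ACl (3*6*2*1*4*5)%AC).
exact: eqxx.
Qed.

(** * The modes of the vertex operators q(y) *)

Section VertexModes.
Context (A : algType Qbeta) (phi : int -> A) (phiP : is_fermion_algebra phi).
Context (E : lmodType A^c) (covac : E) (covacP : is_dual_fock phi covac).
Implicit Types (w v u : E).

Local Notation "w |> n" := (actr w (phi n)) (at level 28, left associativity).
Local Notation bop := (@bop A phi E).
Let phi_rel : clifford_rel phi := fermion_rel phiP.
Let lb (m : int) : m != 0 -> klin (bop m) := bop_klinE phiP covacP (m := m).

(* [\sum_n y^n q_n = exp (2 \sum_(l odd) y^l b_l / l)], defined through the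
   recursion that its logarithmic derivative in [y] imposes on the [q_n]. *)
Fixpoint qseq (n : nat) w : seq E :=
  if n is n'.+1 then
    rcons (qseq n' w) (rscale (2 / n%:R)
      (\sum_(c < n | odd (n - c)) bop (n - c)%N (nth 0 (qseq n' w) c)))
  else [:: w].

Definition qop n w := nth 0 (qseq n w) n.

Lemma size_qseq n w : size (qseq n w) = n.+1.
Proof. by elim: n => //= n IH; rewrite size_rcons IH. Qed.

Lemma nth_qseq n w c : (c <= n)%N -> nth 0 (qseq n w) c = qop c w.
Proof.
elim: n => [|n IH]; first by rewrite leqn0 => /eqP ->.
rewrite leq_eqVlt => /orP[/eqP -> //|cn].
by rewrite /= nth_rcons size_qseq cn IH.
Qed.

Lemma qop0 w : qop 0 w = w. Proof. by []. Qed.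

Lemma qop_euler n w : rscale n%:R (qop n w) =
  rscale 2 (\sum_(c < n | odd (n - c)) bop (n - c)%N (qop c w)).
Proof.
case: n => [|n]; first by rewrite big_ord0 rscaler0 rscale0r.
have -> : qop n.+1 w = rscale (2 / n.+1%:R)
    (\sum_(c < n.+1 | odd (n.+1 - c)) bop (n.+1 - c)%N (qop c w)).
  rewrite /qop /= nth_rcons size_qseq ltnn eqxx; congr rscale.
  by apply: eq_bigr => c _; rewrite nth_qseq // -ltnS.
by rewrite rscaleA mulrC divfK // Qbeta_natr_neq0.
Qed.

(** The working tool for the q_n: linearity, commutation and the link with phi_(-n) are all obtained
    by checking that both sides solve the recursion. *)
Lemma qop_unique (f : nat -> E) w : f 0%N = w ->
  (forall n, rscale n%:R (f n) =
     rscale 2 (\sum_(c < n | odd (n - c)) bop (n - c)%N (f c))) ->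
  forall n, f n = qop n w.
Proof.
move=> f0 fS n; have [k] := ubnP n; elim: k n => // k IH [|n] nk; first by [].
apply: (@rscale_inj _ _ n.+1%:R); first exact: Qbeta_natr_neq0.
rewrite fS qop_euler; congr rscale; apply: eq_bigr => c _; congr bop.
by apply: IH; apply: leq_trans (ltn_ord c) _.
Qed.

Lemma odd_neq0 (n : nat) : odd n -> n%:Z != 0.
Proof. by case: n. Qed.

Lemma qop_klin n : klin (qop n).
Proof.
split=> [w w'|c w]; apply/esym.
  apply: (qop_unique (f := fun n => qop n w + qop n w')) => // {}n.
  rewrite rscaleDr !qop_euler -rscaleDr -big_split; congr rscale.
  by apply: eq_bigr => c nc; rewrite (klinD (lb (odd_neq0 nc))).
apply: (qop_unique (f := fun n => rscale c (qop n w))) => // {}n.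
rewrite rscaleA mulrC -rscaleA qop_euler rscaleA mulrC -rscaleA; congr rscale.
rewrite rscale_sum; apply: eq_bigr => d nd.
by rewrite (klinZ (lb (odd_neq0 nd))).
Qed.

Lemma bop_qop m n w : odd m -> bop m%:Z (qop n w) = qop n (bop m%:Z w).
Proof.
move=> mo; apply: (qop_unique (f := fun n => bop m%:Z (qop n w))) => // {}n.
have lm := lb (odd_neq0 mo).
rewrite -(klinZ lm) qop_euler (klinZ lm) (klin_sum _ _ _ lm); congr rscale.
by apply: eq_bigr => c nc; apply: (bopC phiP covacP) => //; have := odd_neq0 nc; lia.
Qed.

Lemma qopC m n w : qop m (qop n w) = qop n (qop m w).
Proof.
apply: (qop_unique (f := fun n => qop m (qop n w))) => // {}n.
have lm := qop_klin m.
rewrite -(klinZ lm) qop_euler (klinZ lm) (klin_sum _ _ _ lm); congr rscale.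
by apply: eq_bigr => c nc; rewrite [RHS]bop_qop.
Qed.

Definition qpred n w : E := if n is n'.+1 then qop n' w else 0.

Lemma qpred_euler n w : rscale n%:R (qpred n w) =
  rscale 2 (\sum_(c < n | odd (n - c)) bop (n - c)%N (qpred c w)) + qpred n w.
Proof.
case: n => [|n]; first by rewrite big_ord0 rscaler0 rscale0r addr0.
rewrite -natr1 rscaleDl rscale1 /=; congr (_ + _).
rewrite qop_euler big_mkcond [in RHS]big_mkcond big_ord_recl /=.
congr rscale; rewrite [X in X + _](_ : _ = 0) ?add0r.
  by apply: eq_bigr => c _; rewrite /bump /= subSS.
by rewrite (klin0 (@lb n.+1 isT)) if_same.
Qed.

(** In generating form, q(y) b_(-l) = (b_(-l) + y^l) q(y). The scalar l / 2 of [b_l, b_(-l)] cancels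
    against the factor 2 / l of y^l b_l in the exponent. *)
Lemma qop_bopN l n w : odd l -> bop (- l%:Z) (qop n w) =
  qop n (bop (- l%:Z) w) + (if (l <= n)%N then qop (n - l) w else 0).
Proof.
move=> lo; have l0 := odd_neq0 lo.
have lN : klin (bop (- l%:Z)) by apply: lb; rewrite oppr_eq0.
pose g n := if (l <= n)%N then qop (n - l) w else 0.
pose f n := bop (- l%:Z) (qop n w) - g n.
suff fE : f n = qop n (bop (- l%:Z) w) by rewrite -fE /f subrK.
apply: qop_unique => [|{}n]; first by rewrite /f /g leqn0 -eqz_nat (negPf l0) subr0.
rewrite /f rscaleBr -(klinZ lN) qop_euler (klinZ lN) (klin_sum _ _ _ lN).
have termE (c : 'I_n) : odd (n - c) ->
    bop (- l%:Z) (bop (n - c)%N (qop c w)) =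
    bop (n - c)%N (bop (- l%:Z) (qop c w)) +
    rscale ((n - c == l)%N%:R * (l%:R / 2)) (qop c w).
  move=> nc; case: eqP => [->|nl]; first by rewrite mul1r (bopNl phiP covacP).
  rewrite mul0r rscale0r addr0; apply: (bopC phiP covacP) => //; last by lia.
  by rewrite abszN.
rewrite (eq_bigr _ termE) big_split /= rscaleDr.
have fcE (c : 'I_n) : odd (n - c) -> bop (n - c)%N (bop (- l%:Z) (qop c w) - g c) =
    bop (n - c)%N (bop (- l%:Z) (qop c w)) - bop (n - c)%N (g c).
  by move=> nc; rewrite (klinD (lb (odd_neq0 nc))) (klinN _ (lb (odd_neq0 nc))).
rewrite (eq_bigr _ fcE) sumrB rscaleBr -addrA; congr (_ + _).
have -> : \sum_(c < n | odd (n - c)) rscale ((n - c == l)%N%:R * (l%:R / 2)) (qop c w) =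
    rscale (l%:R / 2) (g n).
  rewrite /g; case: leqP => [ln|nl]; last first.
    rewrite rscaler0 big1 // => c _; rewrite (_ : (n - c == l)%N = false).
      by rewrite mul0r rscale0r.
    by apply/eqP; lia.
  have cn : (n - l < n)%N by have := odd_gt0 lo; lia.
  rewrite (bigD1 (Ordinal cn)) /= ?subKn // eqxx mul1r big1 ?addr0 // => c /andP[_].
  rewrite -val_eqE /= => cl; rewrite (_ : (n - c == l)%N = false) ?mul0r ?rscale0r //.
  by apply: contra_neqF cl; have := ltn_ord c; lia.
have -> : rscale 2 (\sum_(c < n | odd (n - c)) bop (n - c)%N (g c)) =
    rscale (n%:R - l%:R) (g n).
  rewrite /g; case: leqP => [ln|nl]; last first.
    rewrite rscaler0 big1 ?rscaler0 // => c nc.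
    by rewrite leqNgt (ltn_trans (ltn_ord c) nl) (klin0 (lb (odd_neq0 nc))).
  rewrite -natrB // qop_euler; congr rscale; rewrite big_mkcond [RHS]big_mkcond.
  pose F c := if odd (n - c) then
    bop (n - c)%N (if (l <= c)%N then qop (c - l) w else 0) else 0.
  rewrite -[LHS](big_mkord xpredT F) (big_cat_nat (n := l)) //=.
  rewrite big_nat_cond big1 ?add0r => [|c]; last first.
    rewrite andbT /F => /andP[_ cl]; case: ifP => // nc.
    by rewrite leqNgt cl (klin0 (lb (odd_neq0 nc))).
  rewrite -{1}[l]add0n big_addn big_mkord; apply: eq_bigr => c _.
  by rewrite /F leq_addl addnK addnC subnDA.
rewrite rscaleA mulrCA divff ?mulr1; last exact: (Qbeta_natr_neq0 1).
by rewrite rscaleBl opprB.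
Qed.

(** With phi(z) the sum of the phi_n z^n, this is the coefficient of y^m z^n in (1 - y z) q(y)
    phi(z) = (1 + y z) phi(z) q(y). *)
Lemma qop_phi m n w :
  qop m w |> n - qpred m w |> (n - 1) = qop m (w |> n) + qpred m (w |> (n - 1)).
Proof.
(* The alternating sum [V] telescopes the terms that [bop] produces when it is
   moved across [phi]. *)
pose V m n := \sum_(c < m) rscale ((-1) ^+ (m.-1 - c)) (qop c w |> (n - m%:Z + c%:Z)).
have VS k p : V k.+1 p = qop k w |> (p - 1) - V k (p - 1).
  rewrite /V big_ord_recr /= subnn expr0 rscale1 addrC; congr (_ |> _ + _).
    by rewrite -addn1 PoszD; ring.
  rewrite -sumrN; apply: eq_bigr => c _; rewrite -rscaleNl; congr rscale.
    have -> : (k - c = (k.-1 - c).+1)%N by have := ltn_ord c; lia.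
    by rewrite exprS mulN1r.
  by congr (_ |> _); rewrite -addn1 PoszD; ring.
pose D k p := qop k w |> p - qpred k w |> (p - 1) - qop k (w |> p) - qpred k (w |> (p - 1)).
(* The two claims are proved together: the relation at k gives the closed form of [V] at k + 1, and
   this closed form completes the Euler recursion for [D] at k + 1. *)
suff D0 : forall k, (forall p, D k p = 0) /\ (forall p, rscale 2 (V k p) =
    qpred k w |> (p - 1) + qpred k (w |> (p - 1))).
  apply/eqP; rewrite -subr_eq0 opprD addrA; apply/eqP; exact: (D0 m).1.
move=> k; have [j] := ubnP k; elim: j k => // j IH [|k] kj.
  split=> p; first by rewrite /D !qop0 /= actr0l !subr0 subrr.
  by rewrite /V big_ord0 rscaler0 /= actr0l addr0.
have V2 p : rscale 2 (V k.+1 p) = qop k w |> (p - 1) + qop k (w |> (p - 1)).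
  have [Dk Vk] := IH k kj; rewrite VS rscaleBr Vk rscale_nat mulr2n.
  rewrite -addrA; congr (_ + _); have /eqP := Dk (p - 1).
  by rewrite /D addrAC subr_eq0 opprD addrA => /eqP.
split=> // p; apply: (@rscale_inj _ _ k.+1%:R); first exact: Qbeta_natr_neq0.
rewrite rscaler0 /D.
have q_phi c r : rscale c%:R (qop c w |> r) =
    rscale 2 (\sum_(d < c | odd (c - d)) bop (c - d)%N (qop d w |> r)) +
    rscale 2 (\sum_(d < c | odd (c - d)) qop d w |> (r - (c - d)%N%:Z)).
  rewrite -rscale_actr qop_euler rscale_actr actr_suml -rscaleDr -big_split.
  by congr rscale; apply: eq_bigr => d cd; rewrite (bop_phiE phiP covacP).
have qpred_phi c r : rscale c%:R (qpred c w |> r) =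
    rscale 2 (\sum_(d < c | odd (c - d)) bop (c - d)%N (qpred d w |> r)) +
    rscale 2 (\sum_(d < c | odd (c - d)) qpred d w |> (r - (c - d)%N%:Z)) + qpred c w |> r.
  rewrite -rscale_actr qpred_euler actrDl rscale_actr actr_suml -rscaleDr -big_split.
  congr (rscale _ _ + _); apply: eq_bigr => d cd.
  by rewrite (bop_phiE phiP covacP).
rewrite !rscaleBr q_phi qpred_phi qop_euler qpred_euler.
have VE : \sum_(d < k.+1 | odd (k.+1 - d)) qop d w |> (p - (k.+1 - d)%N%:Z) -
    \sum_(d < k.+1 | odd (k.+1 - d)) qpred d w |> (p - 1 - (k.+1 - d)%N%:Z) = V k.+1 p.
  pose u c := qop c w |> (p - k.+1%:Z + c%:Z).
  rewrite (_ : \sum_(d < k.+1 | _) qop d w |> _ =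
    \sum_(d < k) (if odd (k.+1 - d) then u d else 0) + u k); last first.
    rewrite big_mkcond big_ord_recr /= subSnn; congr (_ + _ |> _); last by lia.
    apply: eq_bigr => d _; case: ifP => // _; congr (_ |> _).
    by have := ltn_ord d; lia.
  rewrite (_ : \sum_(d < k.+1 | _) qpred d w |> _ =
    \sum_(d < k) (if odd (k - d) then u d else 0)); last first.
    rewrite big_mkcond big_ord_recl /= actr0l if_same add0r.
    apply: eq_bigr => d _; rewrite /bump /= add1n subSS; case: ifP => // _.
    by congr (_ |> _); have := ltn_ord d; lia.
  rewrite /V big_ord_recr /= subnn expr0 rscale1 addrAC; congr (_ + _).
  rewrite -sumrB; apply: eq_bigr => d _; rewrite subSn 1?ltnW // /= -signr_odd -/(u d).
  by case: (odd (k - d)); rewrite /= ?subr0 ?rscale1 // expr1 rscaleNl rscale1 sub0r.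
have {}VE : rscale 2 (\sum_(d < k.+1 | odd (k.+1 - d)) qop d w |> (p - (k.+1 - d)%N%:Z)) =
    rscale 2 (\sum_(d < k.+1 | odd (k.+1 - d)) qpred d w |> (p - 1 - (k.+1 - d)%N%:Z))
    + (qop k w |> (p - 1) + qop k (w |> (p - 1))).
  by rewrite -V2 -rscaleDr -VE addrC subrK.
have bE : \sum_(d < k.+1 | odd (k.+1 - d)) bop (k.+1 - d)%N (qop d w |> p) =
    \sum_(d < k.+1 | odd (k.+1 - d)) bop (k.+1 - d)%N (qpred d w |> (p - 1)) +
    \sum_(d < k.+1 | odd (k.+1 - d)) bop (k.+1 - d)%N (qop d (w |> p)) +
    \sum_(d < k.+1 | odd (k.+1 - d)) bop (k.+1 - d)%N (qpred d (w |> (p - 1))).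
  rewrite -!big_split; apply: eq_bigr => d kd /=.
  have ld := lb (odd_neq0 kd); rewrite -!(klinD ld); congr bop.
  have [/(_ p) + _] := IH d (leq_trans (ltn_ord d) kj).
  by rewrite /D -!addrA => /eqP; rewrite -!opprD subr_eq0 => /eqP.
by rewrite VE bE !rscaleDr /= zmod_cancel.
Qed.

(** The recursion [vac_euler] becomes the one of the q_n after multiplication by (-1)^n: the minus
    sign is absorbed because n - c is odd. *)
Lemma vac_qop v n : vaclike phi v ->
  v |> (- n%:Z) = rscale ((-1) ^+ n) (qop n (v |> 0)).
Proof.
move=> vac; rewrite -(@qop_unique (fun n => rscale ((-1) ^+ n) (v |> (- n%:Z)))).
- by rewrite rscaleA -expr2 sqrr_sign rscale1.
- by rewrite rscale1 oppr0.
move=> {}n; rewrite rscaleA mulrC -rscaleA (vac_euler phiP covacP vac).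
rewrite big_mkcond big_ord_recr /= subnn addr0 -big_mkcond /= rscaleA.
rewrite (_ : _ * -2 = 2 * - (-1) ^+ n); last by rewrite mulrN mulrN mulrC.
rewrite -rscaleA; congr rscale; rewrite rscale_sum; apply: eq_bigr => c nc.
rewrite (klinZ (lb (odd_neq0 nc))); congr rscale.
rewrite -[n in LHS](subnK (ltnW (ltn_ord c))) exprD -[(-1) ^+ (n - c)]signr_odd nc.
by rewrite expr1 mulN1r opprK.
Qed.

(** By [vac_qop] for v phi_0, v q_n is a multiple of v phi_0 phi_(-n), and phi_0 anticommutes with
    phi_(-n); [vac_qop] for v then applies. *)
Lemma qop_phi0 v n : vaclike phi v -> (0 < n)%N ->
  qop n v |> 0 = - qop n (v |> 0).
Proof.
move=> vac n_gt0; apply: (@rscale_inj _ _ ((-1) ^+ n)).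
  by rewrite signr_eq0.
have vE : v = v |> 0 |> 0 by rewrite (phi00 phi_rel).
rewrite rscaleNr -vac_qop // -rscale_actr {1}vE -vac_qop; last exact: vaclike_phi0.
rewrite (actr_anticomm0 phi_rel); last by rewrite addr0 oppr_eq0; lia.
by rewrite -vE.
Qed.

End VertexModes.

(** * Formal power series *)

Section PowerSeries.
Variable R : comNzRingType.

Definition fps : Type := nat -> R.
Definition fcoef (f : fps) (d : nat) : R := f d.

Lemma fpsP (f g : fps) : fcoef f =1 fcoef g -> f = g.
Proof. exact: funext. Qed.

HB.instance Definition _ := gen_eqMixin fps.
HB.instance Definition _ := gen_choiceMixin fps.

Definition fps_zero : fps := fun=> 0.
Definition fps_add (f g : fps) : fps := fun d => f d + g d.
Definition fps_opp (f : fps) : fps := fun d => - f d.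

Fact fps_addA : associative fps_add.
Proof. by move=> f g h; apply: fpsP => d; exact: addrA. Qed.
Fact fps_addC : commutative fps_add.
Proof. by move=> f g; apply: fpsP => d; exact: addrC. Qed.
Fact fps_add0 : left_id fps_zero fps_add.
Proof. by move=> f; apply: fpsP => d; exact: add0r. Qed.
Fact fps_addN : left_inverse fps_zero fps_opp fps_add.
Proof. by move=> f; apply: fpsP => d; exact: addNr. Qed.

HB.instance Definition _ :=
  GRing.isZmodule.Build fps fps_addA fps_addC fps_add0 fps_addN.

Definition fps_one : fps := fun d => (d == 0%N)%:R.
Definition fps_mul (f g : fps) : fps := fun d => \sum_(i < d.+1) f i * g (d - i)%N.

Definition ftrunc N (f : fps) : {poly R} := \poly_(i < N) f i.

(** Low coefficients of a product depend on truncations only; commutativity and associativity are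
    thus inherited from polynomials. *)
Lemma fps_mul_trunc N (f g : fps) d : (d < N)%N ->
  fps_mul f g d = (ftrunc N f * ftrunc N g)`_d.
Proof.
move=> dN; rewrite coefM; apply: eq_bigr => i _; rewrite !coef_poly.
by rewrite !(leq_ltn_trans _ dN) ?leq_subr // -ltnS.
Qed.

Fact fps_mulC : commutative fps_mul.
Proof.
by move=> f g; apply: fpsP => d; rewrite /fcoef !(fps_mul_trunc _ _ (ltnSn d)) mulrC.
Qed.
Fact fps_mulA : associative fps_mul.
Proof.
move=> f g h; apply: fpsP => d; rewrite /fcoef.
have E1 p q : fps_mul p (fps_mul q h) d =
  (ftrunc d.+1 p * (ftrunc d.+1 q * ftrunc d.+1 h))`_d.
  rewrite coefM; apply: eq_bigr => i _.
  by rewrite coef_poly ltn_ord -fps_mul_trunc // ltnS leq_subr.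
rewrite E1 mulrA mulrC fps_mulC.
rewrite /fps_mul coefM; apply: eq_bigr => i _.
by rewrite coef_poly ltn_ord -fps_mul_trunc // ltnS leq_subr.
Qed.
Fact fps_mul1 : left_id fps_one fps_mul.
Proof.
move=> f; apply: fpsP => d; rewrite /fcoef /fps_mul big_ord_recl /= mul1r subn0.
by rewrite big1 ?addr0 // => i _; rewrite /fps_one /= mul0r.
Qed.
Fact fps_mulDl : left_distributive fps_mul fps_add.
Proof.
move=> f g h; apply: fpsP => d; rewrite /fcoef /fps_add /fps_mul -big_split.
by apply: eq_bigr => i _; exact: mulrDl.
Qed.
Fact fps_one_neq0 : fps_one != fps_zero.
Proof. by apply/eqP => /(congr1 (fun f => f 0%N)) /eqP; rewrite oner_eq0. Qed.

HB.instance Definition _ := GRing.Zmodule_isComNzRing.Build fps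
  fps_mulA fps_mulC fps_mul1 fps_mulDl fps_one_neq0.

Implicit Types (f g h : fps) (d N : nat).

Lemma fcoef0 d : fcoef 0 d = 0. Proof. by []. Qed.
Lemma fcoef1 d : fcoef 1 d = (d == 0%N)%:R. Proof. by []. Qed.
Lemma fcoefD f g d : fcoef (f + g) d = fcoef f d + fcoef g d. Proof. by []. Qed.
Lemma fcoefN f d : fcoef (- f) d = - fcoef f d. Proof. by []. Qed.
Lemma fcoefB f g d : fcoef (f - g) d = fcoef f d - fcoef g d. Proof. by []. Qed.
Lemma fcoefM f g d :
  fcoef (f * g) d = \sum_(i < d.+1) fcoef f i * fcoef g (d - i).
Proof. by []. Qed.
Lemma fcoef_sum I (r : seq I) P (F : I -> fps) d :
  fcoef (\sum_(i <- r | P i) F i) d = \sum_(i <- r | P i) fcoef (F i) d.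
Proof. exact: (big_morph (fcoef^~ d)). Qed.

Definition fps_poly (p : {poly R}) : fps := fun d => p`_d.

Fact fps_poly_zmod : zmod_morphism fps_poly.
Proof. by move=> p q; apply: fpsP => d; exact: coefB. Qed.
Fact fps_poly_monoid : monoid_morphism fps_poly.
Proof.
by split=> [|p q]; apply: fpsP => d; [exact: coef1|exact: coefM].
Qed.

HB.instance Definition _ :=
  GRing.isZmodMorphism.Build {poly R} fps fps_poly fps_poly_zmod.
HB.instance Definition _ :=
  GRing.isMonoidMorphism.Build {poly R} fps fps_poly fps_poly_monoid.

Lemma fcoef_poly p d : fcoef (fps_poly p) d = p`_d. Proof. by []. Qed.

Definition fpsC (c : R) : fps := fps_poly c%:P.
HB.instance Definition _ := GRing.RMorphism.copy fpsC (fps_poly \o polyC).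
Definition fpsX : fps := fps_poly 'X.

Lemma fcoefCM c f d : fcoef (fpsC c * f) d = c * fcoef f d.
Proof.
rewrite fcoefM big_ord_recl big1 ?addr0 ?subn0; first by rewrite fcoef_poly coefC.
by move=> i _; rewrite fcoef_poly coefC mul0r.
Qed.

Lemma fcoefXM f d : fcoef (fpsX * f) d = if d is d'.+1 then fcoef f d' else 0.
Proof.
rewrite fcoefM; case: d => [|d]; first by rewrite big_ord1 fcoef_poly coefX mul0r.
rewrite big_ord_recl fcoef_poly coefX mul0r add0r big_ord_recl fcoef_poly coefX mul1r.
rewrite big1 ?addr0; first by rewrite /= /bump subSS subn0.
by move=> i _; rewrite fcoef_poly coefX mul0r.
Qed.

(** Congruence modulo t^N; [ford N] below is divisibility by t^N. Limits are taken by proving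
    congruences for all N. *)
Definition feqm N f g := forall d, (d < N)%N -> fcoef f d = fcoef g d.
Definition ford N f := feqm N f 0.

Lemma feqm_refl N f : feqm N f f. Proof. by []. Qed.
Lemma feqm_sym N f g : feqm N f g -> feqm N g f.
Proof. by move=> fg d dN; rewrite fg. Qed.
Lemma feqm_trans N f g h : feqm N f g -> feqm N g h -> feqm N f h.
Proof. by move=> fg gh d dN; rewrite fg // gh. Qed.
Lemma feqmW M N f g : (M <= N)%N -> feqm N f g -> feqm M f g.
Proof. by move=> MN fg d dM; apply: fg; exact: leq_trans MN. Qed.
Lemma feqmP f g : (forall N, feqm N f g) -> f = g.
Proof. by move=> fg; apply: fpsP => d; exact: (fg d.+1). Qed.
Lemma feqmD N f f' g g' : feqm N f f' -> feqm N g g' -> feqm N (f + g) (f' + g').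
Proof. by move=> ff gg d dN; rewrite !fcoefD ff // gg. Qed.
Lemma feqmM N f f' g g' : feqm N f f' -> feqm N g g' -> feqm N (f * g) (f' * g').
Proof.
move=> ff gg d dN; rewrite !fcoefM; apply: eq_bigr => i _.
by rewrite ff ?gg //; apply: leq_ltn_trans dN; rewrite ?leq_subr // -ltnS.
Qed.
Lemma feqm_sum N I (r : seq I) (P : pred I) (F G : I -> fps) :
  (forall i, P i -> feqm N (F i) (G i)) ->
  feqm N (\sum_(i <- r | P i) F i) (\sum_(i <- r | P i) G i).
Proof.
by move=> FG d dN; rewrite !fcoef_sum; apply: eq_bigr => i Pi; exact: FG.
Qed.

Lemma fordM M N f g : ford M f -> ford N g -> ford (M + N) (f * g).
Proof.
move=> fM gN d dMN; rewrite fcoefM big1 // => i _.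
have [iM|Mi] := ltnP i M; first by rewrite fM // fcoef0 mul0r.
by rewrite gN ?fcoef0 ?mulr0 //; have := ltn_ord i; lia.
Qed.
Lemma ford0 f : ford 0 f. Proof. by []. Qed.
Lemma fordMl N f g : ford N g -> ford N (f * g).
Proof. by move/(fordM (@ford0 f)). Qed.
Lemma fordMr N f g : ford N f -> ford N (f * g).
Proof. by rewrite mulrC; exact: fordMl. Qed.
Lemma fordX N f : ford 1 f -> ford N (f ^+ N).
Proof.
move=> f1; elim: N => [|N IH]; first exact: ford0.
by rewrite exprS -add1n; exact: fordM.
Qed.

(* The Euler derivation [t d/dt] *)
Definition fder f : fps := fun d => d%:R * f d.
Lemma fcoef_der f d : fcoef (fder f) d = d%:R * fcoef f d. Proof. by []. Qed.
Fact fder_zmod : zmod_morphism fder.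
Proof. by move=> f g; apply: fpsP => d; exact: mulrBr. Qed.
HB.instance Definition _ := GRing.isZmodMorphism.Build fps fps fder fder_zmod.
Lemma fderM f g : fder (f * g) = fder f * g + f * fder g.
Proof.
apply: fpsP => d; rewrite fcoefD fcoef_der !fcoefM mulr_sumr -big_split.
apply: eq_bigr => i _; rewrite !fcoef_der -{1}(subnKC (ltnSE (ltn_ord i))) natrD /=.
by ring.
Qed.
Lemma fderC c : fder (fpsC c) = 0.
Proof.
apply: fpsP => d; rewrite fcoef_der fcoef_poly coefC.
by case: d => [|d]; rewrite ?mul0r ?mulr0.
Qed.
Lemma fder1 : fder 1 = 0. Proof. by rewrite -(rmorph1 fpsC) fderC. Qed.
Lemma fderCM c f : fder (fpsC c * f) = fpsC c * fder f.
Proof. by rewrite fderM fderC mul0r add0r. Qed.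
Lemma fderX f n : fder (f ^+ n) = f ^+ n.-1 * fder f *+ n.
Proof.
elim: n => [|n IH]; first by rewrite fder1.
rewrite exprS fderM IH [fder f * _]mulrC mulrnAr mulrA [RHS]mulrS; congr (_ + _).
by case: n {IH} => [|n]; rewrite ?mulr0n // -exprS.
Qed.
Lemma feqm_der N f g : feqm N f g -> feqm N (fder f) (fder g).
Proof. by move=> fg d dN; rewrite !fcoef_der fg. Qed.
Lemma fder_fpsX : fder fpsX = fpsX.
Proof.
apply: fpsP => d; rewrite fcoef_der fcoef_poly coefX.
by case: d => [|[|d]]; rewrite ?mul0r ?mul1r ?mulr0.
Qed.

End PowerSeries.

Section FieldPowerSeries.
Variable K : fieldType.
Implicit Types (f g : fps K).

Lemma fps_mul_reg f g d : ford d f -> fcoef f d != 0 -> f * g = 0 -> g = 0.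
Proof.
move=> fd f0 fg; apply: fpsP => k; have [n] := ubnP k; elim: n k => // n IH k kn.
have := congr1 (fun h => fcoef h (d + k)%N) fg; rewrite fcoefM fcoef0.
have dk : (d < (d + k).+1)%N by rewrite ltnS leq_addr.
rewrite (bigD1 (Ordinal dk)) //= addKn big1 ?addr0 => [/eqP|i id].
  by rewrite mulf_eq0 (negPf f0) /= => /eqP.
have [il|li] := ltnP i d; first by rewrite fd // fcoef0 mul0r.
rewrite IH ?fcoef0 ?mulr0 //; have := ltn_ord i.
by move: id; rewrite -val_eqE /= => id; lia.
Qed.

Lemma fps_mul_reg0 f g : fcoef f 0 != 0 -> f * g = 0 -> g = 0.
Proof. exact: fps_mul_reg. Qed.

(** As u has no constant term, the equation expresses (k + 1) times coefficient k + 1 of the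
    difference through its lower coefficients, which vanish. *)
Lemma fder_unique f g u : (forall n, n.+1%:R != 0 :> K) -> ford 1 u ->
  fcoef f 0 = fcoef g 0 -> fder f = u * f -> fder g = u * g -> f = g.
Proof.
move=> n0 u0 fg0 Df Dg; apply/eqP; rewrite -subr_eq0; apply/eqP.
have : fder (f - g) = u * (f - g) by rewrite raddfB /= Df Dg mulrBr.
have : fcoef (f - g) 0 = 0 by rewrite fcoefB fg0 subrr.
move: (f - g) => h h0 Dh; apply: fpsP => k; have [n] := ubnP k.
elim: n k => // n IH [|k] kn; first by [].
have := congr1 (fun h => fcoef h k.+1) Dh; rewrite fcoef_der fcoefM big_ord_recl.
rewrite u0 // fcoef0 mul0r add0r big1 => [/eqP|i _].
  by rewrite mulf_eq0 (negPf (n0 k)) /= => /eqP.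
rewrite IH ?fcoef0 ?mulr0 //= /bump; have := ltn_ord i; lia.
Qed.

End FieldPowerSeries.

(** * Vertex operators acting on functionals *)

Section VertexOperators.
Context (A : algType Qbeta) (phi : int -> A) (phiP : is_fermion_algebra phi).
Context (E : lmodType A^c) (covac : E) (covacP : is_dual_fock phi covac).
Context (L : fieldType) (iota : {rmorphism Qbeta -> L}).
Implicit Types (w v : E) (F G : E -> fps L) (y z : fps L) (N m n l : nat).

Local Notation "w |> n" := (actr w (phi n)) (at level 28, left associativity).
Local Notation bop := (@bop A phi E).
Local Notation qop := (qop phi).
Local Notation qpred := (qpred phi).

Record flin F : Prop := Flin {
  flinD : {morph F : w w' / w + w'};
  flinZ : forall c w, F (rscale c w) = fpsC (iota c) * F w }.

Lemma flin0 F : flin F -> F 0 = 0.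
Proof. by move=> [_ /(_ 0 0)]; rewrite rscale0r !rmorph0 mul0r. Qed.
Lemma flinN F w : flin F -> F (- w) = - F w.
Proof.
move=> [_ /(_ (-1) w)]; rewrite rscaleNl rscale1 => ->.
by rewrite !rmorphN1 mulN1r.
Qed.
Lemma flin_sum F I (r : seq I) P (g : I -> E) : flin F ->
  F (\sum_(i <- r | P i) g i) = \sum_(i <- r | P i) F (g i).
Proof. by move=> lF; apply: (big_morph F (flinD lF) (flin0 lF)). Qed.
Lemma flin_comp F f : klin f -> flin F -> flin (fun w => F (f w)).
Proof.
by move=> [fD fZ] [FD FZ]; split=> [w w'|c w]; rewrite ?fD ?FD // fZ FZ.
Qed.

(* [(vop y F) w] is [F (w q(y))] with [q(y) = \sum_n y^n q_n]; the sum makes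
   sense because [y] has no constant term. *)
Definition vop y F w : fps L :=
  fun d => fcoef (\sum_(m < d.+1) y ^+ m * F (qop m w)) d.

Lemma fsum_cut N M y (h : nat -> fps L) : ford 1 y -> (N <= M)%N ->
  feqm N (\sum_(m < N) y ^+ m * h m) (\sum_(m < M) y ^+ m * h m).
Proof.
move=> y1 NM d dN.
rewrite -!(big_mkord xpredT (fun m => y ^+ m * h m)) [in RHS](big_cat_nat (n := N)) //=.
rewrite fcoefD [X in _ = _ + X](_ : _ = 0) ?addr0 //.
rewrite fcoef_sum big_nat_cond big1 // => m; rewrite andbT => /andP[Nm _].
have hm : ford m (y ^+ m * h m) by apply: fordMr; exact: fordX.
by rewrite hm //; exact: leq_trans Nm.
Qed.

Lemma vop_feqm N y F w : ford 1 y ->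
  feqm N (vop y F w) (\sum_(m < N) y ^+ m * F (qop m w)).
Proof. by move=> y1 d dN; exact: (fsum_cut (fun m => F (qop m w)) y1 dN (ltnSn d)). Qed.

Lemma vopE y F w d :
  fcoef (vop y F w) d = \sum_(m < d.+1) fcoef (y ^+ m * F (qop m w)) d.
Proof. by rewrite -fcoef_sum. Qed.

Lemma vop_flin y F : flin F -> flin (vop y F).
Proof.
move=> lF; split=> [w w'|c w]; apply: fpsP => d.
  rewrite fcoefD !vopE -big_split; apply: eq_bigr => m _ /=.
  by rewrite (klinD (qop_klin phiP covacP m)) (flinD lF) mulrDr fcoefD.
rewrite fcoefCM !vopE mulr_sumr; apply: eq_bigr => m _.
by rewrite (klinZ (qop_klin phiP covacP m)) (flinZ lF) mulrCA fcoefCM.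
Qed.

Lemma vopD y F G w : vop y (fun w => F w + G w) w = vop y F w + vop y G w.
Proof.
apply: fpsP => d; rewrite fcoefD !vopE -big_split; apply: eq_bigr => m _ /=.
by rewrite mulrDr fcoefD.
Qed.

Lemma vopM y c F w : ford 1 y -> vop y (fun w => c * F w) w = c * vop y F w.
Proof.
move=> y1; apply: feqmP => N; apply: feqm_trans (vop_feqm _ _ y1) _.
apply: feqm_trans (feqmM (@feqm_refl _ N c) (feqm_sym (vop_feqm _ _ y1))).
by rewrite mulr_sumr; under eq_bigr do rewrite mulrCA.
Qed.

Lemma vop_comp y F f w : (forall m w, f (qop m w) = qop m (f w)) ->
  vop y (fun w => F (f w)) w = vop y F (f w).
Proof.
move=> fq; by apply: fpsP => d; rewrite !vopE; apply: eq_bigr => m _; rewrite fq.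
Qed.

Lemma vop_local y F G w N :
  (forall m, (m < N)%N -> feqm N (F (qop m w)) (G (qop m w))) ->
  feqm N (vop y F w) (vop y G w).
Proof.
move=> FG d dN; rewrite !vopE; apply: eq_bigr => m _.
have FGm := FG m (leq_trans (ltn_ord m) dN).
exact: (feqmM (@feqm_refl _ N (y ^+ m)) FGm dN).
Qed.

Lemma vopC y z F w : ford 1 y -> ford 1 z -> flin F ->
  vop y (vop z F) w = vop z (vop y F) w.
Proof.
move=> y1 z1 lF; apply: feqmP => N.
have E1 (u v : fps L) : ford 1 u -> ford 1 v -> feqm N (vop u (vop v F) w)
    (\sum_(m < N) \sum_(l < N) u ^+ m * v ^+ l * F (qop l (qop m w))).
  move=> u1 v1; apply: feqm_trans (vop_feqm _ _ u1) _.
  apply: feqm_sum => m _; apply: feqm_trans (feqmM _ (vop_feqm _ _ v1)) _ => //.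
  by rewrite mulr_sumr; apply: feqm_sum => l _; rewrite mulrA.
apply: feqm_trans (E1 _ _ y1 z1) _; apply: feqm_sym.
apply: feqm_trans (E1 _ _ z1 y1) _; rewrite exchange_big.
apply: feqm_sum => m _; apply: feqm_sum => l _.
by rewrite (qopC phiP covacP) [y ^+ _ * _]mulrC.
Qed.

Lemma vop_shift N y F w l : ford 1 y -> flin F -> feqm N (y ^+ l * vop y F w)
  (\sum_(m < N) y ^+ m * F (if (l <= m)%N then qop (m - l) w else 0)).
Proof.
move=> y1 lF; pose h m := F (if (l <= m)%N then qop (m - l) w else 0).
apply: feqm_trans (feqm_sym (fsum_cut h y1 (leq_addl l N))).
apply: feqm_trans (feqmM (@feqm_refl _ N _) (vop_feqm _ _ y1)) _.
rewrite big_split_ord /= [X in feqm _ _ (X + _)]big1 ?add0r => [|m _]; last first.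
  by rewrite /h leqNgt ltn_ord (flin0 lF) mulr0.
rewrite mulr_sumr; apply: feqm_sum => m _.
by rewrite /h leq_addr addKn mulrA exprD.
Qed.

(** [qop_phi] summed over m against y^m; the term with y and phi_(n-1) stays on the right so that
    nothing is divided by 1 - y z. *)
Lemma vop_phi y F w (n : int) : ford 1 y -> flin F ->
  vop y (fun w => F (w |> n)) w =
  y * vop y (fun w => F (w |> (n - 1))) w + vop y F (w |> n) + y * vop y F (w |> (n - 1)).
Proof.
move=> y1 lF; apply: feqmP => N.
have lFn : flin (fun w => F (w |> (n - 1))) by apply: flin_comp lF; exact: klin_actr.
apply: feqm_trans (vop_feqm _ _ y1) _; apply: feqm_sym.
have qpredE m (u : E) : (if (1 <= m)%N then qop (m - 1) u else 0) = qpred m u.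
  by case: m => //= m; rewrite subSS subn0.
have := @vop_shift N _ _ w 1 y1 lFn; have := @vop_shift N _ _ (w |> (n - 1)) 1 y1 lF.
rewrite expr1 => s1 s2; apply: feqm_trans (feqmD (feqmD s2 (vop_feqm _ _ y1)) s1) _.
rewrite -!big_split; apply: feqm_sum => m _ /=.
rewrite -!mulrDr !qpredE; apply: feqmM => //.
have := qop_phi phiP covacP m n w => /eqP; rewrite subr_eq => /eqP ->.
by rewrite !(flinD lF) -addrA addrC.
Qed.

Lemma vop_bopN y F w l : ford 1 y -> flin F -> odd l ->
  vop y (fun w => F (bop (- l%:Z) w)) w = vop y F (bop (- l%:Z) w) + y ^+ l * vop y F w.
Proof.
move=> y1 lF lo; apply: feqmP => N.
apply: feqm_trans (vop_feqm _ _ y1) _; apply: feqm_sym.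
apply: feqm_trans (feqmD (vop_feqm _ _ y1) (vop_shift _ _ y1 lF)) _.
rewrite -big_split; apply: feqm_sum => m _ /=.
by rewrite -mulrDr (qop_bopN phiP covacP) // (flinD lF).
Qed.

Lemma vop_bop y F w l : odd l ->
  vop y (fun w => F (bop l%:Z w)) w = vop y F (bop l%:Z w).
Proof.
by move=> lo; apply: vop_comp => m u; rewrite (bop_qop phiP covacP).
Qed.

End VertexOperators.

(** With l = m - c the triangle becomes the part l + c < N of the square, and the rest of the square
    is divisible by t^N. *)
Lemma feqm_triangle (R : comNzRingType) N (g : nat -> nat -> fps R) :
  (forall l c, odd l -> (N <= l + c)%N -> ford N (g l c)) ->
  feqm N (\sum_(m < N) \sum_(c < m | odd (m - c)) g (m - c)%N c)
    (\sum_(l < N | odd l) \sum_(c < N) g l c).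
Proof.
move=> gN; rewrite [X in feqm _ _ X]exchange_big /=.
have widen (m : 'I_N) : \sum_(c < m | odd (m - c)) g (m - c)%N c =
    \sum_(c < N | odd (m - c) && (c < m)%N) g (m - c)%N c.
  exact: (big_ord_widen_cond N (fun c => odd (m - c)) (fun c => g (m - c)%N c) (ltnW (ltn_ord m))).
rewrite (eq_bigr _ (fun m _ => widen m)) (exchange_big_dep xpredT) //=.
apply: feqm_sum => c _.
rewrite -(big_mkord (fun m => odd (m - c) && (c < m)%N) (fun m => g (m - c)%N c)).
rewrite -(big_mkord (fun l => odd l) (fun l => g l c)).
rewrite (big_cat_nat (n := c)) ?(ltnW (ltn_ord c)) //= big_nat_cond big1 ?add0r; last first.
  by move=> m /andP[/andP[_ mc] /andP[_]]; rewrite ltnNge (ltnW mc).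
rewrite -{1}[c : nat]add0n big_addn [X in feqm _ _ X](big_cat_nat (n := N - c)) ?leq_subr //=.
rewrite -[X in feqm _ X]addr0; apply: feqmD.
  rewrite (eq_bigl (fun l => odd l)) => [|l]; last first.
    rewrite addnK; case: l => [|l] //.
    by rewrite addSn ltnS leq_addl andbT.
  by rewrite (eq_bigr (fun l => g l c)) // => l _; rewrite addnK.
apply: feqm_sym => d dN; rewrite fcoef_sum big_nat_cond big1 //.
by move=> l /andP[/andP[Nl _] lo]; rewrite gN //; lia.
Qed.

Section Derivation.
Context (A : algType Qbeta) (phi : int -> A) (phiP : is_fermion_algebra phi).
Context (E : lmodType A^c) (covac : E) (covacP : is_dual_fock phi covac).
Context (L : fieldType) (iota : {rmorphism Qbeta -> L}).
Implicit Types (w v : E) (F G : E -> fps L) (y z : fps L) (N m n l : nat).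

Local Notation bop := (@bop A phi E).
Local Notation qop := (qop phi).
Local Notation flin := (flin iota).
Local Notation vop := (vop phi).

Lemma flin_rscale_nat F n w : flin F -> F (rscale n%:R w) = F w *+ n.
Proof. by move=> lF; rewrite (flinZ lF) !rmorph_nat mulr_natl. Qed.

(** The Euler recursion of q_m turns the factor m produced by differentiating y^m into the odd b_l.
    The power l - 1 avoids a logarithmic derivative of y, which is not invertible. *)
Lemma vop_der N y F w : ford 1 y -> flin F ->
  feqm N (fder (vop y F w)) (vop y (fun w => fder (F w)) w +
    \sum_(l < N | odd l) y ^+ l.-1 * fder y * (vop y F (bop l%:Z w) *+ 2)).
Proof.
move=> y1 lF; apply: feqm_trans (feqm_der (vop_feqm _ _ _ y1)) _.
pose g l c := y ^+ l.-1 * fder y * (y ^+ c * (F (qop c (bop l%:Z w)) *+ 2)).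
have E1 m : fder (y ^+ m * F (qop m w)) =
    \sum_(c < m | odd (m - c)) g (m - c)%N c + y ^+ m * fder (F (qop m w)).
  rewrite fderM; congr (_ + _); rewrite fderX mulrnAl -mulrnAr.
  rewrite -(flin_rscale_nat _ _ lF) qop_euler (flin_rscale_nat 2 _ lF) (flin_sum _ _ _ lF).
  rewrite -sumrMnl mulr_sumr; apply: eq_bigr => c mc.
  rewrite (bop_qop phiP covacP) // /g mulrA; congr (_ * _).
  rewrite mulrAC -exprD; congr (_ ^+ _ * _).
  by have := odd_gt0 mc; lia.
rewrite raddf_sum (eq_bigr _ (fun (m : 'I_N) _ => E1 m)) big_split /= addrC.
apply: feqmD; first exact: feqm_sym (vop_feqm _ _ _ y1).
have y_der1 : ford 1 (fder y) by move=> d d1; rewrite fcoef_der y1 // mulr0.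
apply: feqm_trans (feqm_triangle _) _ => [l c lo lc|].
  have -> : g l c = y ^+ l.-1 * (fder y * y ^+ c) * (F (qop c (bop l%:Z w)) *+ 2).
    by rewrite /g !mulrA.
  apply: (@feqmW _ _ (l.-1 + (1 + c))); first by have := odd_gt0 lo; lia.
  by apply: fordMr; apply: fordM; [exact: fordX|apply: fordM => //; exact: fordX].
apply: feqm_sum => l lo; rewrite /g -mulr_sumr; apply: feqmM => //.
apply: feqm_sym; rewrite mulr2n; apply: feqm_trans (feqmD (vop_feqm _ _ _ y1) (vop_feqm _ _ _ y1)) _.
by rewrite -big_split; apply: feqm_sum => c _ /=; rewrite mulr2n mulrDr.
Qed.

End Derivation.

(** * The series y attached to x = xi t *)

Section YSeries.
Context (L : fieldType) (a : L).
Implicit Types (xi eta : L).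

Definition xser xi : fps L := fpsC xi * fpsX L.
(* [x / (1 + a x)] for [x = xser xi] *)
Definition yser xi : fps L :=
  fun d => if d is d'.+1 then (- a) ^+ d' * xi ^+ d else 0.

Lemma yserE xi : (1 + fpsC a * xser xi) * yser xi = xser xi.
Proof.
apply: fpsP => d; rewrite /xser mulrDl mul1r fcoefD -!mulrA !fcoefCM !fcoefXM.
rewrite fcoef_poly coefX; case: d => [|[|d]]; rewrite ?mulr0 ?mulr1.
- by rewrite addr0.
- by rewrite /fcoef /= addr0 expr0 mul1r expr1.
- by rewrite /fcoef /= !exprS; ring.
Qed.

Lemma yser_ord xi : ford 1 (yser xi).
Proof. by case. Qed.

Lemma xser_ord xi : ford 1 (xser xi).
Proof. by move=> [|//] _; rewrite fcoefCM fcoef_poly coefX mulr0. Qed.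

Lemma unit_cancel c (f : fps L) xi : (1 + fpsC c * xser xi) * f = 0 -> f = 0.
Proof.
apply: fps_mul_reg0; rewrite fcoefD fcoefCM xser_ord // mulr0 addr0.
by rewrite fcoef1 oner_eq0.
Qed.

(** This is (y_xi + y_eta) / (y_xi - y_eta): over the common denominator of the two series the
    factor t cancels, leaving the scalar xi - eta below and a polynomial of degree at most 1 in t
    above. *)
Definition yratio xi eta : fps L :=
  fpsC (xi - eta)^-1 * (fpsC (xi + eta) + fpsC (2 * a * xi * eta) * fpsX L).

Lemma yratioE xi eta : xi != eta ->
  yratio xi eta * (yser xi - yser eta) = yser xi + yser eta.
Proof.
rewrite -subr_eq0 => xe; apply/eqP; rewrite -subr_eq0; apply/eqP.
apply: (unit_cancel (c := a) (xi := xi)); apply: (unit_cancel (c := a) (xi := eta)).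
set ux := 1 + fpsC a * xser xi; set ue := 1 + fpsC a * xser eta.
have Yx : ux * yser xi = xser xi := yserE xi.
have Ye : ue * yser eta = xser eta := yserE eta.
have -> : ue * (ux * (yratio xi eta * (yser xi - yser eta) - (yser xi + yser eta))) =
  yratio xi eta * (ue * (ux * yser xi) - ux * (ue * yser eta)) -
    (ue * (ux * yser xi) + ux * (ue * yser eta)) by ring.
rewrite Yx Ye.
have -> : ue * xser xi - ux * xser eta = fpsC (xi - eta) * fpsX L.
  by rewrite /ue /ux /xser rmorphB /=; ring.
have inv : fpsC (xi - eta)^-1 * fpsC (xi - eta) = 1 :> fps L.
  by rewrite -rmorphM mulVf ?rmorph1.
rewrite /yratio mulrACA inv mul1r /ue /ux /xser !rmorphM !rmorphD /= ?rmorph_nat ?rmorph1; ring.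
Qed.

Lemma yser_sub_reg xi eta (f : fps L) : xi != eta -> (yser xi - yser eta) * f = 0 -> f = 0.
Proof.
rewrite -subr_eq0 => xe; apply: (@fps_mul_reg _ _ _ 1).
  by move=> [|//] _; rewrite fcoefB /fcoef /= subrr.
by rewrite fcoefB /fcoef /= !mul1r !expr1.
Qed.

End YSeries.

(** * Moving phi_m across a product of vertex operators *)

Lemma perm_rem (T : eqType) (s1 s2 : seq T) x :
  perm_eq s1 s2 -> perm_eq (rem x s1) (rem x s2).
Proof.
move=> s12; have [xs|xs] := boolP (x \in s1); last first.
  by rewrite !rem_id // -(perm_mem s12).
rewrite -(perm_cons x) -(permPl (perm_to_rem xs)) (permPl s12).
by apply: perm_to_rem; rewrite -(perm_mem s12).
Qed.

Section Recursion.
Context (A : algType Qbeta) (phi : int -> A) (phiP : is_fermion_algebra phi).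
Context (E : lmodType A^c) (covac : E) (covacP : is_dual_fock phi covac).
Context (L : fieldType) (iota : {rmorphism Qbeta -> L}).
Implicit Types (w v : E) (F G : E -> fps L) (N m n l : nat) (s : seq L).

Local Notation "w |> n" := (actr w (phi n)) (at level 28, left associativity).
Local Notation bop := (@bop A phi E).
Local Notation flin := (flin iota).
Local Notation a := (iota (beta / 2)).

Definition vops s F : E -> fps L := foldr (fun xi => vop phi (yser a xi)) F s.

Lemma vops_cons xi s F : vops (xi :: s) F = vop phi (yser a xi) (vops s F).
Proof. by []. Qed.

Lemma vops_flin s F : flin F -> flin (vops s F).
Proof. by move=> lF; elim: s => //= xi s; exact: (vop_flin phiP covacP). Qed.

Lemma vopsD s F G w : vops s (fun w => F w + G w) w = vops s F w + vops s G w.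
Proof.
elim: s w => //= xi s IH w; rewrite -vopD; congr (vop _ _ _ _).
exact: funext IH.
Qed.

Lemma vopsM s c F w : vops s (fun w => c * F w) w = c * vops s F w.
Proof.
elim: s w => //= xi s IH w; rewrite -vopM; last exact: yser_ord.
by congr (vop _ _ _ _); exact: funext IH.
Qed.

Lemma vops_sum s I (r : seq I) (P : pred I) (F : I -> E -> fps L) w :
  vops s (fun w => \sum_(i <- r | P i) F i w) w = \sum_(i <- r | P i) vops s (F i) w.
Proof.
elim: r => [|i r IH].
  rewrite big_nil -[RHS](mul0r (vops s (fun=> 0) w)) -vopsM; congr (vops _ _ _).
  by apply: funext => u; rewrite big_nil mul0r.
rewrite big_cons -IH; case: ifP => Pi; rewrite -?vopsD; congr (vops _ _ _);
  by apply: funext => u; rewrite big_cons Pi.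
Qed.

Lemma vops_rem xi s F : xi \in s -> flin F ->
  vops s F = vop phi (yser a xi) (vops (rem xi s) F).
Proof.
move=> + lF; elim: s => //= eta s IH; rewrite inE [eta == xi]eq_sym.
case: eqP => [-> //|_ /= /IH ->]; apply: funext => w /=.
by rewrite (vopC phiP covacP (iota := iota)) //; [exact: yser_ord..|exact: vops_flin].
Qed.

Lemma vops_perm s1 s2 F : perm_eq s1 s2 -> flin F -> vops s1 F = vops s2 F.
Proof.
move=> + lF; elim: s1 s2 => [|xi s1 IH] s2.
  by rewrite perm_sym => /perm_nilP ->.
move=> s12; have xi2 : xi \in s2 by rewrite -(perm_mem s12) mem_head.
rewrite (vops_rem xi2 lF) /= (IH (rem xi s2)) //.
by rewrite -(perm_cons xi) (permPl s12) perm_to_rem.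
Qed.

Lemma vops_consr xi s F : flin F -> vops (xi :: s) F = vops s (vop phi (yser a xi) F).
Proof.
move=> lF; rewrite (vops_perm (s2 := rcons s xi)) //.
  by rewrite /vops foldr_rcons.
by rewrite perm_sym perm_rcons.
Qed.

Lemma ex_uniform (P : nat -> nat -> Prop) N :
  (forall m, exists M0, forall M, (M0 <= M)%N -> P m M) ->
  exists M0, forall M, (M0 <= M)%N -> forall m, (m < N)%N -> P m M.
Proof.
move=> PM; elim: N => [|N [M1 IH]]; first by exists 0%N.
have [M2 PN] := PM N; exists (maxn M1 M2) => M; rewrite geq_max => /andP[M1M M2M] m.
by rewrite ltnS leq_eqVlt => /orP[/eqP ->|]; [exact: PN|exact: IH].
Qed.

(** Pointwise t-adic convergence. The deformed operators are finite sums on each vector, with no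
    bound uniform in the vector, while [vops] feeds them many modes of w. Modulo t^N finitely many
    modes matter, so a common cut exists. *)
Definition fconv (F : nat -> E -> fps L) G := forall w N,
  exists M0, forall M, (M0 <= M)%N -> feqm N (F M w) (G w).

Lemma fconv_vops s (F : nat -> E -> fps L) G :
  fconv F G -> fconv (fun M => vops s (F M)) (vops s G).
Proof.
move=> FG; elim: s => //= xi s IH w N.
have [M0 hM] := ex_uniform N (fun m => IH (qop phi m w) N).
by exists M0 => M M0M; apply: vop_local => m mN; exact: hM.
Qed.

(** Partial fractions of the product of the (1 + u y) / (1 - u y) have the constant term (-1)^k, the
    value at infinite u; it accounts for the additional summand at m = 0. *)
Definition phi_rhs s m F v : fps L :=
  \sum_(xi <- s) \prod_(eta <- rem xi s) yratio a xi eta *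
     (2 * yser a xi ^+ m) * vops (rem xi s) F (v |> 0) +
  (m == 0)%N%:R * (-1) ^+ size s * vops s F (v |> 0).

Lemma phi_rhs_perm s1 s2 m F v : perm_eq s1 s2 -> flin F ->
  phi_rhs s1 m F v = phi_rhs s2 m F v.
Proof.
move=> s12 lF; rewrite /phi_rhs (perm_big _ s12) (perm_size s12) (vops_perm s12 lF).
congr (_ + _); apply: eq_bigr => xi _; have rs := perm_rem xi s12.
by rewrite (perm_big _ rs) (vops_perm rs lF).
Qed.

(** Putting q(y_xi) last, the left side obeys the relation of [vop_phi]. The right side obeys the
    same one, because [yratio] times a difference of two y is their sum. The terms for the smaller
    [s] agree by hypothesis and cancel. *)
Lemma vops_phi_step xi s m F v : uniq (xi :: s) -> flin F ->
  (forall m G, flin G -> vops s (fun w => G (w |> m%:Z)) v = phi_rhs s m G v) ->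
  vops (xi :: s) (fun w => F (w |> m.+1%:Z)) v - phi_rhs (xi :: s) m.+1 F v =
  yser a xi * (vops (xi :: s) (fun w => F (w |> m%:Z)) v - phi_rhs (xi :: s) m F v).
Proof.
rewrite cons_uniq => /andP[xis us] lF IH.
have y1 := yser_ord a xi.
have lFn (n : int) : flin (fun w => F (w |> n)) by apply: flin_comp lF; exact: klin_actr.
set y := yser a xi in y1 *; pose F' := vop phi y F.
have lF' : flin F' by exact: (vop_flin phiP covacP).
have AE : vops (xi :: s) (fun w => F (w |> m.+1%:Z)) v =
    y * vops (xi :: s) (fun w => F (w |> m%:Z)) v + phi_rhs s m.+1 F' v + y * phi_rhs s m F' v.
  rewrite !vops_consr // -!IH // -!vopsM -!vopsD; congr (vops _ _ _).
  apply: funext => w; rewrite (vop_phi phiP covacP (iota := iota)) // (_ : m.+1%:Z - 1 = m%:Z) //.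
  by rewrite -addn1 PoszD addrK.
have BE : phi_rhs (xi :: s) m.+1 F v - y * phi_rhs (xi :: s) m F v =
    phi_rhs s m.+1 F' v + y * phi_rhs s m F' v.
  rewrite /phi_rhs !big_cons (_ : rem xi (xi :: s) = s) /= ?eqxx // -/y.
  rewrite !mul0r !addr0 -[vop phi y _]/(vops (xi :: s) F) vops_consr // -/y -/F'.
  set q := \prod_(eta <- s) _; set u := vops s F (v |> 0); set u' := vops s F' (v |> 0).
  set S1 := \sum_(eta <- s) _; set S0 := \sum_(eta <- s) _.
  set T1 := \sum_(eta <- s) _; set T0 := \sum_(eta <- s) _.
  suff SE : S1 - y * S0 = T1 + y * T0.
    have -> : S1 = T1 + y * T0 + y * S0 by rewrite -SE subrK.
    by rewrite !exprS; ring.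
  rewrite /S1 /S0 /T1 /T0 !mulr_sumr -sumrB -big_split; apply: eq_big_seq => eta es /=.
  have xe : xi != eta by apply: contraNneq xis => ->.
  rewrite (negPf xe) big_cons vops_consr // -/y -/F'.
  have := yratioE a (xi := eta) (eta := xi); rewrite eq_sym => /(_ xe); rewrite -/y exprS.
  move: (\prod_(_ <- _) _) (vops _ _ _) (yser a eta) (yratio _ _ _) => q' u'' ye r rE.
  rewrite -[RHS](_ : r * (ye - y) * (q' * (2 * ye ^+ m) * u'') = _); first by ring.
  by rewrite rE; ring.
rewrite AE; have -> : phi_rhs s m.+1 F' v = phi_rhs (xi :: s) m.+1 F v - y * phi_rhs (xi :: s) m F v
    - y * phi_rhs s m F' v by rewrite BE addrK.
by ring.
Qed.

Lemma vop_phi0 y v F : ford 1 y -> vaclike phi v -> flin F ->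
  vop phi y (fun w => F (w |> 0)) v + vop phi y F (v |> 0) = 2 * F (v |> 0).
Proof.
move=> y1 vac lF; apply: feqmP => -[|N]; first by [].
apply: feqm_trans (feqmD (vop_feqm _ _ _ y1) (vop_feqm _ _ _ y1)) _.
rewrite -big_split big_ord_recl big1 ?addr0 => [|m _].
  by rewrite !expr0 !mul1r !qop0 /= addr0 mulr_natl -mulr2n.
by rewrite (qop_phi0 phiP covacP vac) // (flinN _ lF) mulrN /= addNr.
Qed.

(** The defect [D] is multiplied by y_xi when m grows by 1, for every xi in [s]. With two distinct
    elements this gives (y_xi - y_eta) D 0 = 0, where the difference is not a zero divisor; with at
    most one element, [D 0] is computed directly. *)
Lemma vops_phi s v m F : uniq s -> vaclike phi v -> flin F ->
  vops s (fun w => F (w |> m%:Z)) v = phi_rhs s m F v.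
Proof.
have [k] := ubnP (size s); elim: k s m F => // k IH s m F sk us vac lF.
have lFn (n : int) : flin (fun w => F (w |> n)) by apply: flin_comp lF; exact: klin_actr.
pose D m := vops s (fun w => F (w |> m%:Z)) v - phi_rhs s m F v.
have DS n xi : xi \in s -> D n.+1 = yser a xi * D n.
  move=> xis; have ps := perm_to_rem xis.
  rewrite /D !(vops_perm ps (lFn _)) !(phi_rhs_perm _ _ ps lF); apply: vops_phi_step => //.
    by rewrite -(perm_uniq ps).
  move=> n' G lG; apply: IH => //; last exact: rem_uniq.
  by rewrite size_rem //; case: (s) xis sk => //= _ s' _; rewrite ltnS.
suff D0 : D 0%N = 0.
  apply/eqP; rewrite -subr_eq0 -/(D m); apply/eqP.
  case: s @D DS D0 {IH sk us} => [|xi s] D DS D0; last first.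
    by elim: m => // m IHm; rewrite (DS _ xi) ?mem_head // IHm mulr0.
  case: m => // m; rewrite /D /phi_rhs /= big_nil !mul0r addr0 subr0 vac //.
  exact: (flin0 lF).
case: s @D DS us {IH sk} => [|xi [|eta s]] D DS us.
- by rewrite /D /phi_rhs /= big_nil add0r !mul1r subrr.
- rewrite /D /phi_rhs big_seq1 /= eqxx big_nil /= expr0 expr1 mul1r !mulr1 mul1r mulN1r.
  by rewrite -(vop_phi0 (yser_ord a xi) vac lF) addrK; exact: subrr.
- apply: (@yser_sub_reg _ a xi eta).
    by move: us => /= /andP[]; rewrite inE negb_or => /andP[].
  by rewrite mulrBl -!DS ?subrr // ?mem_head // inE mem_head orbT.
Qed.

End Recursion.

(** * Exponential series and the logarithm of 1 + 2 a x *)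

Section Composition.
Variable K : fieldType.
Implicit Types (f g y : fps K) (c : nat -> K).

Lemma feqm_shift N y f g : ford 1 y -> feqm N f g -> feqm N.+1 (y * f) (y * g).
Proof.
move=> y1 fg d dN; apply/eqP; rewrite -subr_eq0 -fcoefB -mulrBr.
have /(fordM y1) : ford N (f - g) by move=> e eN; rewrite fcoefB fg // subrr.
by move=> /(_ d dN) ->.
Qed.

Definition fcomp c y : fps K :=
  fun d => fcoef (\sum_(k < d.+1) y ^+ k * fpsC (c k)) d.

Lemma fcomp_feqm N M c y : ford 1 y -> (N <= M)%N ->
  feqm N (fcomp c y) (\sum_(k < M) y ^+ k * fpsC (c k)).
Proof.
by move=> y1 NM d dN; apply: (fsum_cut (fun k => fpsC (c k)) y1 (leq_trans dN NM)).
Qed.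

Definition fexp y := fcomp (fun k => (k`!)%:R^-1) y.

Hypothesis char0 : forall n, n.+1%:R != 0 :> K.

Lemma fder_ord1 y : ford 1 (fder y).
Proof. by case=> // _; rewrite fcoef_der mul0r. Qed.

Lemma fder_exp y : ford 1 y -> fder (fexp y) = fder y * fexp y.
Proof.
move=> y1; apply: feqmP => N.
apply: feqm_trans (feqm_der (fcomp_feqm _ y1 (leqnSn N))) _.
apply: feqm_sym; apply: feqm_trans (feqmM (@feqm_refl _ N _) (fcomp_feqm _ y1 (leqnn N))) _.
rewrite raddf_sum big_ord_recl /= expr0 mul1r fderC add0r mulr_sumr.
apply: feqm_sum => k _; rewrite /= /bump /= add1n fderM fderC mulr0 addr0 fderX /=.
rewrite mulrA [fder y * _]mulrC mulrnAl -mulrnAr -[_ *+ k.+1]mulr_natl.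
rewrite -(rmorph_nat (@fpsC K)) -rmorphM factS natrM invfM mulrA divff ?mul1r //.
Qed.

Lemma fexp_coef0 y : ford 1 y -> fcoef (fexp y) 0 = 1.
Proof.
by move=> y1; rewrite (fcomp_feqm _ y1 (leqnn 1)) // big_ord1 /= expr0 mul1r fact0 invr1 rmorph1.
Qed.

Variable a : K.
Implicit Types xi : K.

Definition atanh_coef k : K := if odd k then 2 * a ^+ k / k%:R else 0.

(* [log ((1 + a y) / (1 - a y)) = 2 \sum_(k odd) (a y)^k / k] *)
Definition atanh_ser xi := fcomp atanh_coef (yser a xi).

Lemma yser_unit xi : (1 + fpsC a * xser xi) * (1 - fpsC a * yser a xi) = 1.
Proof.
have := yserE a xi; set u := 1 + _ => uy.
rewrite mulrBr mulr1 mulrCA uy /u; ring.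
Qed.

Lemma fder_xser xi : fder (xser xi) = xser xi.
Proof. by rewrite fderCM fder_fpsX. Qed.

Lemma fder_yser xi : (1 + fpsC a * xser xi) ^+ 2 * fder (yser a xi) = xser xi.
Proof.
have uy := yserE a xi; have uz := yser_unit xi; have := congr1 (@fder _) uy.
rewrite fderM raddfD /= fder1 add0r fderCM fder_xser; move: uy uz.
set u := 1 + _; set y := yser a xi => uy uz Dy.
have {}Dy : u * fder y = xser xi * (1 - fpsC a * y) by rewrite mulrBr mulr1 -{1}Dy; ring.
by rewrite expr2 -mulrA Dy mulrCA uz mulr1.
Qed.

Lemma sum_odd (V : nmodType) M (f : nat -> V) :
  \sum_(k < M.*2) (if odd k then f k else 0) = \sum_(j < M) f j.*2.+1.
Proof.
elim: M => [|M IH]; first by rewrite !big_ord0.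
by rewrite doubleS !big_ord_recr /= IH odd_double /= addr0.
Qed.

(** With u = 1 + a x one has 1 - a y = 1 / u and 1 + a y = (1 + 2 a x) / u, so the series is the
    logarithm of 1 + 2 a x. The lemma is its derivative with the denominator cleared. *)
Lemma fder_atanh xi : (1 + fpsC (2 * a) * xser xi) * fder (atanh_ser xi) =
  fpsC (2 * a) * xser xi.
Proof.
set y := yser a xi; have y1 : ford 1 y := yser_ord a xi.
have E1 : (1 - (fpsC a * y) ^+ 2) * fder (atanh_ser xi) = fpsC (2 * a) * fder y.
  apply: feqmP => N.
  have NN : (N <= N.*2)%N by rewrite -addnn leq_addr.
  have := feqm_der (fcomp_feqm (N := N) atanh_coef y1 NN).
  rewrite (eq_bigr (fun k : 'I_N.*2 => if odd k then
    y ^+ k * fpsC (2 * a ^+ k / k%:R) else 0)) => [|k _]; last first.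
    by rewrite /atanh_coef; case: ifP => // _; rewrite rmorph0 mulr0.
  rewrite (sum_odd N (fun k => y ^+ k * fpsC (2 * a ^+ k / k%:R))) raddf_sum => D1.
  apply: feqm_trans (feqmM (@feqm_refl _ N _) D1) _.
  rewrite (eq_bigr (fun j : 'I_N => fpsC (2 * a) * fder y * (fpsC a * y) ^+ 2 ^+ j)); last first.
    move=> j _; rewrite /= fderM fderC mulr0 addr0 fderX /= mulrnAl -mulrnAr.
    rewrite -[_ *+ _]mulr_natl -(rmorph_nat (@fpsC K)) -rmorphM mulrCA divff // mulr1.
    by rewrite -exprM mul2n exprMn -rmorphXn exprS !rmorphM; ring.
  rewrite -mulr_sumr mulrCA.
  have -> : (1 - (fpsC a * y) ^+ 2) * (\sum_(j < N) (fpsC a * y) ^+ 2 ^+ j) =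
      1 - (fpsC a * y) ^+ 2 ^+ N by rewrite -opprB mulNr -subrX1 opprB.
  rewrite -[X in feqm _ _ X]mulr1; apply: feqmM => //.
  rewrite -[X in feqm _ _ X]subr0; apply: feqmD => //.
  have zN : ford N ((fpsC a * y) ^+ 2 ^+ N).
    by apply: fordX; rewrite exprS; apply: fordMr; exact: fordMl.
  by move=> d dN; rewrite !fcoefN zN.
have uy := yserE a xi; have uz := yser_unit xi; move: uy uz E1; rewrite -/y.
set u := 1 + fpsC a * xser xi; set x := xser xi; set D := fder (atanh_ser xi) => uy uz E1.
have -> : 1 + fpsC (2 * a) * x = u ^+ 2 * (1 - (fpsC a * y) ^+ 2).
  transitivity (u ^+ 2 - (fpsC a * (u * y)) ^+ 2); last by ring.
  by rewrite uy /u -/x rmorphM rmorph_nat /=; ring.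
by rewrite -mulrA E1 mulrCA /u fder_yser.
Qed.

Lemma fexp_atanh (s : seq K) :
  fexp (\sum_(xi <- s) atanh_ser xi) = \prod_(xi <- s) (1 + fpsC (2 * a) * xser xi).
Proof.
have at1 xi : ford 1 (atanh_ser xi).
  move=> [|//] _; rewrite (fcomp_feqm _ (yser_ord a xi) (leqnn 1)) // big_ord1.
  by rewrite /atanh_coef rmorph0 mulr0.
have s1 : ford 1 (\sum_(xi <- s) atanh_ser xi).
  by move=> d d1; rewrite fcoef_sum big1 // => xi _; rewrite at1.
apply: (fder_unique (u := \sum_(xi <- s) fder (atanh_ser xi))) => //.
- by move=> d d1; rewrite fcoef_sum big1 // => xi _; rewrite fder_ord1.
- rewrite fexp_coef0 //; elim: s {s1} => [|xi s IH]; first by rewrite big_nil.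
  rewrite big_cons mulrDl mul1r fcoefD -IH -mulrA fcoefCM.
  by rewrite (fordMr _ (xser_ord xi)) // mulr0 addr0.
- by rewrite fder_exp // raddf_sum.
elim: s {s1} => [|xi s IH]; first by rewrite !big_nil fder1 mul0r.
rewrite !big_cons fderM IH raddfD /= fder1 add0r fderCM fder_xser -{1}fder_atanh; ring.
Qed.

End Composition.

(** * The deformed operators *)

Section DeformedOperators.
Context (A : algType Qbeta) (phi : int -> A) (phiP : is_fermion_algebra phi).
Context (E : lmodType A^c) (covac : E) (covacP : is_dual_fock phi covac).
Context (L : fieldType) (iota : {rmorphism Qbeta -> L}).
Implicit Types (w v : E) (F G : E -> fps L) (N M m n l k : nat) (s : seq L) (xi : L).

Local Notation "w |> n" := (actr w (phi n)) (at level 28, left associativity).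
Local Notation bop := (@bop A phi E).
Local Notation phib := (@phib A phi E).
Local Notation Theta := (@Theta A phi E).
Local Notation expTheta := (@expTheta A phi E).
Local Notation flin := (flin iota).
Local Notation a := (iota (beta / 2)).
Local Notation vops := (vops phi iota).
Let bdegE := ex_bdeg phiP covacP.

Lemma char0L n : n.+1%:R != 0 :> L.
Proof. by rewrite -(rmorph_nat iota) fmorph_eq0 Qbeta_natr_neq0. Qed.

Lemma iota_beta : iota beta = 2 * a.
Proof.
rewrite -(rmorph_nat iota) -rmorphM mulrC divfK //; exact: (Qbeta_natr_neq0 1).
Qed.

Lemma fpsC_beta : fpsC (iota beta) = 2 * fpsC a.
Proof. by rewrite iota_beta (rmorphM (@fpsC L)) (rmorph_nat (@fpsC L)). Qed.

Definition phib_coef n m : Qbeta := (('X + (beta / 2)%:P) ^+ m : {poly Qbeta})`_n.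

Lemma phibE n w M : (forall m, (M <= m)%N -> w |> m%:Z = 0) ->
  phib n w = \sum_(m < M) rscale (phib_coef n m) (w |> m%:Z).
Proof.
move=> wM; rewrite /Defs.phib (@fsum_nat _ M) => [|m Mm].
  by apply: eq_bigr => m _; rewrite actrZ.
by rewrite actrZ wM // rscaler0.
Qed.

Lemma ex_phi_bound w : exists M : nat, forall m, (M <= m)%N -> w |> m%:Z = 0.
Proof.
have [d dw] := bdegE w; exists (absz d).+1 => m Mm.
by apply: (bdeg_kill dw); lia.
Qed.

Lemma phib_klin n : klin (phib n).
Proof.
apply: klin_fsum => [m|w].
  split=> [w w'|c w]; first by rewrite actrDl.
  by rewrite rscale_actr.
have [M wM] := ex_phi_bound w; exists M => m Mm.
by rewrite actrZ wM // rscaler0.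
Qed.

Lemma fconv_phib n F : flin F ->
  fconv (fun M w => \sum_(m < M) fpsC (iota (phib_coef n m)) * F (w |> m%:Z))
    (fun w => F (phib n w)).
Proof.
move=> lF w N; have [M0 wM] := ex_phi_bound w; exists M0 => M M0M.
rewrite (@phibE n w M) => [|m Mm]; last by apply: wM; exact: leq_trans Mm.
by rewrite (flin_sum _ _ _ lF); apply: feqm_sum => m _; rewrite (flinZ lF).
Qed.

Lemma phib_coef0 n : phib_coef n 0 = (n == 0)%N%:R.
Proof. by rewrite /phib_coef expr0 coef1. Qed.

Lemma phib_coefS n m : phib_coef n m.+1 =
  (if n is n'.+1 then phib_coef n' m else 0) + beta / 2 * phib_coef n m.
Proof.
rewrite /phib_coef exprS mulrDl coefD coefXM coefCM.
by case: n.
Qed.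

(** Summing ((z + a) y)^m over m gives 1 / (1 - a y - z y) = (1 + a x) / (1 - z x), whose
    coefficient of z^n is the right side. Doubled, it is (2 + beta x) x^n. *)
Lemma phib_series N M n xi : (N <= M)%N ->
  feqm N (\sum_(m < M) fpsC (iota (phib_coef n m)) * yser a xi ^+ m)
    ((1 + fpsC a * xser xi) * xser xi ^+ n).
Proof.
move=> NM; apply: feqmW NM _; elim: M n => // M IH n.
rewrite big_ord_recl phib_coef0 expr0 mulr1 !rmorph_nat.
set y := yser a xi; have y1 : ford 1 y := yser_ord a xi.
have -> : \sum_(i < M) fpsC (iota (phib_coef n (lift ord0 i))) * y ^+ lift ord0 i =
  y * ((if n is n'.+1 then \sum_(i < M) fpsC (iota (phib_coef n' i)) * y ^+ i else 0) +
       fpsC a * \sum_(i < M) fpsC (iota (phib_coef n i)) * y ^+ i).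
  case: n => [|n]; rewrite ?add0r !mulr_sumr -?big_split; first last.
    rewrite mulr_sumr; apply: eq_bigr => i _ /=.
    by rewrite /bump /= add1n phib_coefS rmorphD rmorphM exprS /= rmorphD rmorphM /=; ring.
  apply: eq_bigr => i _.
  by rewrite /= /bump /= add1n phib_coefS add0r !rmorphM exprS /=; ring.
have yE := yserE a xi; rewrite -/y in yE.
have := feqm_shift y1 (feqmD (f := if n is n'.+1 then
    \sum_(i < M) fpsC (iota (phib_coef n' i)) * y ^+ i else 0)
  (f' := if n is n'.+1 then (1 + fpsC a * xser xi) * xser xi ^+ n' else 0) _
  (feqmM (@feqm_refl _ M (fpsC a)) (IH n))).
move=> h; apply: feqm_trans (feqmD (@feqm_refl _ M.+1 _) (h _)) _.
  by case: (n) => // n'; exact: IH.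
apply: (@feqm_trans _ _ _ ((n == 0)%N%:R + (if n is n'.+1 then xser xi ^+ n else 0)
    + fpsC a * xser xi ^+ n.+1)).
  move=> d dM; congr (fcoef _ d); rewrite mulrDr addrA; congr (_ + _ + _).
    by case: (n) => [|n']; rewrite ?mulr0 // mulrA [y * _]mulrC yE exprS.
  transitivity (fpsC a * (((1 + fpsC a * xser xi) * y) * xser xi ^+ n)); first by ring.
  by rewrite yE -exprS.
case: n h => [|n] _ d dM; congr (fcoef _ d); rewrite /= ?exprS; ring.
Qed.

Lemma vops_phib s v n F : uniq s -> vaclike phi v -> flin F ->
  vops s (fun w => F (phib n w)) v =
  \sum_(xi <- s) \prod_(eta <- rem xi s) yratio a xi eta *
     ((2 + fpsC (iota beta) * xser xi) * xser xi ^+ n) * vops (rem xi s) F (v |> 0) +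
  (n == 0)%N%:R * (-1) ^+ size s * vops s F (v |> 0).
Proof.
move=> us vac lF; apply: feqmP => N.
have [M0 hM] := fconv_vops phi iota s (fconv_phib n lF) v N.
(* [M] exceeds N so that [phib_series] applies, and it is positive so that the exceptional term m =
   0 is present. *)
pose M := maxn M0 N.+1.
apply: feqm_trans (feqm_sym (hM M (leq_maxl _ _))) _.
rewrite vops_sum.
have E1 m : vops s (fun w => fpsC (iota (phib_coef n m)) * F (w |> m%:Z)) v =
   fpsC (iota (phib_coef n m)) * phi_rhs phi iota s m F v.
  by rewrite vopsM (vops_phi phiP covacP).
rewrite (eq_bigr _ (fun (m : 'I_M) _ => E1 m)) /phi_rhs.
under eq_bigr do rewrite mulrDr.
rewrite big_split /=; apply: feqmD; last first.
  have M1 : M = M.-1.+1 by rewrite prednK // /M; lia.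
  rewrite M1 big_ord_recl big1 ?addr0 => [|m _]; last by rewrite !mul0r mulr0.
  by rewrite /= phib_coef0 !rmorph_nat mul1r mulrA.
under eq_bigr do rewrite mulr_sumr.
rewrite exchange_big; apply: feqm_sum => xi _.
set q := \prod_(_ <- _) _; set u := vops _ _ _.
have -> : \sum_(m < M) fpsC (iota (phib_coef n m)) * (q * (2 * yser a xi ^+ m) * u) =
   (\sum_(m < M) fpsC (iota (phib_coef n m)) * yser a xi ^+ m) * (2 * q * u).
  by rewrite mulr_suml; apply: eq_bigr => m _; ring.
have NM : (N <= M)%N by rewrite /M; lia.
apply: feqm_trans (feqmM (phib_series n xi NM) (@feqm_refl _ _ _)) _.
by move=> d dN; congr (fcoef _ d); rewrite fpsC_beta; ring.
Qed.

Definition theta_coef j : Qbeta := (beta / 2) ^+ j.*2.+1 / j.*2.+1%:R.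

Lemma bdeg_lt0 d w : bdeg phi d w -> d < 0 -> w = 0.
Proof. by move=> /(_ [::]); rewrite big_nil; exact. Qed.

Lemma odd_bopN_neq0 j : - j.*2.+1%:Z != 0. Proof. by []. Qed.

Lemma theta_term_klin j : klin (fun w => rscale (theta_coef j) (bop (- j.*2.+1%:Z) w)).
Proof. exact: klin_rscale (bop_klinE phiP covacP (odd_bopN_neq0 j)). Qed.

Lemma bdeg_bopN j d w : bdeg phi d w -> bdeg phi (d - j.*2.+1%:Z) (bop (- j.*2.+1%:Z) w).
Proof. exact: (bdeg_bop (fermion_rel phiP) bdegE). Qed.

Lemma ex_theta_bound w : exists M : nat, forall j, (M <= j)%N ->
  rscale (theta_coef j) (bop (- j.*2.+1%:Z) w) = 0.
Proof.
have [d dw] := bdegE w; exists (absz d) => j dj.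
by rewrite (bdeg_lt0 (bdeg_bopN dw)) ?rscaler0 //; lia.
Qed.

Lemma ThetaE w M : (forall j, (M <= j)%N ->
    rscale (theta_coef j) (bop (- j.*2.+1%:Z) w) = 0) ->
  Theta w = rscale 2 (\sum_(j < M) rscale (theta_coef j) (bop (- j.*2.+1%:Z) w)).
Proof. by move=> wM; rewrite /Defs.Theta (@fsum_nat _ M). Qed.

Lemma Theta_klin : klin Theta.
Proof.
by apply: klin_rscale; apply: klin_fsum; [exact: theta_term_klin|exact: ex_theta_bound].
Qed.

Lemma bdeg_sum d I (r : seq I) (P : pred I) (f : I -> E) :
  (forall i, bdeg phi d (f i)) -> bdeg phi d (\sum_(i <- r | P i) f i).
Proof.
move=> df; apply: (big_ind (bdeg phi d)) => // [t _|w w']; last exact: bdegD.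
exact: klin0 (actw_klin phi E t).
Qed.

Lemma bdeg_Theta d w : bdeg phi d w -> bdeg phi (d - 1) (Theta w).
Proof.
move=> dw; have [M wM] := ex_theta_bound w; rewrite (ThetaE wM).
apply: bdegZ; apply: bdeg_sum => j; apply: bdegZ.
by apply: bdeg_le (bdeg_bopN dw); lia.
Qed.

Lemma bdeg_iter_Theta d w k : bdeg phi d w -> bdeg phi (d - k%:Z) (iter k Theta w).
Proof.
move=> dw; elim: k => [|k IH]; first by rewrite subr0.
by rewrite /= -addn1 PoszD opprD addrA; exact: bdeg_Theta.
Qed.

Definition exp_term k w := rscale (k`!)%:R^-1 (iter k Theta w).

Lemma ex_exp_bound w : exists M : nat, forall k, (M <= k)%N -> exp_term k w = 0.
Proof.
have [d dw] := bdegE w; exists (absz d).+1 => k dk.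
by rewrite /exp_term (bdeg_lt0 (bdeg_iter_Theta (k := k) dw)) ?rscaler0 //; lia.
Qed.

Lemma expThetaE w M : (forall k, (M <= k)%N -> exp_term k w = 0) ->
  expTheta w = \sum_(k < M) exp_term k w.
Proof. by move=> wM; rewrite /Defs.expTheta (@fsum_nat _ M). Qed.

Lemma expTheta_klin : klin expTheta.
Proof.
have lf k : klin (exp_term k).
  exact: (klin_rscale _ (klin_iter k Theta_klin)).
exact: (klin_fsum lf ex_exp_bound).
Qed.

Lemma vops_bopN s F l w : flin F -> odd l ->
  vops s (fun w => F (bop (- l%:Z) w)) w =
  vops s F (bop (- l%:Z) w) + (\sum_(xi <- s) yser a xi ^+ l) * vops s F w.
Proof.
move=> lF lo; elim: s w => [|xi s IH] w; first by rewrite big_nil mul0r addr0.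
have IH' := funext IH; rewrite big_cons /= IH'.
have y1 := yser_ord a xi.
rewrite vopD vopM // (vop_bopN phiP covacP (iota := iota)) //; last first.
  exact: (vops_flin phiP covacP).
by rewrite mulrDl addrA.
Qed.

Definition theta s : fps L := \sum_(xi <- s) atanh_ser a xi.

(** Moved to the left across the q(y), each b_(-l) leaves the sum of the y^l and then annihilates v.
    Theta thus becomes multiplication by a series. *)
Lemma vops_Theta s v F : vaclike phi v -> flin F ->
  vops s (fun w => F (Theta w)) v = theta s * vops s F v.
Proof.
move=> vac lF; apply: feqmP => N.
pose G M w := F (rscale 2 (\sum_(j < M) rscale (theta_coef j) (bop (- j.*2.+1%:Z) w))).
have GF : fconv G (fun w => F (Theta w)).
  move=> w n; have [M0 wM] := ex_theta_bound w; exists M0 => M M0M.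
  by rewrite (@ThetaE w M) // => j Mj; apply: wM; exact: leq_trans Mj.
have [M0 hM] := fconv_vops phi iota s GF v N.
pose M := maxn M0 N; have NM : (N <= M.*2)%N by rewrite /M; lia.
apply: feqm_trans (feqm_sym (hM M (leq_maxl _ _))) _.
have GE : vops s (G M) v = \sum_(j < M) fpsC (iota (2 * theta_coef j)) *
    ((\sum_(xi <- s) yser a xi ^+ j.*2.+1) * vops s F v).
  transitivity (vops s (fun w => \sum_(j < M) fpsC (iota (2 * theta_coef j)) *
      F (bop (- j.*2.+1%:Z) w)) v).
    congr (vops _ _ _); apply: funext => w.
    rewrite /G rscale_sum (flin_sum _ _ _ lF); apply: eq_bigr => j _.
    by rewrite rscaleA (flinZ lF).
  rewrite vops_sum; apply: eq_bigr => j _; rewrite vopsM vops_bopN //; last first.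
    by rewrite /= odd_double.
  rewrite (vaclike_bopN phiP vac) //.
  by rewrite (flin0 (vops_flin phiP covacP s lF)) add0r.
rewrite GE; under eq_bigr do rewrite mulrA.
rewrite -mulr_suml; apply: feqmM => //; rewrite /theta.
under eq_bigr do rewrite mulr_sumr.
rewrite exchange_big; apply: feqm_sum => xi _; apply: feqm_sym.
apply: feqm_trans (fcomp_feqm _ (yser_ord a xi) NM) _.
rewrite (eq_bigr (fun k : 'I_M.*2 => if odd k then
    fpsC (2 * a ^+ k / k%:R) * yser a xi ^+ k else 0)) => [|k _]; last first.
  by rewrite /atanh_coef; case: ifP => // _; rewrite ?rmorph0 ?mulr0 // mulrC.
rewrite (sum_odd M (fun k => fpsC (2 * a ^+ k / k%:R) * yser a xi ^+ k)).
apply: feqm_sum => j _; rewrite (_ : iota (2 * theta_coef j) = 2 * a ^+ j.*2.+1 / j.*2.+1%:R) //.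
rewrite /theta_coef; move: (beta / 2) => c.
by rewrite !rmorphM /= rmorphXn fmorphV !rmorph_nat mulrA.
Qed.

Lemma vops_expTheta s v F : vaclike phi v -> flin F ->
  vops s (fun w => F (expTheta w)) v =
  \prod_(xi <- s) (1 + fpsC (iota beta) * xser xi) * vops s F v.
Proof.
move=> vac lF; rewrite iota_beta -(fexp_atanh char0L) -/(theta s).
have th1 : ford 1 (theta s).
  move=> d d1; rewrite /theta fcoef_sum big1 // => xi _.
  rewrite (fcomp_feqm _ (yser_ord a xi) (leqnn 1)) // big_ord1.
  by rewrite /atanh_coef rmorph0 mulr0.
apply: feqmP => N.
pose G M w := F (\sum_(k < M) exp_term k w).
have GF : fconv G (fun w => F (expTheta w)).
  move=> w n; have [M0 wM] := ex_exp_bound w; exists M0 => M M0M.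
  by rewrite (@expThetaE w M) // => j Mj; apply: wM; exact: leq_trans Mj.
have [M0 hM] := fconv_vops phi iota s GF v N.
pose M := maxn M0 N; have NM : (N <= M)%N by rewrite /M; lia.
apply: feqm_trans (feqm_sym (hM M (leq_maxl _ _))) _.
(* One factor Theta is converted at a time, the remaining ones being absorbed in the functional: v
   itself never changes. *)
have itE k : vops s (fun w => F (iter k Theta w)) v = theta s ^+ k * vops s F v.
  elim: k => [|k IH]; first by rewrite mul1r.
  transitivity (vops s (fun w => F (iter k Theta (Theta w))) v).
    by congr (vops _ _ _); apply: funext => w; rewrite -iterSr.
  rewrite (vops_Theta s vac (F := fun w => F (iter k Theta w))).
    by rewrite IH mulrA exprS.
  by apply: flin_comp lF; apply: klin_iter; exact: Theta_klin.
have -> : vops s (G M) v = \sum_(k < M) theta s ^+ k * fpsC (k`!)%:R^-1 * vops s F v.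
  transitivity (vops s (fun w => \sum_(k < M) fpsC (k`!)%:R^-1 * F (iter k Theta w)) v).
    congr (vops _ _ _); apply: funext => w.
    rewrite /G (flin_sum _ _ _ lF); apply: eq_bigr => k _.
    by rewrite (flinZ lF) fmorphV rmorph_nat.
  by rewrite vops_sum; apply: eq_bigr => k _; rewrite vopsM itE mulrA [fpsC _ * _]mulrC.
rewrite -mulr_suml; apply: feqmM => //; apply: feqm_sym.
exact: (fcomp_feqm (fun k => (k`!)%:R^-1) th1 NM).
Qed.

End DeformedOperators.

(** One recursion serves three rings: series in t for the expectation value, polynomials in t, and
    the field in which the symmetrized sum lives. The variable chosen for a row is removed before
    the next row. *)
Fixpoint row_rec (R : comNzRingType) (T : eqType) (r : T -> T -> R) (c : nat -> T -> R)
    (t : seq nat) (s : seq T) : R :=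
  if t is n :: t' then
    \sum_(xi <- s) \prod_(eta <- rem xi s) r xi eta * c n xi * row_rec r c t' (rem xi s)
  else 1.

Lemma row_rec_perm (R : comNzRingType) (T : eqType) (r : T -> T -> R) c t s1 s2 :
  perm_eq s1 s2 -> row_rec r c t s1 = row_rec r c t s2.
Proof.
elim: t s1 s2 => //= n t IH s1 s2 s12; rewrite (perm_big _ s12); apply: eq_bigr => xi _.
by have s12' := perm_rem xi s12; rewrite (perm_big _ s12') (IH _ _ s12').
Qed.

Lemma rmorph_row_rec (R S : comNzRingType) (f : {rmorphism R -> S}) (T : eqType)
    (r : T -> T -> R) c t s :
  f (row_rec r c t s) = row_rec (fun xi eta => f (r xi eta)) (fun n xi => f (c n xi)) t s.
Proof.
elim: t s => [|n t IH] s /=; first exact: rmorph1.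
by rewrite rmorph_sum; apply: eq_bigr => xi _; rewrite !rmorphM rmorph_prod IH.
Qed.

Lemma eq_row_rec (R : comNzRingType) (T : eqType) (r r' : T -> T -> R) c c' t s :
  r =2 r' -> c =2 c' -> row_rec r c t s = row_rec r' c' t s.
Proof.
move=> rr' cc'; elim: t s => //= n t IH s; apply: eq_bigr => xi _.
by rewrite cc' IH (eq_bigr _ (fun eta _ => rr' xi eta)).
Qed.

(** * Vacuum expectation values *)

Section VacuumExpectation.
Context (A : algType Qbeta) (phi : int -> A) (phiP : is_fermion_algebra phi).
Context (F : lmodType A) (vac : F) (vacP : is_fock phi vac).
Context (E : lmodType A^c) (covac : E) (covacP : is_dual_fock phi covac).
Context (pairing : E -> F -> Qbeta).
Hypothesis pairingP : is_vacuum_pairing phi vac covac pairing.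
Context (L : fieldType) (iota : {rmorphism Qbeta -> L}).
Implicit Types (w v : E) (N M m n l k : nat) (s : seq L) (xi : L).

Local Notation "w |> n" := (actr w (phi n)) (at level 28, left associativity).
Local Notation bop := (@bop A phi E).
Local Notation phib := (@phib A phi E).
Local Notation expTheta := (@expTheta A phi E).
Local Notation flin := (flin iota).
Local Notation a := (iota (beta / 2)).
Local Notation vops := (vops phi iota).
Let phi_rel : clifford_rel phi := fermion_rel phiP.
Let bdegE := ex_bdeg phiP covacP.

Definition vev0 w : Qbeta := pairing w vac.

Lemma vev0D w w' : vev0 (w + w') = vev0 w + vev0 w'.
Proof.
by have := pairing_linl pairingP 1 w w' vac; rewrite rscale1 mul1r.
Qed.

Lemma vev00 : vev0 0 = 0.
Proof. by apply: (addrI (vev0 0)); rewrite -vev0D !addr0. Qed.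

Lemma vev0N w : vev0 (- w) = - vev0 w.
Proof. by apply: (addrI (vev0 w)); rewrite -vev0D !subrr vev00. Qed.

Lemma vev0Z c w : vev0 (rscale c w) = c * vev0 w.
Proof.
by have := pairing_linl pairingP c w 0 vac; rewrite addr0 -/(vev0 0) vev00 addr0.
Qed.

Lemma vev0_phi w (n : int) : n < 0 -> vev0 (w |> n) = 0.
Proof.
move=> n0; rewrite /vev0 (pairing_balanced pairingP).
have -> : phi n *: vac = 0.
  by apply: (cyclic_rel vacP); exists (- n); rewrite ?oppr_gt0 ?opprK.
have := pairing_linr pairingP 1 w 0 0.
by rewrite scaler0 addr0 mul1r -[LHS]addr0 => /addrI.
Qed.

Lemma vev0_bop w l : odd l -> vev0 (bop l%:Z w) = 0.
Proof.
move=> lo; have l0 := odd_neq0 lo; rewrite bopE vev0Z.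
rewrite (zsum_morph vev00 vev0D (bterm_finsup phi_rel bdegE w l0)).
rewrite (eq_zsum (G := fun=> 0)) => [|i]; first by rewrite (zsum1 (j := 0)) ?mulr0.
rewrite /bterm vev0Z; have [i0|i0] := ltP i 0; first by rewrite vev0_phi // mulr0.
rewrite (actr_anticomm0 phi_rel); last by apply: contra l0; lia.
by rewrite vev0N vev0_phi ?oppr0 ?mulr0 //; lia.
Qed.

Lemma vev0_qop w n : vev0 (qop phi n w) = (n == 0)%N%:R * vev0 w.
Proof.
case: n => [|n]; first by rewrite qop0 mul1r.
rewrite mul0r; apply: (mulfI (Qbeta_natr_neq0 n)).
rewrite mulr0 -vev0Z qop_euler vev0Z.
rewrite (big_morph vev0 vev0D (id1 := 0)) ?big1 ?mulr0 //.
  by move=> c cn; rewrite vev0_bop.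
exact: vev00.
Qed.

Definition Fvac w : fps L := fpsC (iota (vev0 w)).

Lemma Fvac_flin : flin Fvac.
Proof.
split=> [w w'|c w]; rewrite /Fvac; first by rewrite vev0D !rmorphD.
by rewrite vev0Z !rmorphM.
Qed.

(** The b_l with l > 0 annihilate the vacuum on the right, so q(y) fixes it. *)
Lemma vop_Fvac y : ford 1 y -> vop phi y Fvac = Fvac.
Proof.
move=> y1; apply: funext => w; apply: feqmP => -[|N]; first by [].
apply: feqm_trans (vop_feqm _ _ _ y1) _.
rewrite big_ord_recl big1 ?addr0 => [|m _].
  by rewrite /Fvac vev0_qop !mul1r.
by rewrite /Fvac vev0_qop mul0r !rmorph0 mulr0.
Qed.

Lemma vops_Fvac s : vops s Fvac = Fvac.
Proof. by elim: s => //= xi s ->; rewrite vop_Fvac //; exact: yser_ord. Qed.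

Let v0 := covac |> 0.

Lemma v0_vaclike : vaclike phi v0.
Proof. exact: (vaclike_phi0 phi_rel (covac_vaclike covacP)). Qed.

Lemma v0_phi0 : v0 |> 0 = covac. Proof. exact: (phi00 phi_rel). Qed.

Lemma Fvac_covac : Fvac covac = 1.
Proof. by rewrite /Fvac /vev0 (pairing_vac pairingP) !rmorph1. Qed.

(* The [phi_m]-mode of [vops s] on the vacuum is the coefficient of [u^m] in
   [\prod_(xi <- s) (1 + u y) / (1 - u y)]. *)
Definition vmode s m : fps L := vops s (fun w => Fvac (w |> m%:Z)) v0.

Let lFn (n : int) : flin (fun w => Fvac (w |> n)).
Proof. by apply: flin_comp Fvac_flin; exact: klin_actr. Qed.

(** Multiplication of the generating series by (1 + u y) / (1 - u y), with the denominator
    cleared. *)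
Lemma vmodeS xi s m : vmode (xi :: s) m.+1 =
  yser a xi * vmode (xi :: s) m + vmode s m.+1 + yser a xi * vmode s m.
Proof.
have y1 := yser_ord a xi.
rewrite /vmode !(vops_consr phiP covacP) // -!vopsM -!vopsD.
congr (vops _ _ _); apply: funext => w.
rewrite (vop_phi phiP covacP (iota := iota) _ _ y1 Fvac_flin) vop_Fvac //.
by rewrite (_ : m.+1%:Z - 1 = m%:Z) // -addn1 PoszD addrK.
Qed.

Lemma vmode0 xi s : vmode (xi :: s) 0 = vmode s 0.
Proof.
have y1 := yser_ord a xi.
rewrite /vmode (vops_consr phiP covacP) //.
congr (vops _ _ _); apply: funext => w.
rewrite (vop_phi phiP covacP (iota := iota) _ _ y1 Fvac_flin) vop_Fvac //.
have F0 u : Fvac (u |> (0%:Z - 1)) = 0 by rewrite /Fvac vev0_phi // !rmorph0.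
rewrite F0 mulr0 addr0 (_ : vop _ _ _ w = 0) ?mulr0 ?add0r //.
apply: feqmP => N; apply: feqm_trans (vop_feqm _ _ _ y1) _.
by rewrite big1 // => m _; rewrite F0 mulr0.
Qed.

Lemma vmode_nil m : vmode [::] m = (m == 0)%N%:R.
Proof.
case: m => [|m]; first by rewrite /vmode /= v0_phi0 Fvac_covac.
by rewrite /vmode /= v0_vaclike // (flin0 Fvac_flin).
Qed.

Lemma vmodeE s m : uniq s -> vmode s m =
  \sum_(xi <- s) \prod_(eta <- rem xi s) yratio a xi eta * (2 * yser a xi ^+ m)
  + (m == 0)%N%:R * (-1) ^+ size s.
Proof.
move=> us; rewrite /vmode (vops_phi phiP covacP _ us v0_vaclike Fvac_flin) /phi_rhs.
rewrite v0_phi0 vops_Fvac Fvac_covac mulr1; congr (_ + _).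
by apply: eq_bigr => xi _; rewrite vops_Fvac Fvac_covac mulr1.
Qed.

Lemma vmode_ord s m : uniq s -> ford m (vmode s m).
Proof.
move=> us; case: m => [|m]; first exact: ford0.
rewrite vmodeE // mul0r addr0 => d dm; rewrite fcoef_sum big1 // => xi _.
have /(_ d dm) -> // : ford m.+1 (\prod_(eta <- rem xi s) yratio a xi eta * (2 * yser a xi ^+ m.+1)).
by apply: fordMl; apply: fordMl; apply: fordX; exact: yser_ord.
Qed.

(** The generating series of the modes at u = -a, cut at N. Since 1 - a y is the inverse of 1 + a x,
    this value of u produces the factors of [vacuum_identity]. *)
Let umode N s : fps L := \sum_(m < N) fpsC (- a) ^+ m * vmode s m.

Lemma umode_cons N xi s : uniq (xi :: s) ->
  feqm N ((1 + fpsC a * yser a xi) * umode N (xi :: s))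
         ((1 - fpsC a * yser a xi) * umode N s).
Proof.
move=> us; have us' : uniq s by move: us => /andP[].
case: N => [|N]; first by [].
set y := yser a xi; set c := fpsC (- a).
have cE : fpsC a = - c by rewrite /c rmorphN opprK.
have uS t : umode N.+1 t = vmode t 0 + \sum_(m < N) c ^+ m.+1 * vmode t m.+1.
  by rewrite /umode big_ord_recl expr0 mul1r; congr (_ + _); apply: eq_bigr.
(* The last term contains [vmode t N], divisible by t^N; multiplied by y it vanishes modulo t^(N+1),
   so both sides can be cut at the same place. *)
have cut t : uniq t -> feqm N.+1 (y * umode N.+1 t) (y * \sum_(m < N) c ^+ m * vmode t m).
  move=> ut; apply: feqm_shift; first exact: yser_ord.
  rewrite /umode big_ord_recr /= -[X in feqm _ _ X]addr0; apply: feqmD => //.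
  by apply: fordMl; exact: vmode_ord.
rewrite cE mulNr opprK !mulrDl !mul1r mulNr -!mulrA.
have E1 : umode N.+1 (xi :: s) = umode N.+1 s + (c * (y * \sum_(m < N) c ^+ m * vmode s m)
    + c * (y * \sum_(m < N) c ^+ m * vmode (xi :: s) m)).
  rewrite !uS vmode0 -addrA; congr (_ + _); rewrite !mulr_sumr -!big_split.
  by apply: eq_bigr => m _; rewrite vmodeS /= -/y exprS; ring.
rewrite {1}E1 -!addrA; apply: feqmD => //; rewrite -[X in feqm _ _ X]addr0; apply: feqmD.
  by apply: feqmM => //; apply: feqm_sym; exact: cut.
rewrite -[X in feqm _ _ X](subrr (c * (y * umode N.+1 (xi :: s)))); apply: feqmD => //.
by apply: feqmM => //; apply: feqm_sym; exact: cut.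
Qed.

Lemma umode_prod N s : uniq s -> feqm N
  (\prod_(xi <- s) (1 + fpsC a * yser a xi) * umode N s)
  (\prod_(xi <- s) (1 - fpsC a * yser a xi)).
Proof.
elim: s => [_|xi s IH us].
  rewrite !big_nil mul1r /umode; case: N => [|N]; first by [].
  rewrite big_ord_recl vmode_nil big1 ?addr0 ?mulr1 // => m _.
  by rewrite vmode_nil mulr0.
have us' : uniq s by move: us => /andP[].
rewrite !big_cons mulrAC.
apply: feqm_trans (feqmM (umode_cons us) (@feqm_refl _ N _)) _.
by rewrite -mulrA [umode _ _ * _]mulrC; apply: feqmM => //; exact: IH.
Qed.

(* Partial fraction expansion of [\prod_(xi <- s) (1 - a y) / (1 + a y)]. *)
Lemma vacuum_identity s : uniq s ->
  \sum_(xi <- s) \prod_(eta <- rem xi s) (yratio a xi eta * (1 + fpsC (iota beta) * xser eta)) *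
    (2 + fpsC (iota beta) * xser xi) +
  (-1) ^+ size s * \prod_(xi <- s) (1 + fpsC (iota beta) * xser xi) = 1.
Proof.
(* Multiplying by all [z xi], the inverses of [u xi], clears the identity: [z xi] turns 1 + beta x
   into 1 + a y and 2 + beta x into 2. What remains is [umode_prod] with the modes expanded by
   [vmodeE]. *)
move=> us; pose z xi := 1 - fpsC a * yser a xi; pose zp xi := 1 + fpsC a * yser a xi.
pose u xi := 1 + fpsC a * xser xi.
have uz xi : u xi * z xi = 1 := yser_unit a xi.
have bE := fpsC_beta iota.
have ze xi : z xi * (1 + fpsC (iota beta) * xser xi) = zp xi.
  have uy := yserE a xi; rewrite -/(u xi) in uy.
  have -> : 1 + fpsC (iota beta) * xser xi = u xi * zp xi.
    transitivity (u xi + fpsC a * (u xi * yser a xi)); [by rewrite uy bE /u; ring | by rewrite /zp; ring].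
  by rewrite mulrCA mulrA uz mul1r.
have zu xi : z xi * (2 + fpsC (iota beta) * xser xi) = 2.
  by rewrite bE -[RHS]mulr1 -(uz xi) /u; ring.
suff H : \prod_(xi <- s) z xi * (
  \sum_(xi <- s) \prod_(eta <- rem xi s) (yratio a xi eta * (1 + fpsC (iota beta) * xser eta)) *
    (2 + fpsC (iota beta) * xser xi) +
  (-1) ^+ size s * \prod_(xi <- s) (1 + fpsC (iota beta) * xser xi)) =
  \prod_(xi <- s) z xi.
  have uzs : \prod_(xi <- s) u xi * \prod_(xi <- s) z xi = 1.
    by rewrite -big_split big1 // => xi _; exact: uz.
  by rewrite -[RHS]uzs -[in RHS]H mulrA uzs mul1r.
apply: feqmP => N; apply: feqm_trans (umode_prod (N := N) us); apply: feqm_sym.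
case: N => [|N]; first by [].
have -> : umode N.+1 s = \sum_(xi <- s) \prod_(eta <- rem xi s) yratio a xi eta *
    (2 * \sum_(m < N.+1) (- (fpsC a * yser a xi)) ^+ m) + (-1) ^+ size s.
  rewrite /umode; under eq_bigr do rewrite vmodeE // mulrDr.
  rewrite big_split /=; congr (_ + _); last first.
    rewrite big_ord_recl big1 ?addr0 ?mul1r ?mul1r // => m _.
    by rewrite mul0r mulr0.
  under eq_bigr do rewrite mulr_sumr.
  rewrite exchange_big; apply: eq_bigr => xi _; rewrite mulrA mulr_sumr.
  apply: eq_bigr => m _; rewrite rmorphN -mulNr exprMn; ring.
have prod_rem (f : L -> fps L) xi : xi \in s ->
    \prod_(eta <- s) f eta = f xi * \prod_(eta <- rem xi s) f eta.
  by move=> xis; rewrite (perm_big _ (perm_to_rem xis)) big_cons.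
have zeP t : \prod_(xi <- t) z xi * \prod_(xi <- t) (1 + fpsC (iota beta) * xser xi) =
    \prod_(xi <- t) zp xi.
  by rewrite -big_split; apply: eq_bigr => xi _; exact: ze.
rewrite !mulrDr !mulr_sumr; apply: feqmD; last first.
  by rewrite mulrCA zeP -/zp mulrC.
rewrite [X in feqm _ X]big_seq [X in feqm _ _ X]big_seq; apply: feqm_sum => xi xis.
rewrite [X in _ * (X * (2 + _))]big_split /= (prod_rem z xi xis) (prod_rem zp xi xis).
move: (zeP (rem xi s)) (zu xi); move: (\prod_(eta <- rem xi s) z eta) => Z.
move: (\prod_(eta <- rem xi s) (1 + _)) (\prod_(eta <- rem xi s) yratio _ _ _) => U R.
move: (\prod_(eta <- rem xi s) zp _) => V ZU zE.
have -> : z xi * Z * (R * U * (2 + fpsC (iota beta) * xser xi)) = R * V * 2 * 1.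
  transitivity (R * (Z * U) * (z xi * (2 + fpsC (iota beta) * xser xi))); first by ring.
  by rewrite ZU zE mulr1.
have -> : zp xi * V * (R * (2 * \sum_(m < N.+1) (- (fpsC a * yser a xi)) ^+ m)) =
   R * V * 2 * (zp xi * \sum_(m < N.+1) (- (fpsC a * yser a xi)) ^+ m) by ring.
apply: feqmM => //; have -> : zp xi = - (- (fpsC a * yser a xi) - 1) by rewrite /zp; ring.
rewrite mulNr -subrX1 opprB -[X in feqm _ _ X]subr0; apply: feqmD => //.
move=> d dN; rewrite !fcoefN; congr (- _); move: d dN.
apply: fordX => d d1; rewrite fcoefN.
by rewrite (fordMl (fpsC a) (yser_ord a xi)) // oppr0.
Qed.

Definition Fvev (t : seq nat) w : fps L :=
  Fvac (foldl (fun u n => expTheta (phib n u)) w t).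

Lemma Fvev_flin t : flin (Fvev t).
Proof.
suff lf : klin (fun w => foldl (fun u n => expTheta (phib n u)) w t).
  exact: (flin_comp lf Fvac_flin).
elim: t => [|n t IH]; first exact: klin_id.
have le := klin_comp (expTheta_klin phiP covacP) (phib_klin phiP covacP n).
exact: (klin_comp IH le).
Qed.

Definition gser : seq nat -> seq L -> fps L := row_rec
  (fun xi eta => yratio a xi eta * (1 + fpsC (iota beta) * xser eta))
  (fun n xi => (2 + fpsC (iota beta) * xser xi) * xser xi ^+ n).

Lemma gserS n t s : gser (n :: t) s = \sum_(xi <- s)
  \prod_(eta <- rem xi s) (yratio a xi eta * (1 + fpsC (iota beta) * xser eta)) *
    ((2 + fpsC (iota beta) * xser xi) * xser xi ^+ n) * gser t (rem xi s).
Proof. by []. Qed.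

(** For row 0 the exceptional term of [vops_phib] is present; it is the second summand of
    [vacuum_identity]. *)
Lemma Fvev_tail0 s : uniq s -> vops s (Fvev [:: 0%N]) v0 = 1.
Proof.
move=> us; have lF : flin (fun w => Fvac (expTheta w)).
  exact: (flin_comp (expTheta_klin phiP covacP) Fvac_flin).
have vE t : vops t (fun w => Fvac (expTheta w)) covac =
    \prod_(xi <- t) (1 + fpsC (iota beta) * xser xi).
  rewrite (vops_expTheta phiP covacP _ (covac_vaclike covacP) Fvac_flin).
  by rewrite vops_Fvac Fvac_covac mulr1.
rewrite -(vacuum_identity us) (vops_phib phiP covacP 0 us v0_vaclike lF) v0_phi0 vE mul1r.
congr (_ + _); apply: eq_bigr => xi _; rewrite vE expr0 mulr1 [in RHS]big_split /=; ring.
Qed.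

(** Each row removes one variable and replaces v by v phi_0. After an odd number of rows starting
    from [covac] the vector is v phi_0, and the tail [[:: 0]] is what brings it back to [covac]; the
    hypothesis on [t'] covers both parities. *)
Lemma vops_Fvev t t' v : all (ltn 0) t -> vaclike phi v ->
  (forall s, uniq s -> vops s (Fvev t') (iter (size t) (fun w => w |> 0) v) = 1) ->
  forall s, uniq s -> vops s (Fvev (t ++ t')) v = gser t s.
Proof.
elim: t v => [|n t IH] v /=; first by move=> _ _ H s; exact: H.
move=> /andP[n_gt0 t_gt0] vac_v H s us.
have lF : flin (fun w => Fvev (t ++ t') (expTheta w)).
  exact: (flin_comp (expTheta_klin phiP covacP) (Fvev_flin _)).
rewrite [LHS](vops_phib phiP covacP n us vac_v lF) gtn_eqF // !mul0r addr0.
rewrite [RHS]gserS.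
apply: eq_bigr => xi _.
have vac_v0 : vaclike phi (v |> 0) by exact: vaclike_phi0.
rewrite (vops_expTheta phiP covacP _ vac_v0 (Fvev_flin _)) IH ?rem_uniq //; last first.
  by move=> s' us'; rewrite -iterSr; exact: H.
by rewrite [in RHS]big_split /=; ring.
Qed.

Lemma vops_Fvev_covac t s : all (ltn 0) t -> uniq s ->
  vops s (Fvev (if odd (size t) then t ++ [:: 0%N] else t)) covac = gser t s.
Proof.
move=> t_gt0 us; have vac_c := covac_vaclike covacP.
have itE k : iter k (fun w => w |> 0) covac = if odd k then v0 else covac.
  elim: k => //= k ->; case: (odd k) => //=; exact: v0_phi0.
case: ifP => to; last first.
  rewrite -[X in Fvev X](cats0 t); apply: vops_Fvev => // s' us'.
  by rewrite itE to vops_Fvac Fvac_covac.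
by apply: vops_Fvev => // s' us'; rewrite itE to Fvev_tail0.
Qed.

End VacuumExpectation.

(** * Coefficients of e^H in the variables p_n *)

Implicit Types (mu nu kappa : {cmonom nat}).

Definition cmdiv mu (i : nat) : {cmonom nat} := divcm mu (ucm i).

Lemma cmdivE mu i j : cmdiv mu i j = (mu j - (i == j))%N.
Proof. by rewrite /cmdiv divcmE ucmE. Qed.

Lemma cmdivK mu i : (0 < mu i)%N -> mmul (ucm i) (cmdiv mu i) = mu.
Proof.
move=> mui; apply/eqP/cmP => j; rewrite cmM cmU cmdivE.
by case: eqP => [<-|_]; rewrite ?subn0 // subnKC.
Qed.

Lemma mulcmK nu i : cmdiv (mmul (ucm i) nu) i = nu.
Proof. by apply/eqP/cmP => j; rewrite cmdivE cmM cmU addKn. Qed.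

Lemma cmdivC mu i j : cmdiv (cmdiv mu i) j = cmdiv (cmdiv mu j) i.
Proof. by apply/eqP/cmP => k; rewrite !cmdivE subnAC. Qed.

Lemma mdeg_cmdiv mu i : (0 < mu i)%N -> monalg.mdeg mu = (monalg.mdeg (cmdiv mu i)).+1.
Proof. by move=> mui; rewrite -{1}(cmdivK mui) mdegM mdegU. Qed.

Lemma factS_cancel (K : fieldType) (n0 : forall n, n.+1%:R != 0 :> K) i N :
  i.+1%:R * ((N.+1)`!)%:R^-1 * (2 * N.+1%:R / i.+1%:R) = 2 * (N`!)%:R^-1 :> K.
Proof.
have f0 : (N`!)%:R != 0 :> K by case: (N`!) (fact_gt0 N).
have Ni := n0 N; have i1 := n0 i; rewrite factS natrM invfM.
move: (N.+1%:R) (i.+1%:R) (N`!%:R) Ni i1 f0 => x y z x0 y0 z0.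
by field; rewrite x0 y0 z0.
Qed.

Section Hamiltonian.
Context (A : algType Qbeta) (phi : int -> A) (phiP : is_fermion_algebra phi).
Context (E : lmodType A^c) (covac : E) (covacP : is_dual_fock phi covac).
Implicit Types (w : E) (v : mseries E) (N m n l : nat).

Local Notation bop := (@bop A phi E).
Local Notation bbop := (@bbop A phi E).
Local Notation Ham := (@Ham A phi E).
Let lb (m : int) : m != 0 -> klin (bop m) := bop_klinE phiP covacP (m := m).

(** The two bases are exchanged by X -> -X, so half the difference of their powers keeps exactly the
    odd coefficients. *)
Lemma bpoly_rec n (f g : {poly Qbeta}) (c : Qbeta) :
  f = 'X - c%:P -> g = - 'X - c%:P -> forall l,
  (g ^+ n)`_l = (-1) ^+ l * (f ^+ n)`_l.
Proof.
move=> fE gE; elim: n => [|n IH] l.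
  by rewrite !expr0 coef1; case: l => [|l]; rewrite ?mulr0 // mulr1.
rewrite [g ^+ _]exprS [f ^+ _]exprS {1}gE {1}fE !mulrBl mulNr !coefB coefN !coefXM !coefCM !IH.
case: l => [|l] /=; first by rewrite expr0 oppr0 !sub0r mulrN mulrCA.
by rewrite [(-1) ^+ l.+1]exprS mulN1r mulrBr !mulNr mulrN [c * (_ * _)]mulrCA.
Qed.

Definition bcoef n l : Qbeta := (('X - (beta / 2)%:P) ^+ n : {poly Qbeta})`_l.

Lemma bpoly_coef n l : (bpoly n)`_l = if odd l then bcoef n l else 0.
Proof.
rewrite /bpoly coefZ coefB (bpoly_rec n erefl erefl) -/(bcoef n l) -signr_odd.
case: (odd l); rewrite ?expr0 ?expr1 ?mul1r ?subrr ?mulr0 // mulN1r opprK.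
have n2 := Qbeta_natr_neq0 1.
by rewrite (_ : bcoef n l + bcoef n l = 2 * bcoef n l) ?mulKf // mulr_natl mulr2n.
Qed.

Lemma size_bpoly n : (size (bpoly n) <= n.+1)%N.
Proof.
have s1 : (size (('X - (beta / 2)%:P) ^+ n : {poly Qbeta}) <= n.+1)%N.
  by apply: leq_trans (size_poly_exp_leq _ _) _; rewrite size_XsubC mul1n.
have s2 : (size ((- 'X - (beta / 2)%:P) ^+ n : {poly Qbeta}) <= n.+1)%N.
  apply: leq_trans (size_poly_exp_leq _ _) _.
  by rewrite -opprD size_polyN size_XaddC mul1n.
apply: leq_trans (size_scale_leq _ _) _; apply: leq_trans (size_polyD _ _) _.
by rewrite size_polyN geq_max s1 s2.
Qed.

Lemma bbopE n M w : (n < M)%N ->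
  bbop n w = \sum_(l < M | odd l) rscale (bcoef n l) (bop l%:Z w).
Proof.
move=> nM; have sM : (size (bpoly n) <= M)%N := leq_trans (size_bpoly n) nM.
rewrite /Defs.bbop (big_ord_widen M (fun l => rscale (bpoly n)`_l (bop l%:Z w)) sM).
rewrite big_mkcond [RHS]big_mkcond; apply: eq_bigr => l _; rewrite bpoly_coef.
case: ltnP => [_|sl]; first by case: ifP => // _; rewrite rscale0r.
have := bpoly_coef n l; rewrite nth_default //.
by case: ifP => // _ <-; rewrite rscale0r.
Qed.

Lemma bbop_klin n : klin (bbop n).
Proof.
have lf : klin (fun w => \sum_(l < n.+1 | odd l) rscale (bcoef n l) (bop l%:Z w)).
  split=> [w w'|c w].
    rewrite -big_split; apply: eq_bigr => l lo /=.
    by rewrite (klinD (lb (odd_neq0 lo))) rscaleDr.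
  rewrite rscale_sum; apply: eq_bigr => l lo.
  by rewrite (klinZ (lb (odd_neq0 lo)) c w) !(rscaleA _ _ (bop l%:Z w)) mulrC.
by split=> [w w'|c w]; rewrite !(bbopE _ (ltnSn n)); [exact: klinD lf _ _|exact: klinZ lf _ _].
Qed.

Lemma bbopC m n w : bbop m (bbop n w) = bbop n (bbop m w).
Proof.
have E1 p q : bbop p (bbop q w) = \sum_(l < p.+1 | odd l) \sum_(k < q.+1 | odd k)
    rscale (bcoef p l * bcoef q k) (bop l%:Z (bop k%:Z w)).
  rewrite (bbopE _ (ltnSn p)); apply: eq_bigr => l lo.
  have ll := lb (odd_neq0 lo).
  rewrite (bbopE _ (ltnSn q)) (klin_sum _ _ _ ll) rscale_sum; apply: eq_bigr => k ko.
  by rewrite (klinZ ll) rscaleA.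
rewrite !E1 exchange_big; apply: eq_bigr => l lo; apply: eq_bigr => k ko.
rewrite mulrC (bopC phiP covacP) //; have := odd_neq0 ko; lia.
Qed.

Lemma HamE v mu : Ham v mu = rscale 2 (\sum_(i <- finsupp mu)
  rscale i.+1%:R^-1 (bbop i.+1 (v (cmdiv mu i)))).
Proof.
rewrite /Defs.Ham; congr rscale.
pose r := [seq (i, cmdiv mu i) | i <- finsupp mu].
rewrite (fsbig_fwiden r) ?big_map //.
- move=> [i nu] /= iE; apply/mapP; exists i.
    by rewrite -cmE_neq0 -iE cmM cmUU.
  by rewrite -iE mulcmK.
- by rewrite map_inj_in_uniq ?fset_uniq // => i j _ _ [].
- move=> [i nu] /= [/mapP[j jmu [-> ->]]] []; apply: cmdivK.
  by rewrite lt0n cmE_neq0.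
Qed.

Let H N : mseries E := iter N Ham (const_mseries covac).

Lemma H_deg N mu : monalg.mdeg mu != N -> H N mu = 0.
Proof.
elim: N mu => [|N IH] mu.
  by rewrite /H /= /const_mseries monalg.mdeg_eq0 => /negPf ->.
move=> muN; rewrite /H /= -/(H N) HamE big_seq big1 ?rscaler0 // => i imu.
have mui : (0 < mu i)%N by rewrite lt0n cmE_neq0.
rewrite IH; first by rewrite (klin0 (bbop_klin _)) rscaler0.
by move: muN; rewrite (mdeg_cmdiv mui) eqSS.
Qed.

(** The derivative of H^(N+1) with respect to p_(i+1), read on coefficients. It is N + 1 times the
    derivative of H applied to H^N because the [bbop] commute. *)
Lemma H_euler N mu i : (0 < mu i)%N -> rscale (mu i)%:R (H N.+1 mu) =
  rscale (2 * N.+1%:R / i.+1%:R) (bbop i.+1 (H N (cmdiv mu i))).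
Proof.
elim: N mu i => [|N IH] mu i mui.
  have [/eqP mu1|mu1] := boolP (monalg.mdeg mu == 1%N); last first.
    rewrite !H_deg ?(klin0 (bbop_klin _)) ?rscaler0 //.
    by move: mu1; rewrite (mdeg_cmdiv mui).
  have di : cmdiv mu i = mone.
    by apply/eqP; rewrite -monalg.mdeg_eq0; move: mu1; rewrite (mdeg_cmdiv mui) => -[->].
  have muE : mu = ucm i by rewrite -(cmdivK mui) di mulm1.
  by rewrite /H /= HamE muE mdomU big_seq_fset1 cmUU rscale1 rscaleA mulr1 -muE di.
rewrite {1}/H [iter _ _ _]/= -/(H N.+1) HamE rscaleA mulrC -rscaleA rscale_sum.
have lbb := bbop_klin i.+1.
have termE j : j \in finsupp mu ->
  rscale (mu i)%:R (rscale j.+1%:R^-1 (bbop j.+1 (H N.+1 (cmdiv mu j)))) =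
  (if (i == j) then rscale i.+1%:R^-1 (bbop i.+1 (H N.+1 (cmdiv mu i))) else 0) +
  (if (0 < cmdiv mu i j)%N then rscale (2 * N.+1%:R / i.+1%:R)
     (bbop i.+1 (rscale j.+1%:R^-1 (bbop j.+1 (H N (cmdiv (cmdiv mu i) j))))) else 0).
  move=> jmu; have muj : (0 < mu j)%N by rewrite lt0n cmE_neq0.
  (* This splitting is the Leibniz rule: the derivative falls on the new factor p_(j+1), when i = j,
     or on the rest of the monomial. *)
  have -> : mu i = (cmdiv mu j i + (i == j))%N.
    by rewrite cmdivE [j == i]eq_sym; case: (i =P j) => [ij|_]; rewrite ?subn0 ?addn0 // subnK.
  rewrite natrD rscaleDl addrC; congr (_ + _).
    by case: eqP => [<-|_]; rewrite ?rscale1 ?rscale0r.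
  have -> : (0 < cmdiv mu i j)%N = (0 < cmdiv mu j i)%N.
    by rewrite !cmdivE [j == i]eq_sym; case: (i =P j) => [->|_] //; rewrite !subn0 mui muj.
  rewrite rscaleA mulrC -rscaleA -(klinZ (bbop_klin _)).
  case: ltnP => [dji|]; last first.
    by rewrite leqn0 => /eqP ->; rewrite rscale0r (klin0 (bbop_klin _)) rscaler0.
  rewrite IH // (klinZ (bbop_klin _)) (klinZ lbb) !rscaleA mulrC bbopC.
  by rewrite cmdivC.
rewrite (eq_big_seq _ termE) big_split /= (bigD1_seq i) ?fset_uniq ?eqxx //=; last first.
  by rewrite -cmE_neq0 -lt0n.
rewrite [X in _ + X + _]big1 ?addr0 => [|j /negPf]; last by rewrite eq_sym => ->.
have -> : \sum_(j <- finsupp mu) (if (0 < cmdiv mu i j)%N then rscale (2 * N.+1%:R / i.+1%:R)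
     (bbop i.+1 (rscale j.+1%:R^-1 (bbop j.+1 (H N (cmdiv (cmdiv mu i) j))))) else 0) =
  rscale (N.+1%:R / i.+1%:R) (bbop i.+1 (H N.+1 (cmdiv mu i))).
  rewrite [H N.+1 _]HamE (klinZ lbb) (klin_sum _ _ _ lbb) rscaleA rscale_sum -big_mkcond.
  rewrite -big_filter (perm_big (finsupp (cmdiv mu i))) /=; last first.
    apply: uniq_perm; rewrite ?filter_uniq ?fset_uniq // => j.
    rewrite mem_filter -!cmE_neq0 lt0n; apply: andb_idr.
    by rewrite cmdivE -!lt0n => /leq_trans; apply; exact: leq_subr.
  by apply: eq_bigr => j _; congr (rscale _ _); rewrite [RHS]mulrC mulrA.
rewrite -rscaleDl rscaleA; congr (rscale _ _).
by rewrite -mulrA; congr (_ * _); rewrite -[N.+2%:R]natr1 mulrDl mul1r addrC.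
Qed.

Definition Hcoef kappa : E := expHam phi (const_mseries covac) kappa.

Lemma HcoefE kappa :
  Hcoef kappa = rscale ((monalg.mdeg kappa)`!)%:R^-1 (H (monalg.mdeg kappa) kappa).
Proof.
rewrite /Hcoef /expHam (@fsum_seq _ _ [:: monalg.mdeg kappa]) ?big_seq1 // => N.
by rewrite inE eq_sym => kN; rewrite -/(H N) H_deg // rscaler0.
Qed.

Lemma Hcoef1 : Hcoef mone = covac.
Proof. by rewrite HcoefE monalg.mdeg1 fact0 invr1 rscale1 /H /= /const_mseries eqxx. Qed.

Lemma Hcoef_euler kappa i : (0 < kappa i)%N -> rscale (i.+1 * kappa i)%:R (Hcoef kappa) =
  rscale 2 (bbop i.+1 (Hcoef (cmdiv kappa i))).
Proof.
move=> ki; rewrite !HcoefE (mdeg_cmdiv ki); set N := monalg.mdeg _.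
rewrite (klinZ (bbop_klin _)) [LHS]rscaleA natrM mulrAC -[LHS]rscaleA H_euler //.
rewrite [LHS]rscaleA [RHS]rscaleA; congr rscale; apply: factS_cancel; exact: Qbeta_natr_neq0.
Qed.

End Hamiltonian.

(** * Monomials in the p_n by weight *)

Definition cmwt kappa : nat := \sum_(i <- finsupp kappa) i.+1 * kappa i.

Lemma cm_notin kappa i : i \notin finsupp kappa -> kappa i = 0%N.
Proof. by rewrite -cmE_eq0 => /eqP. Qed.

Lemma cmwtEw kappa (d : {fset nat}) : fsubset (finsupp kappa) d ->
  cmwt kappa = (\sum_(i <- d) i.+1 * kappa i)%N.
Proof.
by move=> le; rewrite /cmwt (big_fset_incl _ le) // => i _ /cm_notin ->; rewrite muln0.
Qed.

Lemma cmwtM mu nu : cmwt (mmul mu nu) = (cmwt mu + cmwt nu)%N.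
Proof.
rewrite [cmwt (mmul mu nu)]/cmwt mdomD.
rewrite (cmwtEw (fsubsetUl _ (finsupp nu))) (cmwtEw (fsubsetUr (finsupp mu) _)).
by rewrite -big_split /=; apply/eq_bigr => i _; rewrite cmM mulnDr.
Qed.

Lemma cmwtU i : cmwt (ucm i) = i.+1.
Proof. by rewrite /cmwt mdomU big_seq_fset1 cmUU muln1. Qed.

Lemma cmwt_cmdiv kappa i : (0 < kappa i)%N -> cmwt kappa = (i.+1 + cmwt (cmdiv kappa i))%N.
Proof. by move=> ki; rewrite -{1}(cmdivK ki) cmwtM cmwtU. Qed.

Lemma cmwt1 : cmwt mone = 0%N.
Proof. by rewrite /cmwt mdom1 big_seq_fset0. Qed.

Lemma cmwt_supp kappa i : i \in finsupp kappa -> (i < cmwt kappa)%N.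
Proof.
rewrite -cmE_neq0 -lt0n => ki; rewrite (cmwt_cmdiv ki).
by rewrite addSn ltnS leq_addr.
Qed.

Lemma cmwt_eq0 kappa : cmwt kappa = 0%N -> kappa = mone.
Proof.
move=> k0; apply/eqP/cmP => i; rewrite cm1; apply: cm_notin.
by apply/negP => /cmwt_supp; rewrite k0.
Qed.

Lemma finite_cmwt d : finite_set [set kappa | cmwt kappa = d]%classic.
Proof.
have [k] := ubnP d; elim: k d => // k IH [|d] dk.
  apply: (@sub_finite_set _ _ [set mone]%classic); last exact: finite_set1.
  by move=> kappa /= /cmwt_eq0.
apply: (@sub_finite_set _ _ (\bigcup_(i in `I_d.+1)
    [set mmul (ucm i) nu | nu in [set nu | cmwt nu = (d - i)%N]])%classic).
  move=> kappa /= kd; have [k0|/fset0Pn[i ik]] := eqVneq (finsupp kappa) fset0.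
    by move: kd; rewrite /cmwt k0 big_seq_fset0.
  have ki : (0 < kappa i)%N by rewrite lt0n cmE_neq0.
  exists i; first by rewrite /= -kd cmwt_supp.
  exists (cmdiv kappa i); last exact: cmdivK.
  by move: kd; rewrite /= (cmwt_cmdiv ki) addSn => -[<-]; rewrite addKn.
apply: bigcup_finite; first exact: finite_II.
by move=> i /= _; apply: finite_image; apply: IH; apply: leq_ltn_trans (leq_subr _ _) _.
Qed.

Definition cmsphere d : {fset {cmonom nat}} := fset_set [set kappa | cmwt kappa = d]%classic.

Lemma in_cmsphere d kappa : (kappa \in cmsphere d) = (cmwt kappa == d).
Proof.
by rewrite /cmsphere in_fset_set; [apply/idP/eqP; rewrite inE|exact: finite_cmwt].
Qed.

(** Division by p_(i+1) is a bijection from the monomials of weight d containing it onto those of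
    weight d - (i + 1). *)
Lemma sum_cmsphere (V : nmodType) (g : nat -> {cmonom nat} -> V) d :
  \sum_(kappa <- cmsphere d) \sum_(i <- finsupp kappa) g i (cmdiv kappa i) =
  \sum_(i < d) \sum_(nu <- cmsphere (d - i.+1)) g i nu.
Proof.
transitivity (\sum_(kappa <- cmsphere d) \sum_(i < d | (0 < kappa i)%N) g i (cmdiv kappa i)).
  apply: eq_big_seq => kappa; rewrite in_cmsphere => /eqP kd.
  rewrite -(big_mkord (fun i => (0 < kappa i)%N) (fun i => g i (cmdiv kappa i))).
  rewrite -[RHS]big_filter; apply: perm_big; apply: uniq_perm.
  - exact: fset_uniq.
  - by rewrite filter_uniq // iota_uniq.
  move=> i; rewrite mem_filter mem_index_iota lt0n cmE_neq0 /=.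
  by apply/idP/andP => [ik|[]//]; split=> //; rewrite -kd cmwt_supp.
rewrite (exchange_big_dep xpredT) //=; apply: eq_bigr => i _.
rewrite -big_filter -(big_map (fun kappa => cmdiv kappa i) xpredT (fun nu => g i nu)).
apply: perm_big; apply: uniq_perm; last 2 first.
- exact: fset_uniq.
- move=> nu; apply/mapP/idP => [[kappa]|].
    rewrite mem_filter !in_cmsphere => /andP[ki /eqP kd] ->.
    by rewrite -(addKn i.+1 (cmwt _)) -cmwt_cmdiv ?kd.
  rewrite in_cmsphere => /eqP nud; exists (mmul (ucm (i : nat)) nu); last by rewrite mulcmK.
  rewrite mem_filter in_cmsphere cmM cmUU add1n /= cmwtM cmwtU nud.
  by rewrite subnKC.
rewrite map_inj_in_uniq ?filter_uniq ?fset_uniq // => k1 k2.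
rewrite !mem_filter => /andP[k1i _] /andP[k2i _] k12.
by rewrite -(cmdivK k1i) k12 cmdivK.
Qed.

Section Evaluation.
Variables (R : comNzRingType) (p : nat -> R).

Definition cmeval kappa : R := \prod_(i <- finsupp kappa) p i.+1 ^+ kappa i.

Lemma cmevalEw kappa (d : {fset nat}) : fsubset (finsupp kappa) d ->
  cmeval kappa = \prod_(i <- d) p i.+1 ^+ kappa i.
Proof.
by move=> le; rewrite /cmeval (big_fset_incl _ le) // => i _ /cm_notin ->.
Qed.

Lemma cmevalM mu nu : cmeval (mmul mu nu) = cmeval mu * cmeval nu.
Proof.
rewrite [cmeval (mmul mu nu)]/cmeval mdomD.
rewrite (cmevalEw (fsubsetUl _ (finsupp nu))) (cmevalEw (fsubsetUr (finsupp mu) _)).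
by rewrite -big_split /=; apply/eq_bigr => i _; rewrite cmM exprD.
Qed.

Lemma cmevalU i : cmeval (ucm i) = p i.+1.
Proof. by rewrite /cmeval mdomU big_seq_fset1 cmUU expr1. Qed.

Lemma cmeval1 : cmeval mone = 1.
Proof. by rewrite /cmeval mdom1 big_seq_fset0. Qed.

Lemma cmeval_cmdiv kappa i : (0 < kappa i)%N ->
  cmeval kappa = p i.+1 * cmeval (cmdiv kappa i).
Proof. by move=> ki; rewrite -{1}(cmdivK ki) cmevalM cmevalU. Qed.

End Evaluation.

Lemma rmorph_cmeval (R S : comNzRingType) (f : {rmorphism R -> S}) (p : nat -> R) kappa :
  f (cmeval p kappa) = cmeval (f \o p) kappa.
Proof. by rewrite rmorph_prod; apply: eq_bigr => i _; rewrite rmorphXn. Qed.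

(** * The vector e^H at power sums as a product of vertex operators *)

Section ExpH.
Context (A : algType Qbeta) (phi : int -> A) (phiP : is_fermion_algebra phi).
Context (E : lmodType A^c) (covac : E) (covacP : is_dual_fock phi covac).
Context (L : fieldType) (iota : {rmorphism Qbeta -> L}).
Implicit Types (w : E) (F : E -> fps L) (N m n l : nat) (s : seq L) (xi : L).

Local Notation bop := (@bop A phi E).
Local Notation bbop := (@bbop A phi E).
Local Notation flin := (flin iota).
Local Notation a := (iota (beta / 2)).
Local Notation vops := (vops phi iota).
Local Notation Hcoef := (Hcoef phi covac).

(** Stated through constant series, so that [vops] applies to scalar functionals; t then enters only
    through the y. *)
Definition clin (f : E -> L) := flin (fun w => fpsC (f w)).

Lemma clinD f w w' : clin f -> f (w + w') = f w + f w'.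
Proof.
move=> lf; have := congr1 (fun g => fcoef g 0) (flinD lf w w').
by rewrite fcoefD !fcoef_poly !coefC.
Qed.

Lemma clinZ f c w : clin f -> f (rscale c w) = iota c * f w.
Proof.
move=> lf; have := congr1 (fun g => fcoef g 0) (flinZ lf c w).
by rewrite fcoefCM !fcoef_poly !coefC.
Qed.

Lemma clin_comp f g : klin g -> clin f -> clin (fun w => f (g w)).
Proof. exact: flin_comp. Qed.

Definition expH_coef (p : nat -> L) (f : E -> L) d : L :=
  \sum_(kappa <- cmsphere d) f (Hcoef kappa) * cmeval p kappa.

Lemma expH_coef0 p f : expH_coef p f 0 = f covac.
Proof.
rewrite /expH_coef (big_fsetD1 mone) ?in_cmsphere ?cmwt1 //=.
rewrite (Hcoef1 phiP covacP) cmeval1 mulr1 big_seq big1 ?addr0 // => kappa.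
by rewrite in_fsetD1 in_cmsphere => /andP[/eqP km /eqP /cmwt_eq0].
Qed.

(** On weight d the Euler operator, the sum of the n p_n d/dp_n, is multiplication by d;
    [Hcoef_euler] evaluates each derivative. *)
Lemma expH_coef_euler p f d : clin f -> d%:R * expH_coef p f d =
  \sum_(i < d) 2 * p i.+1 * expH_coef p (fun w => f (bbop i.+1 w)) (d - i.+1).
Proof.
move=> lf; rewrite /expH_coef.
under [RHS]eq_bigr do rewrite mulr_sumr.
rewrite -(sum_cmsphere (fun i nu => 2 * p i.+1 * (f (bbop i.+1 (Hcoef nu)) * cmeval p nu))).
rewrite mulr_sumr; apply: eq_big_seq => kappa; rewrite in_cmsphere => /eqP kd.
rewrite -{1}kd /cmwt natr_sum mulr_suml; apply: eq_big_seq => i.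
rewrite -cmE_neq0 -lt0n => ki.
have e := congr1 f (Hcoef_euler phiP covacP ki).
rewrite !(clinZ _ _ lf) !rmorph_nat in e.
rewrite mulrA e (cmeval_cmdiv p ki); ring.
Qed.

End ExpH.

Section VertexExpansion.
Context (A : algType Qbeta) (phi : int -> A) (phiP : is_fermion_algebra phi).
Context (E : lmodType A^c) (covac : E) (covacP : is_dual_fock phi covac).
Context (L : fieldType) (iota : {rmorphism Qbeta -> L}).
Implicit Types (w : E) (F : E -> fps L) (f : E -> L) (N m n l k d : nat) (s : seq L) (xi : L).

Local Notation bop := (@bop A phi E).
Local Notation bbop := (@bbop A phi E).
Local Notation flin := (flin iota).
Local Notation clin := (clin iota).
Local Notation a := (iota (beta / 2)).
Local Notation vops := (vops phi iota).
Local Notation Hcoef := (Hcoef phi covac).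
Local Notation expH_coef := (expH_coef phi covac).

Definition ypow_der xi k : fps L := yser a xi ^+ k * fder (yser a xi).

Lemma vops_der N s F w : flin F -> (forall w, fder (F w) = 0) ->
  feqm N (fder (vops s F w))
    (\sum_(l < N | odd l) 2 * (\sum_(xi <- s) ypow_der xi l.-1) * vops s F (bop l%:Z w)).
Proof.
move=> lF F0; elim: s w => [|xi s IH] w.
  by rewrite /= F0 big1 // => l _; rewrite big_nil mulr0 mul0r.
have lFs := vops_flin phiP covacP s lF; have y1 := yser_ord a xi.
apply: feqm_trans (vop_der phiP covacP w y1 lFs) _.
have loc := vop_local (phi := phi) (yser a xi) (w := w)
  (F := fun w => fder (vops s F w))
  (G := fun w => \sum_(l < N | odd l) 2 * (\sum_(xi <- s) ypow_der xi l.-1) * vops s F (bop l%:Z w))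
  (fun m (_ : (m < N)%N) => IH _).
apply: feqm_trans (feqmD loc (@feqm_refl _ N _)) _.
rewrite [X in feqm _ (X + _)](vops_sum phi iota [:: xi]) -big_split; apply: feqm_sum => l lo.
rewrite [X in feqm _ (X + _)](vopsM phi iota [:: xi]) [X in feqm _ (_ * X + _)](vop_bop phiP covacP) //.
rewrite -/(ypow_der xi l.-1) big_cons vops_cons.
move: (ypow_der _ _) (\sum_(_ <- _) _) (vop _ _ _ _) => x y z.
have E1 : 2 * y * z + x * (z *+ 2) = 2 * (x + y) * z by ring.
by move=> d _; congr (fcoef _ d); exact: E1.
Qed.

Lemma bcoef0 l : bcoef 0 l = (l == 0%N)%:R.
Proof. by rewrite /bcoef expr0 coef1. Qed.

Lemma bcoef0S l : bcoef 0 l.+1 = 0.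
Proof. exact: bcoef0. Qed.

Lemma bcoefS n l : bcoef n.+1 l = (if l is l'.+1 then bcoef n l' else 0) - beta / 2 * bcoef n l.
Proof. by rewrite /bcoef exprS mulrBl coefB coefXM coefCM; case: l. Qed.

(** Summing x^n (X - a)^n over n gives 1 / (1 + a x - x X), whose coefficient of X^l is y^l / (1 + a
    x). This equals y^(l-1) times the Euler derivative of y. Hence the polynomials defining
    b^(beta)_n are dual to the substitution y = x / (1 + a x). *)
Lemma ypow_der_coef xi k n :
  fcoef (ypow_der xi k) n = iota (bcoef n k.+1) * xi ^+ n.
Proof.
elim: k n => [|k IH] n.
  rewrite /ypow_der expr0 mul1r fcoef_der.
  have b0 m : bcoef m 0 = (- (beta / 2)) ^+ m.
    by elim: m => [|m IHm]; rewrite ?bcoef0 ?expr0 // bcoefS sub0r IHm exprS mulNr.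
  case: n => [|n]; first by rewrite bcoef0S [iota 0]rmorph0 !mul0r.
  have -> : bcoef n.+1 1 = n.+1%:R * (- (beta / 2)) ^+ n.
    elim: n => [|n IHn]; rewrite bcoefS b0; first by rewrite bcoef0S mulr0 subr0 mul1r.
    by rewrite IHn -[- (_ * (_ * _))]mulNr mulrCA -exprS -[n.+2%:R]natr1 mulrDl mul1r addrC.
  by rewrite [iota (_ * _ ^+ n)]rmorphM rmorphXn rmorphN rmorph_nat mulrA.
have rec : (1 + fpsC a * xser xi) * ypow_der xi k.+1 = xser xi * ypow_der xi k.
  by rewrite /ypow_der exprS -mulrA mulrA yserE mulrA.
elim: n => [|n IHn].
  rewrite bcoef0S rmorph0 mul0r; apply: (fordMr (N := 1)) => //.
  by rewrite exprS; apply: fordMr; exact: yser_ord.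
move: (congr1 (fun g => fcoef g n.+1) rec).
rewrite /xser mulrDl mul1r fcoefD -!mulrA !fcoefCM !fcoefXM IH IHn => /(canRL (addrK _)) ->.
rewrite bcoefS rmorphB [iota (_ * bcoef _ _)]rmorphM exprS; ring.
Qed.

Lemma vops_coef0 s f w : fcoef (vops s (fun w => fpsC (f w)) w) 0 = f w.
Proof.
elim: s w => [|xi s IH] w; first by rewrite /= fcoef_poly coefC.
rewrite vops_cons (vop_feqm _ _ _ (yser_ord a xi) (ltnSn 0)) big_ord1 expr0 mul1r.
exact: IH.
Qed.

Lemma expH_coef_sum I (r : seq I) (P : pred I) (c : I -> L) (f : I -> E -> L) p d :
  expH_coef p (fun w => \sum_(i <- r | P i) c i * f i w) d =
  \sum_(i <- r | P i) c i * expH_coef p (f i) d.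
Proof.
rewrite /expH_coef; under eq_bigr do rewrite mulr_suml.
rewrite exchange_big; apply: eq_bigr => i _; rewrite mulr_sumr.
by apply: eq_bigr => kappa _; rewrite mulrA.
Qed.

(* [<0| e^H] at [p_n = \sum_(xi <- s) xi^n] is [<0| \prod_(xi <- s) q(y)]. *)
Lemma vops_expH s f d : clin f ->
  fcoef (vops s (fun w => fpsC (f w)) covac) d =
  expH_coef (fun n => \sum_(xi <- s) xi ^+ n) f d.
Proof.
have [M] := ubnP d; elim: M d f => // M IH [|d] f dM lf.
  by rewrite (expH_coef0 phiP covacP) vops_coef0.
(* Both sides satisfy the same recursion in d, by [vops_der] and [expH_coef_euler]. It involves [f]
   composed with b_l, so the induction runs over all functionals at once. *)
apply: (mulfI (char0L iota d)); rewrite (expH_coef_euler phiP covacP _ _ lf) -fcoef_der.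
rewrite (vops_der (N := d.+2) _ _ lf) //; last by move=> w; exact: fderC.
rewrite fcoef_sum.
transitivity (\sum_(l < d.+2 | odd l) \sum_(i < d.+1) 2 * (\sum_(xi <- s) xi ^+ i.+1) *
    (iota (bcoef i.+1 l) * expH_coef (fun n => \sum_(xi <- s) xi ^+ n)
      (fun w => f (bop l%:Z w)) (d - i))).
  apply: eq_bigr => l lo; have lb := bop_klinE phiP covacP (odd_neq0 lo).
  have S_coef i : fcoef (\sum_(xi <- s) ypow_der xi l.-1) i =
      iota (bcoef i l) * \sum_(xi <- s) xi ^+ i.
    rewrite fcoef_sum mulr_sumr; apply: eq_bigr => xi _.
    by rewrite ypow_der_coef (prednK (odd_gt0 lo)).
  rewrite -mulrA -(rmorph_nat (@fpsC L)) fcoefCM fcoefM big_ord_recl S_coef.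
  rewrite bcoef0 gtn_eqF ?odd_gt0 // rmorph0 !mul0r add0r mulr_sumr; apply: eq_bigr => i _.
  rewrite /= /bump /= add1n S_coef subSS.
  have := IH (d - i)%N (fun w => f (bop l%:Z w)); rewrite /= => <-; last 2 first.
  - by rewrite (leq_ltn_trans (leq_subr _ _)).
  - exact: clin_comp.
  have -> : vops s (fun w => fpsC (f (bop l%:Z w))) covac = vops s (fun w => fpsC (f w)) (bop l%:Z covac).
    elim: (s) (covac) => //= xi s' IHs u.
    rewrite -(vop_bop phiP covacP) //; congr (vop _ _ _ _); exact: funext IHs.
  by ring.
rewrite exchange_big; apply: eq_bigr => i _; rewrite -mulr_sumr; congr (_ * _).
rewrite subSS -expH_coef_sum; congr (expH_coef _ _ _); apply: funext => w.
have id2 : (i.+1 < d.+2)%N by rewrite ltnS ltn_ord.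
rewrite (bbopE _ _ id2); symmetry.
rewrite (big_morph f (fun x y => clinD x y lf) (id1 := 0)); last first.
  by have := clinZ 0 0 lf; rewrite rscale0r rmorph0 mul0r.
by apply: eq_bigr => l _; rewrite (clinZ _ _ lf).
Qed.

End VertexExpansion.

(** * Symmetrized sums *)

Section Symmetrization.
Context (L : fieldType) (b : L).
Implicit Types (t : seq nat) (s : seq L) (xi eta : L) (n : nat).

Definition oratio xi eta : L := oplus b xi eta / ominus b xi eta.

Definition grow : seq nat -> seq L -> L := row_rec oratio (fun n xi => dbracket b xi n).

Lemma big_perm_lift (R : nmodType) n (f : 'S_n.+1 -> R) :
  \sum_(w : 'S_n.+1) f w = \sum_(i < n.+1) \sum_(u : 'S_n) f (lift_perm ord0 i u).
Proof.
rewrite (reindex (fun p : 'I_n.+1 * 'S_n => lift_perm ord0 p.1 p.2)).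
  by rewrite [RHS]pair_bigA.
apply: onW_bij; apply: inj_card_bij => [[i u] [j v] /= uv|]; last first.
  by rewrite card_prod card_ord !card_Sn factS.
have ij : i = j by have /(congr1 (fun w : 'S_n.+1 => w ord0)) := uv; rewrite !lift_perm_id.
rewrite -ij in uv *; congr (_, _); apply/permP => k; apply: (@lift_inj _ i).
by rewrite -!(lift_perm_lift ord0 i) uv.
Qed.

Definition sym_term t n (x : 'I_n -> L) : L :=
  (\prod_(i < n | (i < size t)%N) dbracket b (x i) (nth 0%N t i)) *
  \prod_(i < n | (i < size t)%N) \prod_(j < n | (i < j)%N) oratio (x i) (x j).

Definition sym_sum t n (x : 'I_n -> L) : L :=
  \sum_(w : 'S_n) sym_term t (fun i => x (w i)).

Lemma sym_termS l t n (x : 'I_n.+1 -> L) : sym_term (l :: t) x =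
  \prod_(j < n) oratio (x ord0) (x (lift ord0 j)) * dbracket b (x ord0) l *
  sym_term t (fun j => x (lift ord0 j)).
Proof.
have prodS (f : 'I_n.+1 -> L) : \prod_(i < n.+1 | (i < (size t).+1)%N) f i =
    f ord0 * \prod_(i < n | (i < size t)%N) f (lift ord0 i).
  by rewrite [LHS]big_mkcond big_ord_recl [in RHS]big_mkcond.
have prodl (f : 'I_n.+1 -> L) (i : 'I_n) : \prod_(j < n.+1 | (lift ord0 i < j)%N) f j =
    \prod_(j < n | (i < j)%N) f (lift ord0 j).
  by rewrite [LHS]big_mkcond big_ord_recl [in RHS]big_mkcond /= mul1r.
have prod0 (f : 'I_n.+1 -> L) : \prod_(j < n.+1 | (@ord0 n < j)%N) f j = \prod_(j < n) f (lift ord0 j).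
  by rewrite [LHS]big_mkcond big_ord_recl /= mul1r.
rewrite /sym_term /= !prodS prod0; under [X in _ * (_ * X)]eq_bigr do rewrite prodl.
by rewrite mulrACA [dbracket _ _ _ * _]mulrC.
Qed.

Lemma perm_enum_lift n (i : 'I_n.+1) : perm_eq (enum 'I_n.+1) (i :: map (lift i) (enum 'I_n)).
Proof.
apply: uniq_perm; first exact: enum_uniq.
  rewrite cons_uniq (map_inj_uniq (@lift_inj _ i)) enum_uniq andbT.
  by apply/mapP => -[j _ /eqP]; rewrite (negPf (neq_lift _ _)).
move=> j; rewrite mem_enum; case: (unliftP i j) => [k ->|->]; last by rewrite mem_head.
by rewrite in_cons map_f ?orbT ?mem_enum.
Qed.

(** Once the r rows have received their variables, the term no longer depends on the order of the
    others: hence the factorial, which the normalization of [GQ_at] cancels. *)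
Lemma sym_sum_grow t n (x : 'I_n -> L) : (size t <= n)%N ->
  sym_sum t x = ((n - size t)`!)%:R * grow t (map x (enum 'I_n)).
Proof.
elim: t n x => [|l t IH] n x /=.
  move=> _; rewrite subn0 mulr1 /sym_sum (eq_bigr (fun=> 1)) => [|w _].
    by rewrite sumr_const card_Sn.
  by rewrite /sym_term !big_pred0 ?mulr1.
case: n x => // n x tn; rewrite /sym_sum big_perm_lift subSS /grow /= big_map big_enum mulr_sumr.
apply: eq_bigr => i _ /=; set x' := fun j => x (lift i j).
have remE : perm_eq (rem (x i) (map x (enum 'I_n.+1))) (map x' (enum 'I_n)).
  have := perm_map x (perm_enum_lift i); rewrite /= -map_comp => p.
  rewrite -(perm_cons (x i)) -(permPr p) perm_sym perm_to_rem //.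
  by rewrite map_f ?mem_enum.
rewrite (perm_big _ remE) (row_rec_perm _ _ _ remE) big_map big_enum /= mulrCA -(IH n x') //.
rewrite mulr_sumr; apply: eq_bigr => u _; rewrite sym_termS lift_perm_id.
have -> : (fun j => x (lift_perm ord0 i u (lift ord0 j))) = (fun j => x' (u j)).
  by apply: funext => j; rewrite lift_perm_lift.
congr (_ * _ * _); rewrite [RHS](reindex_inj (@perm_inj _ u)).
by apply: eq_bigr => j _; rewrite lift_perm_lift.
Qed.

Lemma GQ_at_grow t n (x : 'I_n -> L) : (forall n, n.+1%:R != 0 :> L) ->
  (size t <= n)%N -> GQ_at b t x = grow t (map x (enum 'I_n)).
Proof.
move=> char0 tn; rewrite /GQ_at -/(sym_sum t x) sym_sum_grow // mulKf //.
by case: (_`!) (fact_gt0 (n - size t)) => // k _; exact: char0.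
Qed.

End Symmetrization.

(* [gser] as a polynomial in the grading variable. *)
Definition gpoly (L : fieldType) (a b : L) : seq nat -> seq L -> {poly L} := row_rec
  (fun xi eta => ((xi - eta)^-1)%:P * ((xi + eta)%:P + (2 * a * xi * eta)%:P * 'X) *
                 (1 + b%:P * (eta%:P * 'X)))
  (fun n xi => (2 + b%:P * (xi%:P * 'X)) * (xi%:P * 'X) ^+ n).

(** At t = 1 the ratio times 1 + b eta is the oplus/ominus ratio. Rows are positive here: at n = 0
    [dbracket] is 1, whereas [gpoly] has 2 + b xi. *)
Lemma gpoly_horner1 (L : fieldType) (a b : L) t s : b = 2 * a -> all (ltn 0) t ->
  (gpoly a b t s).[1] = grow b t s.
Proof.
move=> ba; elim: t s => [|n t IH] s /=; first by rewrite hornerC.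
move=> /andP[n0 t0]; rewrite /gpoly /grow /= horner_sum; apply: eq_bigr => xi _.
rewrite !hornerM IH // horner_prod; congr (_ * _ * _).
  apply: eq_bigr => eta _; rewrite !hornerE /oratio /oplus /ominus ba invf_div.
  by rewrite /=; move: (xi - eta)^-1 => v; ring.
by rewrite /dbracket gtn_eqF // !hornerE /= mulr1.
Qed.

Lemma gser_gpoly (L : fieldType) (iota : {rmorphism Qbeta -> L}) t s :
  gser iota t s = fps_poly (gpoly (iota (beta / 2)) (iota beta) t s).
Proof.
rewrite /gpoly rmorph_row_rec /gser; move: (iota (beta / 2)) (iota beta) => a b.
have M (p q : {poly L}) : fps_poly (p * q) = fps_poly p * fps_poly q := rmorphM _ p q.
have D (p q : {poly L}) : fps_poly (p + q) = fps_poly p + fps_poly q := rmorphD _ p q.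
have one : fps_poly 1 = 1 :> fps L := rmorph1 (@fps_poly L).
apply: eq_row_rec => [xi eta|n xi]; first by rewrite /= !M !D !M one.
have n2 : fps_poly 2 = 2 :> fps L := rmorph_nat (@fps_poly L) 2.
by rewrite /= !M D rmorphXn /= !M n2.
Qed.

(** * Restriction to finitely many variables *)

Section Truncation.
Variable n : nat.
Implicit Types k : multinom n.

Definition cmbound mu := forall i, (n <= i)%N -> mu i = 0%N.

Definition untrunc k : {cmonom nat} :=
  mkcmonom [fsfun i in seq_fset tt (iota 0 n) =>
              (if insub i is Some j then k j else 0)%N | 0%N].

Lemma untruncE k (i : nat) : untrunc k i = if insub i is Some j then k j else 0%N.
Proof.
rewrite /untrunc cmE [LHS]fsfunE seq_fsetE mem_iota add0n.
by case: insubP => [j ->|/= /negPf ->].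
Qed.

Lemma trunc_monomE mu (i : 'I_n) : trunc_monom n mu i = mu (i : nat).
Proof. by rewrite mnmE. Qed.

Lemma untruncK k : trunc_monom n (untrunc k) = k.
Proof. by apply/mnmP => i; rewrite trunc_monomE untruncE valK. Qed.

Lemma trunc_monomK mu : cmbound mu -> untrunc (trunc_monom n mu) = mu.
Proof.
move=> mun; apply/eqP/cmP => i; rewrite untruncE.
by case: insubP => [j _ <-|]; [rewrite trunc_monomE | rewrite -leqNgt => /mun ->].
Qed.

Lemma trunc_monomM mu nu :
  trunc_monom n (mmul mu nu) = (trunc_monom n mu + trunc_monom n nu)%MM.
Proof. by apply/mnmP => i; rewrite mnmDE !trunc_monomE cmM. Qed.

Lemma trunc_monom1 : trunc_monom n mone = 0%MM.
Proof. by apply/mnmP => i; rewrite mnm0E trunc_monomE cm1. Qed.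

Lemma untruncD k l : untrunc (k + l)%MM = mmul (untrunc k) (untrunc l).
Proof.
apply/eqP/cmP => i; rewrite cmM !untruncE.
by case: insubP => // j _ _; rewrite mnmDE.
Qed.

(** [q] is [f] with all variables beyond the n-th set to 0; monomials involving these are
    ignored. *)
Definition restricts (f : mseries Qbeta) (q : mpoly n Qbeta) :=
  forall mu, cmbound mu -> f mu = q@_(trunc_monom n mu).

Lemma restricts_one : restricts mseries_one 1.
Proof.
move=> mu mun; rewrite /mseries_one mcoeff1; congr ((nat_of_bool _)%:R).
apply/eqP/eqP => [->|e]; first exact: trunc_monom1.
rewrite -(trunc_monomK mun) e -trunc_monom1 trunc_monomK // => i _; exact: cm1.
Qed.

Lemma restricts_mul f g p q :
  restricts f p -> restricts g q -> restricts (mseries_mul f g) (p * q).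
Proof.
move=> fp gq mu mun; set m := trunc_monom n mu.
have bnd q1 q2 : mmul q1 q2 = mu -> cmbound q1 /\ cmbound q2.
  by move=> q12; split=> i /mun; rewrite -q12 cmM => /eqP; rewrite addn_eq0 => /andP[/eqP ? /eqP ?].
rewrite mcoeffM /mseries_mul.
pose B := (bmultinom n (mpoly.mdeg m).+1 * bmultinom n (mpoly.mdeg m).+1)%type.
pose r := [seq (untrunc u.1, untrunc u.2) |
  u : B <- [seq u : B <- index_enum B | m == (u.1 + u.2)%MM]].
rewrite (@fsbig_fwiden _ _ _ _ r) /=; last 3 first.
- move=> [q1 q2] /= q12; have [b1 b2] := bnd _ _ q12.
  have mE : m = (trunc_monom n q1 + trunc_monom n q2)%MM by rewrite -trunc_monomM q12.
  have h1 : (mpoly.mdeg (trunc_monom n q1) < (mpoly.mdeg m).+1)%N.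
    by rewrite ltnS mE mpoly.mdegD leq_addr.
  have h2 : (mpoly.mdeg (trunc_monom n q2) < (mpoly.mdeg m).+1)%N.
    by rewrite ltnS mE mpoly.mdegD leq_addl.
  apply/mapP; exists (BMultinom h1, BMultinom h2); last by rewrite /= !trunc_monomK.
  by rewrite mem_filter mem_index_enum /= andbT; apply/eqP.
- rewrite map_inj_uniq ?filter_uniq ?index_enum_uniq // => -[k1 k2] [l1 l2] /= [].
  move=> /(congr1 (trunc_monom n)) + /(congr1 (trunc_monom n)); rewrite !untruncK.
  by move=> /val_inj -> /val_inj ->.
- move=> [q1 q2] /= [/mapP[[k1 k2]]]; rewrite mem_filter => /andP[/eqP /= mE _] [-> ->] [].
  by rewrite -untruncD -mE trunc_monomK.
rewrite big_map big_filter; apply: eq_bigr => k _ /=.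
by rewrite fp ?gq ?untruncK // => i ni; rewrite untruncE insubF // ltnNge ni.
Qed.

Definition psum (d : nat) : mpoly n Qbeta := \sum_(i < n) 'X_i ^+ d.

Lemma expcmnE mu d i : expcmn mu d i = (mu i * d)%N.
Proof.
elim: d => [|[|d] IH]; first by rewrite muln0 [LHS]onecmE.
  by rewrite muln1.
have -> : expcmn mu d.+2 = mulcm mu (expcmn mu d.+1) by [].
by rewrite mulcmE IH [RHS]mulnS.
Qed.

Lemma restricts_powersum d : restricts (powersum d.+1) (psum d.+1).
Proof.
move=> mu mun; rewrite /powersum raddf_sum /=.
have XE (i : 'I_n) : ('X_i ^+ d.+1)@_(trunc_monom n mu) = (mu == expcmn (ucm (i : nat)) d.+1)%:R :> Qbeta.
  rewrite mcoeffXn; congr ((nat_of_bool _)%:R).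
  apply/eqP/eqP => [e|->].
    apply/eqP/cmP => j; rewrite expcmnE ucmE; case: (ltnP j n) => [jn|nj].
      have := congr1 (fun k : multinom n => k (Ordinal jn)) e.
      by rewrite /= mulmnE mnm1E trunc_monomE /= => <-; rewrite -val_eqE.
    by rewrite mun // (_ : (i == j :> nat) = false) //; apply/negbTE; rewrite neq_ltn (leq_trans _ nj).
  by apply/mnmP => j; rewrite mulmnE mnm1E trunc_monomE expcmnE ucmE -val_eqE.
under eq_bigr do rewrite XE.
have [[j muE]|nex] := asboolP (exists i : nat, mu = expcmn (ucm i) d.+1); last first.
  rewrite big1 // => i _; case: eqP => // muE.
  by case: nex; exists (i : nat).
have jn : (j < n)%N.
  by rewrite ltnNge; apply/negP => /mun; rewrite muE expcmnE ucmE eqxx mul1n.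
rewrite (bigD1 (Ordinal jn)) //= muE eqxx big1 ?addr0 // => i ij.
case: eqP => // e; have : expcmn (ucm j) d.+1 j = expcmn (ucm (i : nat)) d.+1 j by rewrite e.
rewrite !expcmnE !ucmE eqxx; move: ij; rewrite -val_eqE /= => /negPf ->.
by rewrite mul1n mul0n.
Qed.

Lemma restricts_powersum_monom kappa :
  restricts (powersum_monom kappa) (cmeval psum kappa).
Proof.
rewrite /powersum_monom /cmeval.
apply: (big_rec2 restricts) => [|i q f _ fq]; first exact: restricts_one.
apply: restricts_mul fq; elim: (kappa i) => [|c IH]; first exact: restricts_one.
by rewrite exprS /=; apply: restricts_mul IH; exact: restricts_powersum.
Qed.

Lemma psum_homog d : psum d \is d.-homog.
Proof.
apply: rpred_sum => i _.
rewrite mpolyXn dhomogX; apply/eqP.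
by rewrite -[LHS]/(mpoly.mdeg _) mpoly.mdegMn mpoly.mdeg1 mul1n.
Qed.

(** Homogeneity ties the weight in the p_n to the degree in the x_i; it makes the substitution of
    power sums finite at each monomial. *)
Lemma cmeval_homog kappa m : mpoly.mdeg m != cmwt kappa -> (cmeval psum kappa)@_m = 0.
Proof.
move=> mk; have /dhomog_nemf_coeff -> // : cmeval psum kappa \is (cmwt kappa).-homog.
rewrite /cmeval /cmwt; apply: (big_rec2 (fun p d => p \is d.-homog)) => [|i q d _ dq].
  exact: dhomog1.
apply: dhomogM dq; elim: (kappa i) => [|c IH]; first by rewrite muln0 expr0; exact: dhomog1.
by rewrite exprS mulnS; apply: dhomogM IH; exact: psum_homog.
Qed.

End Truncation.

(** * The function GQ in n variables as a polynomial *)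

Section PolynomialExpansion.
Context (A : algType Qbeta) (phi : int -> A) (phiP : is_fermion_algebra phi).
Context (F : lmodType A) (vac : F) (vacP : is_fock phi vac).
Context (E : lmodType A^c) (covac : E) (covacP : is_dual_fock phi covac).
Context (pairing : E -> F -> Qbeta).
Hypothesis pairingP : is_vacuum_pairing phi vac covac pairing.
Variable n : nat.
Implicit Types (t : seq nat) (d : nat).

Local Notation vev := (vev phi vac covac pairing).
Local Notation L := {fraction mpoly n Qbeta}.

Definition coefL : {rmorphism Qbeta -> L} := (@tofrac (mpoly n Qbeta)) \o (@mpolyC n Qbeta).

Definition xvar (i : 'I_n) : L := tofrac 'X_i.

Lemma xvar_inj : injective xvar.
Proof.
move=> i j /eqP; rewrite tofrac_eq => /eqP /(congr1 (mcoeff U_(i))).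
by rewrite !mcoeffXU eqxx; case: eqP => // _ /eqP; rewrite oner_eq0.
Qed.

Definition vev_part t d : mpoly n Qbeta :=
  \sum_(kappa <- cmsphere d) (vev t kappa)%:MP_[n] * cmeval (psum n) kappa.

Lemma vevE t kappa : vev t kappa =
  vev0 vac pairing (foldl (fun w m => expTheta phi (phib phi m w)) (Hcoef phi covac kappa) t).
Proof.
rewrite /Defs.vev /vev0 /Hcoef; congr pairing.
by elim: t (expHam _ _) => //= m t IH v; rewrite IH.
Qed.

(** The part of weight d at power sums is the coefficient of t^d of the paired product of vertex
    operators, with the xi_i the variables themselves; they are distinct, as the recursion
    requires. *)
Lemma tofrac_vev_part t d : all (ltn 0) t ->
  tofrac (vev_part (if odd (size t) then t ++ [:: 0%N] else t) d) =
  fcoef (gser coefL t (map xvar (enum 'I_n))) d.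
Proof.
move=> t0; set t' := if _ then _ else _.
have us : uniq (map xvar (enum 'I_n)) by rewrite (map_inj_uniq xvar_inj) enum_uniq.
rewrite -(vops_Fvev_covac phiP vacP covacP pairingP coefL t0 us) -/t'.
have lf := Fvev_flin phiP covacP pairingP coefL t'.
rewrite [RHS](vops_expH phiP covacP _ _ lf) rmorph_sum; apply: eq_bigr => kappa _.
rewrite rmorphM -vevE; congr (_ * _).
rewrite (rmorph_cmeval (@tofrac _)); apply: eq_bigr => i _; congr (_ ^+ _).
by rewrite /= rmorph_sum big_map big_enum; apply: eq_bigr => j _; rewrite rmorphXn.
Qed.

(** [gpoly] has finitely many coefficients in t and their sum, its value at 1, is GQ. So the parts
    of large weight add nothing, and GQ is a polynomial; any larger cut serves too. *)
Lemma GQ_frac_poly t : all (ltn 0) t -> (size t <= n)%N ->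
  exists M, forall M', (M <= M')%N ->
  tofrac (\sum_(d < M') vev_part (if odd (size t) then t ++ [:: 0%N] else t) d) = GQ_frac t n.
Proof.
move=> t0 tn; pose g := gpoly (coefL (beta / 2)) (coefL beta) t (map xvar (enum 'I_n)).
exists (size g) => M' gM; rewrite rmorph_sum.
have ba : coefL beta = 2 * coefL (beta / 2) := iota_beta coefL.
rewrite [RHS](GQ_at_grow (coefL beta) xvar (char0L coefL) tn).
rewrite -(gpoly_horner1 _ ba t0) (horner_coef_wide _ gM); apply: eq_bigr => d _.
by rewrite expr1n mulr1 [LHS](tofrac_vev_part _ t0) gser_gpoly.
Qed.

Lemma vev_part_coef t d mu : cmbound n mu ->
  (vev_part t d)@_(trunc_monom n mu) =
  if d == mpoly.mdeg (trunc_monom n mu) then subst_powersums (vev t) mu else 0.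
Proof.
move=> mun; rewrite /vev_part raddf_sum /=; under eq_bigr do rewrite mcoeffCM.
have [->|dmu] := eqVneq d; last first.
  apply: big1_seq => kappa /= ; rewrite in_cmsphere => /eqP kd.
  by rewrite cmeval_homog ?mulr0 // kd eq_sym.
rewrite /subst_powersums (@fsum_seq _ _ (cmsphere (mpoly.mdeg (trunc_monom n mu)))).
- by apply: eq_bigr => kappa _; rewrite (restricts_powersum_monom kappa mun).
- exact: fset_uniq.
move=> kappa; rewrite in_cmsphere => kd.
by rewrite (restricts_powersum_monom kappa mun) cmeval_homog ?mulr0 // eq_sym.
Qed.

End PolynomialExpansion.

Theorem theorem7p1
  (A : algType Qbeta) (phi : int -> A) (phiP : is_fermion_algebra phi)
  (F : lmodType A) (vac : F) (vacP : is_fock phi vac)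
  (E : lmodType A^c) (covac : E) (covacP : is_dual_fock phi covac)
  (pairing : E -> F -> Qbeta)
  (pairingP : is_vacuum_pairing phi vac covac pairing)
  (lambda : seq nat) (lambdaP : strict_partition lambda) :
  is_GQ lambda
    (subst_powersums
       (vev phi vac covac pairing
          (if odd (size lambda) then lambda ++ [:: 0%N] else lambda))).
Proof.
(* The n variables must accommodate all the rows and include every variable of [mu]. *)
move=> mu; exists (maxn (size lambda) (\max_(i <- finsupp mu) i.+1)) => n.
rewrite geq_max => /andP[ln mun].
have mu_bnd : cmbound n mu.
  move=> i ni; apply: cm_notin; apply/negP => imu.
  have := leq_trans (leq_bigmax_seq i imu isT) mun.
  by rewrite ltnNge ni.
have l0 : all (ltn 0) lambda by case/andP: lambdaP.
have [M PM] := GQ_frac_poly phiP vacP covacP pairingP l0 ln.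
(* The cut is raised beyond the degree of [mu], so that the homogeneous part containing [mu] is one
   of the summands of [P]. *)
have := PM _ (leq_maxl M (mpoly.mdeg (trunc_monom n mu)).+1).
set M' := maxn _ _; set P := \sum_(d < M') _ => PE; exists P => //.
have DM : (mpoly.mdeg (trunc_monom n mu) < M')%N by rewrite leq_max leqnn orbT.
rewrite /P raddf_sum (bigD1 (Ordinal DM)) //= big1 ?addr0 => [|d dD].
  by rewrite vev_part_coef // eqxx.
by rewrite vev_part_coef //; move: dD; rewrite -val_eqE /= => /negPf ->.
Qed.
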